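(* Assume (A0) and (A1), and let $T>0$. Then there exists a unique viscosity solution $u:[0,T)\times J\to\mathbb{R}$ of $u_t+H(x,u_x)=0$ on $J_T$ with initial condition $u(0,\cdot)=u_0$ (in the sense of the definition below) that satisfies, for some constant $C_T>0$, $$|u(t,x)-u_0(x)|\le C_T\quad\text{for all }(t,x)\in J_T.$$ Moreover this $u$ is Lipschitz continuous with respect to $(t,x)$ on $J_T$.
   Context: Junction: fix an integer $N\ge1$ and $N$ distinct unit vectors $e_1,\dots,e_N\in\mathbb{R}^2$. Set $J_i=[0,\infty)e_i$, $J_i^*=J_i\setminus\{0\}$, $J=\bigcup_{i=1}^NJ_i$, $J^*=J\setminus\{0\}$, $I_N=\{1,\dots,N\}$. Each $x\in J_i$ is written $x=x_ie_i$ with $x_i\ge0$. $J$ carries the geodesic distance $d(x,y)=|x-y|$ if $x,y$ lie in a common branch $J_i$, and $d(x,y)=|x|+|y|$ otherwise. For $T>0$, $J_T=(0,T)\times J$; balls $B((t,x),r)$ are taken in $(0,\infty)\times J$. For $u$ defined on $J_T$, $u^i$ is its restriction to $(0,T)\times J_i$, viewed as a function of $(t,x_i)\in(0,T)\times[0,\infty)$. $C^1_*(J_T)$ is the set of continuous $u$ on $J_T$ with each $u^i\in C^1((0,T)\times[0,\infty))$ (one-sided derivative at $x_i=0$); for such $u$, $u_t$ is the time derivative, $u^i_x=\partial u^i/\partial x_i$, $u_x(t,x)=u^i_x(t,x)$ if $x\in J_i^*$, and $u_x(t,0)=(u^1_x(t,0),\dots,u^N_x(t,0))$. (A0): $u_0:J\to\mathbb{R}$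 is Lipschitz continuous with respect to $d$. (A1): there is $\gamma>0$ such that for each $i\in I_N$, $L_i\in C^2(\mathbb{R})$ with $L_i''\ge\gamma$; $H_i(p)=\sup_{q\in\mathbb{R}}(pq-L_i(q))$ and $H_i^-(p)=\sup_{q\le0}(pq-L_i(q))$. Hamiltonian: $H(x,p)=H_i(p)$ for $x\in J_i^*$, $p\in\mathbb{R}$; $H(0,p)=\max_{i\in I_N}H_i^-(p_i)$ for $p=(p_1,\dots,p_N)\in\mathbb{R}^N$. So the equation reads $u^i_t+H_i(u^i_x)=0$ on $(0,T)\times J_i^*$ and $u_t+\max_iH_i^-(u^i_x)=0$ on $(0,T)\times\{0\}$. Viscosity solutions: $u:[0,T)\times J\to\mathbb{R}$ is a sub-solution (resp. super-solution) of $u_t+H(x,u_x)=0$ on $J_T$ if it is upper (resp. lower) semicontinuous and for every $\phi\in C^1_*(J_T)$, every $P=(t,x)\in J_T$ and $r>0$ with $u\le\phi$ (resp. $u\ge\phi$) on $B(P,r)$ and $u(P)=\phi(P)$: if $x\in J_i^*$ then $\phi_t(t,x)+H_i(\phi_x(t,x))\le0$ (resp. $\ge0$); if $x=0$ then $\phi_t(t,0)+\max_{i\in I_N}H_i^-(\phi^i_x(t,0))\le0$ (resp. $\ge0$). It is a sub-solution (resp. super-solution) of the problem with initial condition $u_0$ if in addition $u(0,\cdot)\le u_0$ (resp. $\ge u_0$). A function $u$ is a (viscosity) solution if its upper semicontinuous envelope $u^*$ is a sub-solution and its lower semicontinuous envelope $u_*$ is a super-solution. *)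

(* Defs.v *)
From Stdlib Require Import Reals Lra Classical ClassicalEpsilon.
Open Scope R_scope.

(* Points of R^2. Branch directions are indexed 0..N-1 (paper: 1..N). *)
Definition pt := (R * R)%type.
Definition smul (s : R) (v : pt) : pt := (s * fst v, s * snd v).
Definition enorm (v : pt) : R := sqrt (fst v ^ 2 + snd v ^ 2).
Definition edist (x y : pt) : R := sqrt ((fst x - fst y) ^ 2 + (snd x - snd y) ^ 2).

Definition inJi (e : nat -> pt) (i : nat) (x : pt) : Prop :=
  exists s, 0 <= s /\ x = smul s (e i).
Definition inJ (N : nat) (e : nat -> pt) (x : pt) : Prop :=
  exists i, (i < N)%nat /\ inJi e i x.
Definition same_branch (N : nat) (e : nat -> pt) (x y : pt) : Prop :=
  exists i, (i < N)%nat /\ inJi e i x /\ inJi e i y.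

Definition dJ (N : nat) (e : nat -> pt) (x y : pt) : R :=
  if excluded_middle_informative (same_branch N e x y)
  then edist x y else enorm x + enorm y.

Definition pdist (N : nat) (e : nat -> pt) (t : R) (x : pt) (s : R) (y : pt) : R :=
  Rmax (Rabs (t - s)) (dJ N e x y).

Definition inJT (T : R) (N : nat) (e : nat -> pt) (t : R) (x : pt) : Prop :=
  0 < t < T /\ inJ N e x.
Definition inDom (T : R) (N : nat) (e : nat -> pt) (t : R) (x : pt) : Prop :=
  0 <= t < T /\ inJ N e x.

(* supremum of a set of reals (meaningful when the lub exists) *)
Definition Rsup (E : R -> Prop) : R :=
  match excluded_middle_informative (exists m, is_lub E m) with
  | left h => proj1_sig (constructive_indefinite_description _ h)
  | right _ => 0
  end.

Definition Hi (L : nat -> R -> R) (i : nat) (p : R) : R :=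
  Rsup (fun y => exists q, y = p * q - L i q).
Definition Hminus (L : nat -> R -> R) (i : nat) (p : R) : R :=
  Rsup (fun y => exists q, q <= 0 /\ y = p * q - L i q).

Fixpoint maxUpTo (f : nat -> R) (n : nat) : R :=
  match n with
  | O => f O
  | S k => Rmax (maxUpTo f k) (f (S k))
  end.

Definition H0 (N : nat) (L : nat -> R -> R) (p : nat -> R) : R :=
  maxUpTo (fun j => Hminus L j (p j)) (N - 1).

Definition cont2_on (D : R -> R -> Prop) (f : R -> R -> R) : Prop :=
  forall t s, D t s -> forall eps, eps > 0 -> exists d, d > 0 /\
    forall t' s', D t' s' -> Rabs (t' - t) < d -> Rabs (s' - s) < d ->
      Rabs (f t' s' - f t s) < eps.

Definition HalfStrip (T : R) (t s : R) : Prop := 0 < t < T /\ 0 <= s.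

(* g in C^1((0,T) x [0,oo)) with partial derivatives gt, gx
   (the x-derivative is one-sided at x = 0) *)
Definition C1_half (T : R) (g gt gx : R -> R -> R) : Prop :=
  cont2_on (HalfStrip T) g /\
  cont2_on (HalfStrip T) gt /\ cont2_on (HalfStrip T) gx /\
  forall t s, HalfStrip T t s ->
    derivable_pt_lim (fun t' => g t' s) t (gt t s) /\
    (forall eps, eps > 0 -> exists d, d > 0 /\
       forall h, h <> 0 -> Rabs h < d -> 0 <= s + h ->
         Rabs ((g t (s + h) - g t s) / h - gx t s) < eps).

Definition C1_star (T : R) (N : nat) (e : nat -> pt) (phi : R -> pt -> R)
    (phit phix : nat -> R -> R -> R) : Prop :=
  (forall t x, inJT T N e t x -> forall eps, eps > 0 -> exists d, d > 0 /\
     forall s y, inJT T N e s y -> pdist N e t x s y < d ->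
       Rabs (phi s y - phi t x) < eps) /\
  (forall i, (i < N)%nat ->
     C1_half T (fun t s => phi t (smul s (e i))) (phit i) (phix i)).

Definition usc_on (T : R) (N : nat) (e : nat -> pt) (u : R -> pt -> R) : Prop :=
  forall t x, inDom T N e t x -> forall eps, eps > 0 -> exists r, r > 0 /\
    forall s y, inDom T N e s y -> pdist N e t x s y < r -> u s y < u t x + eps.
Definition lsc_on (T : R) (N : nat) (e : nat -> pt) (u : R -> pt -> R) : Prop :=
  forall t x, inDom T N e t x -> forall eps, eps > 0 -> exists r, r > 0 /\
    forall s y, inDom T N e s y -> pdist N e t x s y < r -> u t x - eps < u s y.

(* U is the upper semicontinuous envelope of u on [0,T) x J:
   U(P) = limsup_{Q -> P} u(Q) (a finite real) *)
Definition is_usc_env (T : R) (N : nat) (e : nat -> pt) (u U : R -> pt -> R) : Prop :=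
  forall t x, inDom T N e t x ->
    (forall eps, eps > 0 -> exists r, r > 0 /\
       forall s y, inDom T N e s y -> pdist N e t x s y < r -> u s y < U t x + eps) /\
    (forall eps r, eps > 0 -> r > 0 -> exists s y,
       inDom T N e s y /\ pdist N e t x s y < r /\ U t x - eps < u s y).
Definition is_lsc_env (T : R) (N : nat) (e : nat -> pt) (u V : R -> pt -> R) : Prop :=
  forall t x, inDom T N e t x ->
    (forall eps, eps > 0 -> exists r, r > 0 /\
       forall s y, inDom T N e s y -> pdist N e t x s y < r -> V t x - eps < u s y) /\
    (forall eps r, eps > 0 -> r > 0 -> exists s y,
       inDom T N e s y /\ pdist N e t x s y < r /\ u s y < V t x + eps).

Definition subsol (T : R) (N : nat) (e : nat -> pt) (L : nat -> R -> R)
    (u : R -> pt -> R) : Prop :=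
  usc_on T N e u /\
  forall phi phit phix, C1_star T N e phi phit phix ->
  forall t x r, inJT T N e t x -> r > 0 ->
    (forall s y, inJT T N e s y -> pdist N e t x s y < r -> u s y <= phi s y) ->
    u t x = phi t x ->
    (forall i s, (i < N)%nat -> 0 < s -> x = smul s (e i) ->
       phit i t s + Hi L i (phix i t s) <= 0) /\
    (x = (0, 0) -> phit 0%nat t 0 + H0 N L (fun j => phix j t 0) <= 0).

Definition supersol (T : R) (N : nat) (e : nat -> pt) (L : nat -> R -> R)
    (u : R -> pt -> R) : Prop :=
  lsc_on T N e u /\
  forall phi phit phix, C1_star T N e phi phit phix ->
  forall t x r, inJT T N e t x -> r > 0 ->
    (forall s y, inJT T N e s y -> pdist N e t x s y < r -> phi s y <= u s y) ->
    u t x = phi t x ->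
    (forall i s, (i < N)%nat -> 0 < s -> x = smul s (e i) ->
       phit i t s + Hi L i (phix i t s) >= 0) /\
    (x = (0, 0) -> phit 0%nat t 0 + H0 N L (fun j => phix j t 0) >= 0).

Definition is_solution (T : R) (N : nat) (e : nat -> pt) (L : nat -> R -> R)
    (u0 : pt -> R) (u : R -> pt -> R) : Prop :=
  exists U V : R -> pt -> R,
    is_usc_env T N e u U /\ is_lsc_env T N e u V /\
    subsol T N e L U /\ (forall x, inJ N e x -> U 0 x <= u0 x) /\
    supersol T N e L V /\ (forall x, inJ N e x -> V 0 x >= u0 x).

(* Main.v *)
Require Import Defs.
From Stdlib Require Import Reals Lra Lia Classical ClassicalEpsilon IndefiniteDescription.
Open Scope R_scope.

(** The solution is an explicit Hopf-Lax value function. A trajectory ending at the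
    vertex runs straight down one branch and then waits at the cheapest cost
    [l0 = min_j L_j(0)]; a trajectory ending inside a branch is straight inside that
    branch, starting either at time 0 or at the vertex. Convexity (Jensen) gives the
    dynamic programming inequality along segments, cutting off the beginning of a
    trajectory gives the Lipschitz bound in time, and the two together give the Lipschitz
    bound in space and the sub- and supersolution properties.

    Uniqueness needs no doubling of variables. A subsolution decreases along every
    segment up to the running cost, since it satisfies a transport inequality for each
    velocity, so it lies below the value. For a supersolution [V], one minimises [V] plus
    the cost-to-go to a target slightly in the future plus an increasing function of time.
    The cost-to-go is locally bounded above, with contact, by polynomials whose opposites
    solve the equation, so an interior minimum would contradict the supersolution
    inequality; hence the minimum lies at time 0, and [V] is above the value. This is done
    first for targets at the vertex, then on each branch with the vertex as a boundary. *)

(** * Lower semicontinuous minimisation *)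

(** The obstacle is the vertex, where the equation only sees [Hminus], hence velocities [q <= 0].
    For subsolutions, a segment leaving the vertex is therefore a limit of segments that start
    slightly inside the branch. For supersolutions, the straight cost-to-go [th * L j (- y / th)]
    cannot be turned into a test function near the vertex: at [y = 0] its value [th * L j 0] may
    change with the branch and exceed the waiting cost. The waiting cost is lowered to
    [l = l0 - eps], strictly below every [L j 0], so that from height [l] on the vertical axis one
    can draw a tangent to each [L j] that touches it at a strictly negative speed. Following this
    tangent line gives a cost that is linear in time and space around the vertex and agrees across
    the branches, with slopes satisfying [Hminus <= - l]. The price is at most [eps] per unit of
    time.

    Targets are placed slightly in the future because the perspective [th * L (w / th)] degenerates
    at [th = 0]; the bound on the value in time absorbs the delay. *)

Lemma interval_cover_induction (B : (R -> Prop) -> Prop) (a b : R) :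
  (forall S S' : R -> Prop, (forall x, S x -> S' x) -> B S' -> B S) ->
  (forall S S' : R -> Prop, B S -> B S' -> B (fun x => S x \/ S' x)) ->
  a <= b ->
  (forall x, a <= x <= b -> exists d, d > 0 /\
     B (fun y => a <= y <= b /\ Rabs (y - x) < d)) ->
  B (fun x => a <= x <= b).
Proof.
  intros Hsub Hun Hab Hloc.
  (* Heine-Borel by a supremum: [E] collects the [x] up to which [B] is established, and the
     neighbourhood of [sup E] given by [Hloc] carries [E] past it unless [b] is reached. *)
  set (E := fun x => a <= x <= b /\ B (fun y => a <= y <= x)).
  assert (Ea : E a).
  { split; [lra|]. destruct (Hloc a) as [d [Hd HB]]; [lra|].
    eapply Hsub; [|exact HB]. intros y Hy. cbn in Hy. split; [lra|].
    replace (y - a) with 0 by lra. rewrite Rabs_R0; lra. }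
  destruct (completeness E) as [m [Hm1 Hm2]].
  { exists b. intros x [Hx _]. lra. }
  { exists a; exact Ea. }
  assert (Ham : a <= m) by (apply Hm1; exact Ea).
  assert (Hmb : m <= b) by (apply Hm2; intros x [Hx _]; lra).
  destruct (Hloc m) as [d [Hd HB]]; [lra|].
  assert (Hx : exists x, E x /\ m - d < x).
  { apply NNPP. intro Hn. assert (m <= m - d); [|lra].
    apply Hm2. intros x Ex. apply Rnot_lt_le. intro Hlt. apply Hn. exists x; split; assumption. }
  destruct Hx as [x [[Hx1 Hx2] Hx3]].
  assert (Hbig : forall z, a <= z <= b -> z < m + d -> B (fun y => a <= y <= z)).
  { intros z Hz1 Hz2. eapply Hsub; [|exact (Hun _ _ Hx2 HB)].
    intros y Hy. cbn in *. destruct (Rle_dec y x) as [Hyx|Hyx]; [left; lra|right].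
    split; [lra|]. apply Rabs_def1; lra. }
  destruct (Rlt_le_dec b (m + d)) as [Hc|Hc]; [apply Hbig; lra|].
  assert (m + d / 2 <= m); [|lra].
  apply Hm1. split; [lra|]. apply Hbig; lra.
Qed.

Definition lsc_box (a b c d : R) (f : R -> R -> R) : Prop :=
  forall s y, a <= s <= b -> c <= y <= d -> forall eps, eps > 0 -> exists r, r > 0 /\
    forall s' y', a <= s' <= b -> c <= y' <= d -> Rabs (s' - s) < r -> Rabs (y' - y) < r ->
      f s y - eps < f s' y'.

(* If the minimum were not attained, every point would have a neighbourhood on
   which [f] is strictly above some fixed value of [f]; such sets are stable under
   finite unions, so the whole box would be one. *)
Lemma lsc_box_min (a b c d : R) (f : R -> R -> R) :
  a <= b -> c <= d -> lsc_box a b c d f ->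
  exists s y, a <= s <= b /\ c <= y <= d /\
    forall s' y', a <= s' <= b -> c <= y' <= d -> f s y <= f s' y'.
Proof.
  intros Hab Hcd Hl. apply NNPP. intro Hno.
  set (beaten := fun S : R -> R -> Prop => exists s y, a <= s <= b /\ c <= y <= d /\
     forall s' y', S s' y' -> f s y < f s' y').
  assert (Hsub : forall S S' : R -> R -> Prop, (forall x y, S x y -> S' x y) -> beaten S' -> beaten S).
  { intros S S' HS [s [y [H1 [H2 H3]]]]. exists s, y. repeat split; try tauto. intros; apply H3; auto. }
  assert (Hun : forall S S' : R -> R -> Prop, beaten S -> beaten S' -> beaten (fun x y => S x y \/ S' x y)).
  { intros S S' [s [y [H1 [H2 H3]]]] [s' [y' [H1' [H2' H3']]]].
    destruct (Rle_dec (f s y) (f s' y')) as [Hc|Hc].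
    - exists s, y. repeat split; try tauto. intros p q [Hp|Hp]; [auto|].
      apply Rle_lt_trans with (1 := Hc). auto.
    - exists s', y'. repeat split; try tauto. intros p q [Hp|Hp]; [|auto].
      apply Rlt_trans with (f s y); [lra|auto]. }
  assert (Hloc : forall s y, a <= s <= b -> c <= y <= d -> exists r, r > 0 /\
     beaten (fun s' y' => (a <= s' <= b /\ c <= y' <= d) /\ Rabs (s' - s) < r /\ Rabs (y' - y) < r)).
  { intros s y Hs Hy.
    assert (Hex : exists s1 y1, a <= s1 <= b /\ c <= y1 <= d /\ f s1 y1 < f s y).
    { apply NNPP. intro Hn. apply Hno. exists s, y. repeat split; try tauto.
      intros s' y' Hs' Hy'. apply Rnot_lt_le. intro Hlt. apply Hn. exists s', y'. tauto. }
    destruct Hex as [s1 [y1 [H1 [H2 H3]]]].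
    destruct (Hl s y Hs Hy (f s y - f s1 y1)) as [r [Hr Hr']]; [lra|].
    exists r. split; [exact Hr|]. exists s1, y1. repeat split; try tauto.
    intros s' y' [[G1 G2] [G3 G4]]. specialize (Hr' s' y' G1 G2 G3 G4). lra. }
  assert (Hall : beaten (fun s y => a <= s <= b /\ c <= y <= d)).
  { apply (interval_cover_induction
      (fun S => beaten (fun s y => S s /\ c <= y <= d)) a b); auto.
    - intros S S' HS. apply Hsub. intuition.
    - intros S S' H1 H2. eapply Hsub; [|exact (Hun _ _ H1 H2)]. cbn; tauto.
    - intros s Hs.
      assert (HH : exists r, r > 0 /\
          beaten (fun s' y' => (a <= s' <= b /\ Rabs (s' - s) < r) /\ c <= y' <= d)).
      (* Tube lemma: the radius [r] in the first variable is part of the property propagated along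
         the second, and a union takes the smaller radius. *)
      { apply (interval_cover_induction (fun S => exists r, r > 0 /\
          beaten (fun s' y' => (a <= s' <= b /\ Rabs (s' - s) < r) /\ S y')) c d); auto.
        - intros S S' HS [r [Hr HB]]. exists r; split; [exact Hr|].
          eapply Hsub; [|exact HB]. cbn; intuition.
        - intros S S' [r [Hr HB]] [r' [Hr' HB']]. exists (Rmin r r').
          split; [apply Rmin_glb_lt; lra|].
          eapply Hsub; [|exact (Hun _ _ HB HB')].
          intros p q [[P1 P2] P3]. pose proof (Rmin_l r r'). pose proof (Rmin_r r r').
          destruct P3; [left|right]; repeat split; try tauto; lra.
        - intros y Hy. destruct (Hloc s y Hs Hy) as [r [Hr HB]].
          exists r; split; [exact Hr|]. exists r; split; [exact Hr|].
          eapply Hsub; [|exact HB]. cbn; tauto. }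
      destruct HH as [r [Hr HB]]. exists r; split; [exact Hr|]. exact HB. }
  destruct Hall as [s [y [H1 [H2 H3]]]]. specialize (H3 s y (conj H1 H2)). lra.
Qed.

Lemma finite_min (P : nat -> R -> Prop) (n : nat) :
  (1 <= n)%nat -> (forall i, (i < n)%nat -> exists m, P i m) ->
  exists i m, (i < n)%nat /\ P i m /\
    forall j, (j < n)%nat -> exists m', P j m' /\ m <= m'.
Proof.
  induction n as [|n IH]; intros Hn Hex; [lia|].
  destruct (Hex n) as [m0 Hm0]; [lia|].
  destruct (Nat.eq_dec n 0) as [->|Hn0].
  - exists 0%nat, m0. split; [lia|]. split; [exact Hm0|]. intros j Hj.
    replace j with 0%nat by lia. exists m0; split; [exact Hm0|lra].
  - destruct IH as [i [m [Hi [Hm Hmin]]]]; [lia|intros; apply Hex; lia|].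
    destruct (Rle_dec m m0) as [Hc|Hc].
    + exists i, m. split; [lia|]. split; [exact Hm|]. intros j Hj.
      destruct (Nat.eq_dec j n) as [->|]; [exists m0; auto|apply Hmin; lia].
    + exists n, m0. split; [lia|]. split; [exact Hm0|]. intros j Hj.
      destruct (Nat.eq_dec j n) as [->|]; [exists m0; split; [exact Hm0|lra]|].
      destruct (Hmin j) as [m' [Hm' Hle]]; [lia|]. exists m'; split; [exact Hm'|lra].
Qed.

Lemma finite_upper_bound (P : nat -> R -> Prop) (n : nat) :
  (forall i, (i < n)%nat -> exists B, forall B', B <= B' -> P i B') ->
  exists B, forall i B', (i < n)%nat -> B <= B' -> P i B'.
Proof.
  induction n as [|n IH]; intros Hex; [exists 0; intros; lia|].
  destruct IH as [B1 HB1]; [intros; apply Hex; lia|].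
  destruct (Hex n) as [B2 HB2]; [lia|].
  exists (Rmax B1 B2). intros i B' Hi HB.
  pose proof (Rmax_l B1 B2). pose proof (Rmax_r B1 B2).
  destruct (Nat.eq_dec i n) as [->|]; [apply HB2; lra|apply HB1; [lia|lra]].
Qed.

Lemma finite_bound (f : nat -> R) (n : nat) :
  exists B, forall i, (i < n)%nat -> f i <= B.
Proof.
  destruct (finite_upper_bound (fun i B => f i <= B) n) as [B HB].
  - intros i _. exists (f i). auto.
  - exists B. intros i Hi. apply HB; [exact Hi|lra].
Qed.

Lemma lsc_family_min (n : nat) (a b c d : R) (f : nat -> R -> R -> R) :
  (1 <= n)%nat -> a <= b -> c <= d ->
  (forall i, (i < n)%nat -> lsc_box a b c d (f i)) ->
  exists i s y, (i < n)%nat /\ a <= s <= b /\ c <= y <= d /\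
    forall j s' y', (j < n)%nat -> a <= s' <= b -> c <= y' <= d -> f i s y <= f j s' y'.
Proof.
  intros Hn Hab Hcd Hl.
  destruct (finite_min (fun i m => exists s y, a <= s <= b /\ c <= y <= d /\ m = f i s y /\
    forall s' y', a <= s' <= b -> c <= y' <= d -> m <= f i s' y') n Hn)
    as [i [m [Hi [[s [y [Hs [Hy [-> Hm]]]]] Hmin]]]].
  - intros i Hi. destruct (lsc_box_min a b c d (f i) Hab Hcd (Hl i Hi)) as [s [y [H1 [H2 H3]]]].
    exists (f i s y), s, y. auto.
  - exists i, s, y. repeat split; try tauto. intros j s' y' Hj Hs' Hy'.
    destruct (Hmin j Hj) as [m' [[s1 [y1 [_ [_ [-> Hm']]]]] Hle]].
    eapply Rle_trans; [exact Hle|auto].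
Qed.

(** * Squared positive part and joint continuity in two variables *)

Definition pospart2 (b s : R) : R := Rmax 0 (s - b) ^ 2.

Lemma pospart2_expand (b s h : R) :
  Rabs (pospart2 b (s + h) - pospart2 b s - 2 * Rmax 0 (s - b) * h) <= h ^ 2.
Proof.
  unfold pospart2. apply Rabs_le.
  assert (E : s + h - b = (s - b) + h) by ring. rewrite E. clear E.
  generalize (s - b); intro x.
  unfold Rmax. destruct (Rle_dec 0 (x + h)), (Rle_dec 0 x); split; nra.
Qed.

Lemma derivable_pospart2 (b s : R) :
  derivable_pt_lim (pospart2 b) s (2 * Rmax 0 (s - b)).
Proof.
  intros eps Heps. exists (mkposreal eps Heps). intros h Hh Hhe. cbn in Hhe.
  pose proof (pospart2_expand b s h) as HE.
  replace ((pospart2 b (s + h) - pospart2 b s) / h - 2 * Rmax 0 (s - b))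
    with ((pospart2 b (s + h) - pospart2 b s - 2 * Rmax 0 (s - b) * h) / h) by (field; exact Hh).
  unfold Rdiv. rewrite Rabs_mult, Rabs_inv.
  assert (0 < Rabs h) by (apply Rabs_pos_lt; exact Hh).
  apply Rle_lt_trans with (h ^ 2 * / Rabs h).
  - apply Rmult_le_compat_r; [left; apply Rinv_0_lt_compat; lra|exact HE].
  - rewrite <- (pow2_abs h). replace (Rabs h ^ 2 * / Rabs h) with (Rabs h) by (field; lra). exact Hhe.
Qed.

Lemma continuity_pospart2 (b : R) : continuity (pospart2 b).
Proof.
  intro s. apply derivable_continuous_pt. exists (2 * Rmax 0 (s - b)). apply derivable_pospart2.
Qed.

Lemma continuity_Rmax (c : R) : continuity (fun s => Rmax c s).
Proof.
  intros x eps Heps. exists eps. split; [exact Heps|].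
  intros y [_ Hy]. cbn in *. unfold Rdist in *.
  eapply Rle_lt_trans; [|exact Hy].
  apply Rabs_le. unfold Rabs. destruct (Rcase_abs (y - x)); unfold Rmax;
  destruct (Rle_dec c y), (Rle_dec c x); split; lra.
Qed.

Lemma cont2_const D c : cont2_on D (fun _ _ => c).
Proof. intros t s _ eps He. exists 1. split; [lra|]. intros. rewrite Rminus_diag, Rabs_R0. lra. Qed.

Lemma cont2_fst D : cont2_on D (fun t _ => t).
Proof. intros t s _ eps He. exists eps. split; [lra|]. auto. Qed.

Lemma cont2_snd D : cont2_on D (fun _ s => s).
Proof. intros t s _ eps He. exists eps. split; [lra|]. auto. Qed.

Lemma cont2_comp D (g : R -> R) f :
  cont2_on D f -> (forall t s, D t s -> continuity_pt g (f t s)) -> cont2_on D (fun t s => g (f t s)).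
Proof.
  intros Hf Hg t s Hts eps He.
  destruct (Hg t s Hts eps He) as [d [Hd Hgd]].
  destruct (Hf t s Hts d Hd) as [r [Hr Hfr]]. exists r. split; [exact Hr|].
  intros t' s' H' H1 H2. specialize (Hfr t' s' H' H1 H2).
  destruct (Req_dec (f t' s') (f t s)) as [->|Hne].
  - rewrite Rminus_diag, Rabs_R0. lra.
  - apply (Hgd (f t' s')). split; [split; [exact I|auto]|exact Hfr].
Qed.

Lemma cont2_plus D f g : cont2_on D f -> cont2_on D g -> cont2_on D (fun t s => f t s + g t s).
Proof.
  intros Hf Hg t s Hts eps He.
  destruct (Hf t s Hts (eps / 2)) as [d1 [Hd1 H1]]; [lra|].
  destruct (Hg t s Hts (eps / 2)) as [d2 [Hd2 H2]]; [lra|].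
  exists (Rmin d1 d2). split; [apply Rmin_glb_lt; lra|].
  intros t' s' H' Ht Hs. pose proof (Rmin_l d1 d2). pose proof (Rmin_r d1 d2).
  assert (A1 := H1 t' s' H' ltac:(lra) ltac:(lra)). assert (A2 := H2 t' s' H' ltac:(lra) ltac:(lra)).
  apply Rabs_def2 in A1; apply Rabs_def2 in A2. apply Rabs_def1; lra.
Qed.

(** Polarisation: the product is a quarter of the difference of the squares of [f + g] and [f - g],
    so sums and composition with a function of one variable suffice. *)
Lemma cont2_mult D f g : cont2_on D f -> cont2_on D g -> cont2_on D (fun t s => f t s * g t s).
Proof.
  intros Hf Hg.
  assert (Hsq : forall h, cont2_on D h -> cont2_on D (fun t s => (h t s) ^ 2)).
  { intros h Hh. apply (cont2_comp D (fun x => x ^ 2)); [exact Hh|].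
    intros t s _. apply derivable_continuous_pt, derivable_pt_pow. }
  assert (Hc : forall c h, cont2_on D h -> cont2_on D (fun t s => c * h t s)).
  { intros c h Hh. apply (cont2_comp D (fun x => c * x)); [exact Hh|].
    intros t s _. apply continuity_pt_mult; [apply continuity_pt_const; intros ? ?; reflexivity|].
    apply derivable_continuous_pt, derivable_pt_id. }
  pose proof (cont2_plus D _ _ Hf (Hc (-1) _ Hg)) as Hm.
  pose proof (cont2_plus D _ _ (Hc (1/4) _ (Hsq _ (cont2_plus D _ _ Hf Hg))) (Hc (-1/4) _ (Hsq _ Hm))) as HH.
  intros t s Hts eps He. destruct (HH t s Hts eps He) as [d [Hd Hd']]. exists d. split; [exact Hd|].
  intros t' s' H1 H2 H3. specialize (Hd' t' s' H1 H2 H3). cbn in Hd'.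
  eapply Rle_lt_trans; [|exact Hd']. right. f_equal. field.
Qed.

Lemma cont2_ext D f g : (forall t s, f t s = g t s) -> cont2_on D f -> cont2_on D g.
Proof.
  intros E Hf t s Hts eps He. destruct (Hf t s Hts eps He) as [d [Hd Hd']]. exists d. split; [exact Hd|].
  intros. rewrite <- !E. auto.
Qed.

Lemma cont2_div D f g :
  cont2_on D f -> cont2_on D g -> (forall t s, D t s -> g t s <> 0) -> cont2_on D (fun t s => f t s / g t s).
Proof.
  intros Hf Hg Hn. apply cont2_mult; [exact Hf|]. apply (cont2_comp D Rinv); [exact Hg|].
  intros t s Hts. apply (continuity_pt_inv id); [apply derivable_continuous_pt, derivable_pt_id|].
  unfold id; auto.
Qed.

Lemma cont2_minus D f g : cont2_on D f -> cont2_on D g -> cont2_on D (fun t s => f t s - g t s).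
Proof.
  intros Hf Hg. apply (cont2_ext D (fun t s => f t s + (-1) * g t s)); [intros; ring|].
  apply cont2_plus; [exact Hf|]. apply cont2_mult; [apply cont2_const|exact Hg].
Qed.

Lemma cont2_lsc (a b c d : R) f :
  cont2_on (fun s y => a <= s <= b /\ c <= y <= d) f -> lsc_box a b c d f.
Proof.
  intros Hf s y Hs Hy eps He. destruct (Hf s y (conj Hs Hy) eps He) as [r [Hr H]].
  exists r. split; [exact Hr|]. intros s' y' H1 H2 H3 H4.
  specialize (H s' y' (conj H1 H2) H3 H4). apply Rabs_def2 in H. lra.
Qed.

Lemma lsc_box_plus (a b c d : R) f g :
  lsc_box a b c d f -> lsc_box a b c d g -> lsc_box a b c d (fun s y => f s y + g s y).
Proof.
  intros Hf Hg s y Hs Hy eps He.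
  destruct (Hf s y Hs Hy (eps / 2)) as [d1 [Hd1 H1]]; [lra|].
  destruct (Hg s y Hs Hy (eps / 2)) as [d2 [Hd2 H2]]; [lra|].
  exists (Rmin d1 d2). split; [apply Rmin_glb_lt; lra|].
  intros t' s' Ht' Hs' G1 G2. pose proof (Rmin_l d1 d2). pose proof (Rmin_r d1 d2).
  assert (A1 := H1 t' s' Ht' Hs' ltac:(lra) ltac:(lra)). assert (A2 := H2 t' s' Ht' Hs' ltac:(lra) ltac:(lra)). lra.
Qed.

(** Added to a function to be minimised: the slope [eps] makes the inequality at the minimum strict,
    and the quadratic part penalises late times but only after [t0], where the barrier vanishes.
    Squaring the positive part keeps it continuously differentiable, as test functions require. *)
Definition barrier (eps t0 kap s : R) : R := eps * (s - t0) + kap * pospart2 t0 s.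

Lemma barrier_at (eps t0 kap : R) : barrier eps t0 kap t0 = 0.
Proof. unfold barrier, pospart2. rewrite Rminus_diag, Rmax_left by lra. ring. Qed.

Lemma barrier_before (eps t0 kap s : R) : s <= t0 -> barrier eps t0 kap s = eps * (s - t0).
Proof. intros Hs. unfold barrier, pospart2. rewrite Rmax_left by lra. ring. Qed.

Lemma barrier_ge (eps t0 kap s : R) : 0 <= kap -> eps * (s - t0) <= barrier eps t0 kap s.
Proof. intros Hk. unfold barrier, pospart2. pose proof (pow2_ge_0 (Rmax 0 (s - t0))). nra. Qed.

(* A large [kap] keeps the minimum away from the final time [b]. *)
Lemma barrier_min (n : nat) (a b Y t0 eps : R) (f : nat -> R -> R -> R) (i0 : nat) (x0 : R) :
  (i0 < n)%nat -> a <= t0 < b -> 0 <= x0 <= Y -> 0 <= eps ->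
  (forall i, (i < n)%nat -> lsc_box a b 0 Y (f i)) ->
  exists kap i s y, 0 <= kap /\ (i < n)%nat /\ a <= s < b /\ 0 <= y <= Y /\
    forall j s' y', (j < n)%nat -> a <= s' <= b -> 0 <= y' <= Y ->
      f i s y + barrier eps t0 kap s <= f j s' y' + barrier eps t0 kap s'.
Proof.
  intros Hi0 Ht0 Hx0 Heps Hl.
  destruct (lsc_family_min n a b 0 Y f) as [i1 [s1 [y1 [_ [_ [_ Hm]]]]]]; [lia|lra|lra|exact Hl|].
  set (m := f i1 s1 y1) in *.
  assert (Hm0 : m <= f i0 t0 x0) by (apply Hm; [lia|lra|lra]).
  (* At time [b] the quadratic part equals [f i0 t0 x0 - m + 1], more than any other point can save
     on [f] compared with [(t0, x0)]. *)
  set (kap := (f i0 t0 x0 - m + 1) / (b - t0) ^ 2).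
  assert (Hsq : 0 < (b - t0) ^ 2) by nra.
  assert (Hkap : 0 <= kap) by (unfold kap; apply Rle_mult_inv_pos; lra).
  destruct (lsc_family_min n a b 0 Y (fun i s y => f i s y + barrier eps t0 kap s))
    as [i [s [y [Hi [Hs [Hy Hmin]]]]]]; [lia|lra|lra| |].
  - intros i Hi. apply lsc_box_plus; [auto|]. apply cont2_lsc. unfold barrier.
    apply cont2_plus.
    + apply cont2_mult; [apply cont2_const|]. apply cont2_minus; [apply cont2_fst|apply cont2_const].
    + apply cont2_mult; [apply cont2_const|]. apply (cont2_comp _ (pospart2 t0)); [apply cont2_fst|].
      intros; apply continuity_pospart2.
  - exists kap, i, s, y. repeat split; try tauto.
    destruct (Req_dec s b) as [->|]; [exfalso|lra].
    assert (H1 := Hmin i0 t0 x0 Hi0 ltac:(lra) Hx0). cbn in H1. rewrite barrier_at in H1.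
    assert (H2 := Hm i b y Hi ltac:(lra) Hy).
    assert (H3 : kap * (b - t0) ^ 2 = f i0 t0 x0 - m + 1) by (unfold kap; field; nra).
    unfold barrier, pospart2 in H1. rewrite Rmax_right in H1 by lra. nra.
Qed.

(** * Uniformly convex Lagrangians *)

Lemma Rsup_lub (E : R -> Prop) (m : R) :
  (exists x, E x) -> (forall x, E x -> x <= m) -> is_lub E (Rsup E).
Proof.
  intros Hne Hb. unfold Rsup.
  destruct (excluded_middle_informative (exists m, is_lub E m)) as [h|h].
  - apply proj2_sig.
  - exfalso. apply h. destruct (completeness E) as [b Hlub]; [exists m; exact Hb|exact Hne|].
    exists b; exact Hlub.
Qed.

Definition Rinf (E : R -> Prop) : R := - Rsup (fun y => E (- y)).

Lemma Rinf_glb (E : R -> Prop) (b : R) :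
  (exists x, E x) -> (forall x, E x -> b <= x) ->
  (forall x, E x -> Rinf E <= x) /\ (forall c, (forall x, E x -> c <= x) -> c <= Rinf E).
Proof.
  intros [x0 Hx0] Hb. unfold Rinf.
  destruct (Rsup_lub (fun y => E (- y)) (- b)) as [H1 H2].
  - exists (- x0). rewrite Ropp_involutive; exact Hx0.
  - intros x Hx. specialize (Hb _ Hx). lra.
  - split.
    + intros x Hx. specialize (H1 (- x)). cbn in H1. rewrite Ropp_involutive in H1. specialize (H1 Hx). lra.
    + intros c Hc. assert (Rsup (fun y => E (- y)) <= - c); [|lra].
      apply H2. intros y Hy. specialize (Hc _ Hy). lra.
Qed.

Definition tangent (f : R -> R) (q p : R) : Prop := forall r, f q + p * (r - q) <= f r.

(* The last clause finds the point of the negative half-line at which the tangent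
   to the graph of [f] meets the vertical axis at height [l]. *)
Definition regular_lagrangian (f : R -> R) : Prop :=
  continuity f /\
  (forall q, exists p, tangent f q p /\ exists M rho, 0 <= M /\ 0 < rho /\
     forall r, Rabs (r - q) <= rho -> f r <= f q + p * (r - q) + M * (r - q) ^ 2) /\
  (forall k, exists c, forall q, k * Rabs q - c <= f q) /\
  (forall l, l < f 0 -> exists q p, q < 0 /\ tangent f q p /\ l = f q - q * p).

Lemma mean_value (f f' : R -> R) (a b : R) :
  (forall x, derivable_pt_lim f x (f' x)) ->
  exists c, f b - f a = f' c * (b - a) /\ Rmin a b <= c <= Rmax a b.
Proof.
  intros Hd. destruct (Rtotal_order a b) as [Hab|[->|Hab]].
  - destruct (MVT_cor2 f f' a b Hab) as [c [Hc1 Hc2]]; [auto|].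
    exists c. rewrite Rmin_left, Rmax_right by lra. split; lra.
  - exists b. rewrite Rmin_left, Rmax_left by lra. split; [ring|lra].
  - destruct (MVT_cor2 f f' b a Hab) as [c [Hc1 Hc2]]; [auto|].
    exists c. rewrite Rmin_right, Rmax_left by lra. split; lra.
Qed.

(** Subtracting [g / 2 * x ^ 2] leaves a convex function; the mean value theorem is used once for it
    and once for [f1], and the intermediate point lies on the same side of [q] as [r]. *)
Lemma strong_tangent (f f1 f2 : R -> R) (g : R) :
  (forall q, derivable_pt_lim f q (f1 q)) -> (forall q, derivable_pt_lim f1 q (f2 q)) ->
  (forall q, g <= f2 q) ->
  forall q r, f q + f1 q * (r - q) + g / 2 * (r - q) ^ 2 <= f r.
Proof.
  intros H1 H2 Hg q r.
  set (h := fun x => f x - g / 2 * (x * x)).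
  assert (Hh : forall x, derivable_pt_lim h x (f1 x - g / 2 * (1 * x + x * 1))).
  { intros x. unfold h. apply derivable_pt_lim_minus; [apply H1|].
    apply (derivable_pt_lim_scal (fun y => y * y) (g / 2)).
    apply (derivable_pt_lim_mult id id); apply derivable_pt_lim_id. }
  destruct (mean_value h _ q r Hh) as [c [Hc1 Hc2]].
  destruct (mean_value f1 f2 q c H2) as [d [Hd1 _]]. specialize (Hg d).
  unfold h in Hc1.
  assert (0 <= (f1 c - f1 q - g * (c - q)) * (r - q)).
  { replace (f1 c - f1 q - g * (c - q)) with ((f2 d - g) * (c - q)) by (rewrite Hd1; ring).
    assert (0 <= (c - q) * (r - q)).
    { unfold Rmin, Rmax in Hc2. destruct (Rle_dec q r); nra. }
    nra. }
  nra.
Qed.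

Lemma uniformly_convex_regular (f f1 f2 : R -> R) (g : R) :
  g > 0 ->
  (forall q, derivable_pt_lim f q (f1 q)) -> (forall q, derivable_pt_lim f1 q (f2 q)) ->
  (forall q, g <= f2 q) -> regular_lagrangian f.
Proof.
  intros Hg H1 H2 H3.
  pose proof (strong_tangent f f1 f2 g H1 H2 H3) as Hst.
  assert (Htan : forall q, tangent f q (f1 q)).
  { intros q r. specialize (Hst q r). pose proof (pow2_ge_0 (r - q)). nra. }
  repeat split.
  - intro q. apply derivable_continuous_pt. exists (f1 q). apply H1.
  - intro q. exists (f1 q). split; [apply Htan|].
    (* Differentiability of [f1] at the single point [q], with error 1, bounds its increments there
       by [f2 q + 1], which serves as the quadratic constant [M]. *)
    destruct (H2 q 1) as [d Hd]; [lra|]. pose proof (cond_pos d) as Hdp.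
    exists (f2 q + 1), (d / 2). split; [specialize (H3 q); lra|]. split; [lra|].
    intros r Hr. destruct (mean_value f f1 q r H1) as [c [Hc1 Hc2]].
    assert (Hdc : Rabs (f1 c - f1 q) <= (f2 q + 1) * Rabs (c - q)).
    { destruct (Req_dec c q) as [->|Hne]; [rewrite !Rminus_diag, Rabs_R0; lra|].
      assert (Hlt : Rabs (c - q) < d).
      { apply Rle_lt_trans with (Rabs (r - q)); [|lra].
        unfold Rmin, Rmax in Hc2. unfold Rabs.
        destruct (Rle_dec q r), (Rcase_abs (c - q)), (Rcase_abs (r - q)); lra. }
      specialize (Hd (c - q) ltac:(lra) Hlt). replace (q + (c - q)) with c in Hd by ring.
      assert (E : f1 c - f1 q = (f1 c - f1 q) / (c - q) * (c - q)) by (field; lra).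
      rewrite E, Rabs_mult. apply Rmult_le_compat_r; [apply Rabs_pos|].
      specialize (H3 q). apply Rabs_def2 in Hd. apply Rabs_le. lra. }
    assert (Hcr : Rabs (c - q) <= Rabs (r - q)).
    { unfold Rmin, Rmax in Hc2. unfold Rabs.
      destruct (Rle_dec q r), (Rcase_abs (c - q)), (Rcase_abs (r - q)); lra. }
    assert (Hprod : (f1 c - f1 q) * (r - q) <= (f2 q + 1) * (r - q) ^ 2).
    { eapply Rle_trans; [apply Rle_abs|]. rewrite Rabs_mult, <- (pow2_abs (r - q)).
      pose proof (Rabs_pos (r - q)). pose proof (Rabs_pos (c - q)). specialize (H3 q).
      apply Rle_trans with ((f2 q + 1) * Rabs (r - q) * Rabs (r - q)); [|right; ring].
      apply Rmult_le_compat_r; [lra|]. nra. }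
    nra.
  (* The constant comes from Young's inequality [K * |q| <= K ^ 2 / (2 * g) + g / 2 * q ^ 2] applied
     to the strong tangent at 0. *)
  - intro k. exists ((Rabs k + Rabs (f1 0)) ^ 2 / (2 * g) - f 0). intro q.
    specialize (Hst 0 q). rewrite Rminus_0_r in Hst.
    set (K := Rabs k + Rabs (f1 0)).
    assert (Hk1 : k * Rabs q - f1 0 * q <= K * Rabs q).
    { unfold K. rewrite Rmult_plus_distr_r.
      pose proof (Rle_abs k). pose proof (Rabs_pos q).
      assert (- (f1 0 * q) <= Rabs (f1 0) * Rabs q).
      { rewrite <- Rabs_mult. rewrite <- Rabs_Ropp. apply Rle_abs. }
      nra. }
    assert (Hk2 : K * Rabs q <= K ^ 2 / (2 * g) + g / 2 * q ^ 2).
    { rewrite <- (pow2_abs q). set (a := Rabs q).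
      assert (E : K ^ 2 / (2 * g) + g / 2 * a ^ 2 - K * a = (K - g * a) ^ 2 / (2 * g)) by (field; lra).
      assert (0 <= (K - g * a) ^ 2 / (2 * g)).
      { apply Rle_mult_inv_pos; [apply pow2_ge_0|lra]. }
      lra. }
    lra.
  - intros l Hl.
    (* [F q] is the height at which the tangent at [q] meets the vertical axis. It equals [f 0 > l]
       at 0 and stays below [f 0 - g / 2 * q ^ 2], so it takes the value [l] between [q0] and 0. *)
    set (F := fun q => f q - q * f1 q).
    assert (HF : continuity F).
    { intro q. apply derivable_continuous_pt. unfold F.
      apply derivable_pt_minus; [exists (f1 q); apply H1|].
      apply (derivable_pt_mult id f1); [apply derivable_pt_id|exists (f2 q); apply H2]. }
    assert (HFb : forall q, F q <= f 0 - g / 2 * q ^ 2).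
    { intro q. specialize (Hst q 0). unfold F. nra. }
    set (q0 := - (1 + 2 / g * (f 0 - l))).
    assert (Hp : 0 < 2 / g * (f 0 - l)).
    { apply Rmult_lt_0_compat; [|lra]. apply Rdiv_lt_0_compat; lra. }
    assert (Hq0 : F q0 < l).
    { specialize (HFb q0). assert (f 0 - l < g / 2 * q0 ^ 2); [|lra].
      unfold q0. set (z := 2 / g * (f 0 - l)) in *.
      assert (E : g / 2 * z = f 0 - l) by (unfold z; field; lra).
      rewrite <- E. nra. }
    destruct (IVT (fun q => F q - l) q0 0) as [q [Hq1 Hq2]].
    + intro q. apply continuity_pt_minus; [apply HF|apply continuity_pt_const; intros ? ?; reflexivity].
    + unfold q0; lra.
    + lra.
    + unfold F; lra.
    + exists q, (f1 q). split.
      * destruct (Req_dec q 0) as [->|]; [|lra]. unfold F in Hq2. lra.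
      * split; [apply Htan|]. unfold F in Hq2. lra.
Qed.

(** Jensen for trajectories: two consecutive segments cost at least as much as the single segment
    with the same ends. The tangent at the mean velocity is summed with weights [a] and [b], and its
    linear part cancels. *)
Lemma perspective_subadditive (f : R -> R) (a b x y : R) :
  regular_lagrangian f -> 0 < a -> 0 < b ->
  (a + b) * f ((x + y) / (a + b)) <= a * f (x / a) + b * f (y / b).
Proof.
  intros [_ [Ht _]] Ha Hb.
  set (q := (x + y) / (a + b)). destruct (Ht q) as [p [Hp _]].
  pose proof (Hp (x / a)) as H1. pose proof (Hp (y / b)) as H2.
  assert (E1 : a * (x / a) = x) by (field; lra).
  assert (E2 : b * (y / b) = y) by (field; lra).
  assert (E3 : (a + b) * q = x + y) by (unfold q; field; lra).
  set (u := x / a) in *. set (v := y / b) in *.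
  apply Rmult_le_compat_l with (r := a) in H1; [|lra].
  apply Rmult_le_compat_l with (r := b) in H2; [|lra].
  assert (E : a * (f q + p * (u - q)) + b * (f q + p * (v - q))
    = (a + b) * f q + p * (a * u + b * v - (a + b) * q)) by ring.
  replace (a * u + b * v - (a + b) * q) with 0 in E by lra. lra.
Qed.

(** The deviation of velocity is [w / th - q = (w - q * th) / th], so the quadratic bound on [f]
    becomes one in [w - q * th] with factor [M / th]. Keeping [th] above [th0 / 2] replaces this
    factor by a constant and makes the bound a polynomial in [(th, w)]. *)
Lemma perspective_upper_bound (f : R -> R) (th0 w0 : R) :
  regular_lagrangian f -> 0 < th0 ->
  exists p M r, tangent f (w0 / th0) p /\ 0 < r /\
    forall th w, Rabs (th - th0) < r -> Rabs (w - w0) < r ->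
      th * f (w / th) <= th * f (w0 / th0) + p * (w - w0 / th0 * th) + M * (w - w0 / th0 * th) ^ 2.
Proof.
  intros [_ [Ht _]] Hth. set (q := w0 / th0).
  destruct (Ht q) as [p [Hp [M [rho [HM [Hrho Hub]]]]]].
  assert (Hq := Rabs_pos q).
  set (r1 := rho * th0 / (2 * (1 + Rabs q))).
  assert (Hr1 : 0 < r1) by (unfold r1; apply Rdiv_lt_0_compat; nra).
  exists p, (2 * M / th0), (Rmin (th0 / 2) r1).
  split; [exact Hp|]. split; [apply Rmin_glb_lt; lra|].
  intros th w H1 H2. pose proof (Rmin_l (th0 / 2) r1). pose proof (Rmin_r (th0 / 2) r1).
  assert (Hth2 : th0 / 2 < th) by (apply Rabs_def2 in H1; lra).
  assert (Ew : w0 = q * th0) by (unfold q; field; lra).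
  assert (Hd : w / th - q = (w - q * th) / th) by (field; lra).
  assert (Hnum : Rabs (w - q * th) <= r1 * (1 + Rabs q)).
  { replace (w - q * th) with ((w - w0) + - (q * (th - th0))) by (rewrite Ew; ring).
    eapply Rle_trans; [apply Rabs_triang|]. rewrite Rabs_Ropp, Rabs_mult.
    assert (Rabs q * Rabs (th - th0) <= Rabs q * r1) by (apply Rmult_le_compat_l; lra). lra. }
  assert (Hr1e : r1 * (1 + Rabs q) = rho * (th0 / 2)) by (unfold r1; field; lra).
  assert (Hin : Rabs (w / th - q) <= rho).
  { rewrite Hd. unfold Rdiv. rewrite Rabs_mult, Rabs_inv, (Rabs_pos_eq th) by lra.
    apply Rmult_le_reg_r with th; [lra|]. rewrite Rmult_assoc, Rinv_l, Rmult_1_r by lra.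
    rewrite Hr1e in Hnum. nra. }
  specialize (Hub _ Hin). rewrite Hd in Hub.
  apply Rmult_le_compat_l with (r := th) in Hub; [|lra].
  eapply Rle_trans; [exact Hub|].
  replace (th * (f q + p * ((w - q * th) / th) + M * ((w - q * th) / th) ^ 2))
    with (th * f q + p * (w - q * th) + M / th * (w - q * th) ^ 2) by (field; lra).
  apply Rplus_le_compat_l. apply Rmult_le_compat_r; [apply pow2_ge_0|].
  unfold Rdiv. rewrite (Rmult_comm 2 M), Rmult_assoc. apply Rmult_le_compat_l; [exact HM|].
  apply Rmult_le_reg_r with (th * th0); [nra|].
  replace (/ th * (th * th0)) with th0 by (field; lra).
  replace (2 * / th0 * (th * th0)) with (2 * th) by (field; lra). lra.
Qed.

Lemma perspective_growth (f : R -> R) (k c th w : R) :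
  (forall q, k * Rabs q - c <= f q) -> 0 < th -> k * Rabs w - c * th <= th * f (w / th).
Proof.
  intros Hk Hth. specialize (Hk (w / th)).
  apply Rmult_le_compat_l with (r := th) in Hk; [|lra].
  eapply Rle_trans; [|exact Hk]. right.
  unfold Rdiv. rewrite Rabs_mult, Rabs_inv, (Rabs_pos_eq th) by lra. field. lra.
Qed.

(** * Conjugates on the line and on the negative half-line *)

Section Hamiltonians.
Context (N : nat) (L : nat -> R -> R).
Hypothesis HN : (1 <= N)%nat.
Hypothesis HL : forall i, (i < N)%nat -> regular_lagrangian (L i).

Lemma Hi_lub i p : (i < N)%nat -> is_lub (fun y => exists q, y = p * q - L i q) (Hi L i p).
Proof.
  intros Hi. destruct (HL i Hi) as [_ [_ [Hg _]]]. destruct (Hg (Rabs p)) as [c Hc].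
  apply Rsup_lub with c; [exists (p * 0 - L i 0), 0; reflexivity|].
  intros x [q ->]. specialize (Hc q). rewrite <- Rabs_mult in Hc. pose proof (Rle_abs (p * q)). lra.
Qed.

Lemma Hminus_lub i p :
  (i < N)%nat -> is_lub (fun y => exists q, q <= 0 /\ y = p * q - L i q) (Hminus L i p).
Proof.
  intros Hi. destruct (HL i Hi) as [_ [_ [Hg _]]]. destruct (Hg (Rabs p)) as [c Hc].
  apply Rsup_lub with c; [exists (p * 0 - L i 0), 0; split; [lra|reflexivity]|].
  intros x [q [_ ->]]. specialize (Hc q). rewrite <- Rabs_mult in Hc. pose proof (Rle_abs (p * q)). lra.
Qed.

Lemma Hi_ge i p q : (i < N)%nat -> p * q - L i q <= Hi L i p.
Proof. intros Hi. apply (Hi_lub i p Hi). exists q; reflexivity. Qed.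

Lemma Hi_le i p B : (i < N)%nat -> (forall q, p * q - L i q <= B) -> Hi L i p <= B.
Proof. intros Hi HB. apply (Hi_lub i p Hi). intros y [q ->]. apply HB. Qed.

Lemma Hminus_ge i p q : (i < N)%nat -> q <= 0 -> p * q - L i q <= Hminus L i p.
Proof. intros Hi Hq. apply (Hminus_lub i p Hi). exists q; auto. Qed.

Lemma Hminus_le i p B :
  (i < N)%nat -> (forall q, q <= 0 -> p * q - L i q <= B) -> Hminus L i p <= B.
Proof. intros Hi HB. apply (Hminus_lub i p Hi). intros y [q [Hq ->]]. auto. Qed.

(** Half of Fenchel's equality; with it, test functions whose slope is tangent at the velocity [q]
    solve the equation exactly. *)
Lemma Hi_tangent i q p : (i < N)%nat -> tangent (L i) q p -> Hi L i p <= p * q - L i q.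
Proof. intros Hi Ht. apply Hi_le; [exact Hi|]. intros r. specialize (Ht r). lra. Qed.

Lemma Hminus_tangent i q p : (i < N)%nat -> tangent (L i) q p -> Hminus L i p <= p * q - L i q.
Proof. intros Hi Ht. apply Hminus_le; [exact Hi|]. intros r _. specialize (Ht r). lra. Qed.

Lemma uniform_growth k : exists c, 0 <= c /\ forall i q, (i < N)%nat -> k * Rabs q - c <= L i q.
Proof.
  destruct (finite_upper_bound (fun i c => forall q, k * Rabs q - c <= L i q) N) as [c Hc].
  - intros i Hi. destruct (HL i Hi) as [_ [_ [Hg _]]]. destruct (Hg k) as [c Hc].
    exists c. intros c' Hc' q. specialize (Hc q). lra.
  - exists (Rmax c 0). split; [apply Rmax_r|]. intros i q Hi. apply Hc; [exact Hi|apply Rmax_l].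
Qed.

Lemma maxUpTo_ge f n j : (j <= n)%nat -> f j <= maxUpTo f n.
Proof.
  induction n as [|n IH]; intros Hj; cbn; [replace j with 0%nat by lia; lra|].
  destruct (Nat.eq_dec j (S n)) as [->|]; [apply Rmax_r|].
  eapply Rle_trans; [apply IH; lia|apply Rmax_l].
Qed.

Lemma maxUpTo_le f n B : (forall j, (j <= n)%nat -> f j <= B) -> maxUpTo f n <= B.
Proof.
  induction n as [|n IH]; intros HB; cbn; [apply HB; lia|].
  apply Rmax_lub; [apply IH; intros; apply HB; lia|apply HB; lia].
Qed.

Lemma H0_ge p j : (j < N)%nat -> Hminus L j (p j) <= H0 N L p.
Proof. intros Hj. apply (maxUpTo_ge (fun j => Hminus L j (p j))). lia. Qed.

Lemma H0_le p B : (forall j, (j < N)%nat -> Hminus L j (p j) <= B) -> H0 N L p <= B.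
Proof. intros HB. apply maxUpTo_le. intros j Hj. apply HB. lia. Qed.

End Hamiltonians.

(** * Test functions on the junction *)

(** Reciprocals reduce this to a common upper threshold. It provides one radius valid on all
    branches around the vertex. *)
Lemma finite_lower_bound (P : nat -> R -> Prop) (n : nat) :
  (forall i, (i < n)%nat -> exists d, d > 0 /\ forall d', 0 < d' <= d -> P i d') ->
  exists d, d > 0 /\ forall i, (i < n)%nat -> P i d.
Proof.
  intros Hex.
  destruct (finite_upper_bound (fun i B => B > 0 -> P i (/ B)) n) as [B HB].
  - intros i Hi. destruct (Hex i Hi) as [d [Hd HP]]. exists (/ d). intros B' HB' HB0.
    apply HP. split; [apply Rinv_0_lt_compat; lra|].
    rewrite <- (Rinv_inv d). apply Rinv_le_contravar; [apply Rinv_0_lt_compat; lra|exact HB'].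
  - exists (/ (Rmax B 1)). pose proof (Rmax_l B 1). pose proof (Rmax_r B 1).
    split; [apply Rinv_0_lt_compat; lra|]. intros i Hi. apply HB; [exact Hi|lra|lra].
Qed.

Lemma C1_half_shift T g gt gx c :
  C1_half T g gt gx -> C1_half T (fun t s => g t s + c) gt gx.
Proof.
  intros [Hg [Ht [Hx Hd]]]. split; [|split; [exact Ht|split; [exact Hx|]]].
  - apply cont2_plus; [exact Hg|apply cont2_const].
  - intros t s Hts. destruct (Hd t s Hts) as [Hd1 Hd2]. split.
    + replace (gt t s) with (gt t s + 0) by ring.
      apply (derivable_pt_lim_plus (fun t' => g t' s) (fun _ => c)); [exact Hd1|apply derivable_pt_lim_const].
    + intros eps He. destruct (Hd2 eps He) as [d [Hdp H]]. exists d. split; [exact Hdp|].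
      intros h H1 H2 H3. replace (g t (s + h) + c - (g t s + c)) with (g t (s + h) - g t s) by ring. auto.
Qed.

Lemma C1_half_ext T g g' gt gt' gx gx' :
  (forall t s, HalfStrip T t s -> gt t s = gt' t s /\ gx t s = gx' t s) ->
  (forall t s, 0 <= s -> g t s = g' t s) ->
  C1_half T g gt gx -> C1_half T g' gt' gx'.
Proof.
  intros E E' [Hg [Ht [Hx Hd]]].
  assert (Hc : forall f f', (forall t s, HalfStrip T t s -> f t s = f' t s) ->
    cont2_on (HalfStrip T) f -> cont2_on (HalfStrip T) f').
  { intros f f' Ef Hf t s Hts eps He. destruct (Hf t s Hts eps He) as [d [Hdp H]].
    exists d. split; [exact Hdp|]. intros t' s' H' H1 H2. rewrite <- !Ef by assumption. auto. }
  split; [|split; [|split]].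
  - apply (Hc g); [intros t s [_ Hs]; auto|exact Hg].
  - apply (Hc gt); [apply E|exact Ht].
  - apply (Hc gx); [apply E|exact Hx].
  - intros t s Hts. destruct (Hd t s Hts) as [Hd1 Hd2].
    destruct (E t s Hts) as [<- <-]. destruct Hts as [Ht0 Hs]. split.
    + intros eps He. destruct (Hd1 eps He) as [d H]. exists d. intros h H1 H2.
      rewrite <- !E' by exact Hs. auto.
    + intros eps He. destruct (Hd2 eps He) as [d [Hdp H]]. exists d. split; [exact Hdp|].
      intros h H1 H2 H3. rewrite <- !E' by assumption. auto.
Qed.

(** Up to an additive constant, every test function of the comparison arguments belongs to this
    family on each branch. *)
Lemma C1_half_quadratic T c1 c2 c3 c4 c5 k b :
  C1_half T
    (fun t s => c1 * t + c2 * t ^ 2 + c3 * t * s + c4 * s ^ 2 + c5 * s + k * pospart2 b t)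
    (fun t s => c1 + 2 * c2 * t + c3 * s + k * (2 * Rmax 0 (t - b)))
    (fun t s => c3 * t + 2 * c4 * s + c5).
Proof.
  assert (Hsq : forall D f, cont2_on D f -> cont2_on D (fun t s => f t s ^ 2)).
  { intros D f Hf. apply (cont2_ext D (fun t s => f t s * f t s)); [intros; ring|].
    apply cont2_mult; exact Hf. }
  assert (Hm : forall D, cont2_on D (fun t _ => Rmax 0 (t - b))).
  { intros D. apply (cont2_comp D (fun x => Rmax 0 x));
      [apply cont2_minus; [apply cont2_fst|apply cont2_const]|intros; apply continuity_Rmax]. }
  assert (Hp : forall D, cont2_on D (fun t _ => pospart2 b t)).
  { intros D. apply (cont2_comp D (pospart2 b)); [apply cont2_fst|intros; apply continuity_pospart2]. }
  split; [|split; [|split]].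
  - repeat first [apply Hp | apply cont2_plus | apply cont2_mult | apply cont2_const | apply cont2_fst
      | apply cont2_snd | apply Hsq].
  - repeat first [apply Hm | apply cont2_plus | apply cont2_mult | apply cont2_const | apply cont2_fst
      | apply cont2_snd | apply Hsq].
  - repeat first [apply cont2_plus | apply cont2_mult | apply cont2_const | apply cont2_fst
      | apply cont2_snd | apply Hsq].
  - intros t s _. split.
    + intros eps He.
      assert (Hpos : 0 < eps / (Rabs c2 + Rabs k + 1)).
      { apply Rdiv_lt_0_compat; [exact He|]. pose proof (Rabs_pos c2). pose proof (Rabs_pos k). lra. }
      exists (mkposreal _ Hpos). intros h Hh Hhd. cbn in Hhd.
      set (D := pospart2 b (t + h) - pospart2 b t - 2 * Rmax 0 (t - b) * h).
      assert (HD : Rabs D <= h ^ 2) by apply pospart2_expand.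
      match goal with |- Rabs ?x < _ => replace x with ((c2 * h ^ 2 + k * D) / h) end.
      2: { unfold D. field. exact Hh. }
      assert (Hha : 0 < Rabs h) by (apply Rabs_pos_lt; exact Hh).
      unfold Rdiv. rewrite Rabs_mult, Rabs_inv.
      assert (HN : Rabs (c2 * h ^ 2 + k * D) <= (Rabs c2 + Rabs k) * (Rabs h * Rabs h)).
      { eapply Rle_trans; [apply Rabs_triang|]. rewrite !Rabs_mult.
        replace (Rabs (h ^ 2)) with (Rabs h * Rabs h) by (rewrite <- Rabs_mult; f_equal; ring).
        assert (E : h ^ 2 = Rabs h * Rabs h) by (rewrite <- (pow2_abs h); ring).
        rewrite E in HD. pose proof (Rabs_pos k). nra. }
      apply Rle_lt_trans with ((Rabs c2 + Rabs k) * (Rabs h * Rabs h) * / Rabs h).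
      { apply Rmult_le_compat_r; [left; apply Rinv_0_lt_compat; lra|exact HN]. }
      replace ((Rabs c2 + Rabs k) * (Rabs h * Rabs h) * / Rabs h)
        with ((Rabs c2 + Rabs k) * Rabs h) by (field; lra).
      pose proof (Rabs_pos c2). pose proof (Rabs_pos k).
      apply Rmult_lt_compat_l with (r := Rabs c2 + Rabs k + 1) in Hhd; [|lra].
      replace ((Rabs c2 + Rabs k + 1) * (eps / (Rabs c2 + Rabs k + 1))) with eps in Hhd by (field; lra).
      lra.
    + intros eps He. exists (eps / (Rabs c4 + 1)).
      assert (Hc4 := Rabs_pos c4).
      split; [apply Rdiv_lt_0_compat; lra|]. intros h Hh Hhd _.
      match goal with |- Rabs ?x < _ => replace x with (c4 * h) end.
      2: { field. exact Hh. }
      rewrite Rabs_mult.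
      apply Rmult_lt_compat_l with (r := Rabs c4 + 1) in Hhd; [|lra].
      replace ((Rabs c4 + 1) * (eps / (Rabs c4 + 1))) with eps in Hhd by (field; lra).
      pose proof (Rabs_pos h). lra.
Qed.

Lemma smul0 v : smul 0 v = (0, 0).
Proof. unfold smul. f_equal; ring. Qed.

(** * Coordinates on the junction and functions glued from the branches *)

Definition bdist (i : nat) (x : R) (j : nat) (y : R) : R :=
  if Nat.eq_dec i j then Rabs (x - y) else x + y.

Section Junction.
Context (N : nat) (e : nat -> pt).
Hypothesis HN : (1 <= N)%nat.
Hypothesis Hunit : forall i, (i < N)%nat -> fst (e i) ^ 2 + snd (e i) ^ 2 = 1.
Hypothesis Hdist : forall i j, (i < N)%nat -> (j < N)%nat -> i <> j -> e i <> e j.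

Lemma enorm_smul i s : (i < N)%nat -> 0 <= s -> enorm (smul s (e i)) = s.
Proof.
  intros Hi Hs. unfold enorm, smul; cbn [fst snd].
  replace ((s * fst (e i)) ^ 2 + (s * snd (e i)) ^ 2) with (s ^ 2 * (fst (e i) ^ 2 + snd (e i) ^ 2)) by ring.
  rewrite Hunit by exact Hi. rewrite Rmult_1_r. apply sqrt_pow2; exact Hs.
Qed.

Lemma edist_smul i x y : (i < N)%nat -> edist (smul x (e i)) (smul y (e i)) = Rabs (x - y).
Proof.
  intros Hi. unfold edist, smul; cbn [fst snd].
  replace ((x * fst (e i) - y * fst (e i)) ^ 2 + (x * snd (e i) - y * snd (e i)) ^ 2)
    with ((x - y) ^ 2 * (fst (e i) ^ 2 + snd (e i) ^ 2)) by ring.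
  rewrite Hunit by exact Hi. rewrite Rmult_1_r, <- pow2_abs. apply sqrt_pow2, Rabs_pos.
Qed.

Lemma smul_inj i j x y :
  (i < N)%nat -> (j < N)%nat -> 0 <= x -> 0 <= y -> smul x (e i) = smul y (e j) ->
  x = y /\ (x = 0 \/ i = j).
Proof.
  intros Hi Hj Hx Hy E.
  assert (Exy : x = y).
  { rewrite <- (enorm_smul i x Hi Hx), <- (enorm_smul j y Hj Hy), E. reflexivity. }
  split; [exact Exy|]. subst y.
  destruct (Req_dec x 0) as [->|Hx0]; [left; reflexivity|right].
  apply NNPP. intro Hij. apply (Hdist i j Hi Hj Hij).
  unfold smul in E. injection E as E1 E2.
  apply Rmult_eq_reg_l in E1; [|exact Hx0]. apply Rmult_eq_reg_l in E2; [|exact Hx0].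
  rewrite (surjective_pairing (e i)), (surjective_pairing (e j)), E1, E2. reflexivity.
Qed.

Lemma dJ_smul i j x y :
  (i < N)%nat -> (j < N)%nat -> 0 <= x -> 0 <= y ->
  dJ N e (smul x (e i)) (smul y (e j)) = bdist i x j y.
Proof.
  intros Hi Hj Hx Hy. unfold dJ, bdist.
  destruct (excluded_middle_informative _) as [[k [Hk [[a [Ha Ea]] [b [Hb Eb]]]]]|Hns].
  - rewrite Ea, Eb, edist_smul by exact Hk.
    destruct (smul_inj i k x a) as [-> Hx']; auto. destruct (smul_inj j k y b) as [-> Hy']; auto.
    destruct (Nat.eq_dec i j) as [|Hij]; [reflexivity|].
    destruct Hx' as [->| ->].
    + rewrite Rminus_0_l, Rabs_Ropp, Rabs_pos_eq by exact Hb. ring.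
    + destruct Hy' as [->|]; [|congruence]. rewrite Rminus_0_r, Rabs_pos_eq by exact Ha. ring.
  - destruct (Nat.eq_dec i j) as [<-|Hij].
    + exfalso. apply Hns. exists i. split; [exact Hi|]. split; [exists x|exists y]; auto.
    + rewrite !enorm_smul by assumption. reflexivity.
Qed.

Lemma inJ_smul i x : (i < N)%nat -> 0 <= x -> inJ N e (smul x (e i)).
Proof. intros Hi Hx. exists i. split; [exact Hi|]. exists x; auto. Qed.

(** At the vertex every branch qualifies and the choice is arbitrary; hence the matching condition
    at 0 whenever a family is lifted. *)
Definition branch (p : pt) : nat := epsilon (inhabits 0%nat) (fun i => (i < N)%nat /\ inJi e i p).

Lemma branch_spec p : inJ N e p -> (branch p < N)%nat /\ p = smul (enorm p) (e (branch p)).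
Proof.
  intros Hp. assert (H := epsilon_spec (inhabits 0%nat) (fun i => (i < N)%nat /\ inJi e i p) Hp).
  fold (branch p) in H. destruct H as [Hb [s [Hs Es]]]. split; [exact Hb|].
  rewrite Es at 2. rewrite enorm_smul by assumption. exact Es.
Qed.

Lemma inJ_coord p : inJ N e p -> exists i x, (i < N)%nat /\ 0 <= x /\ p = smul x (e i).
Proof. intros [i [Hi [x [Hx Ex]]]]. exists i, x. auto. Qed.

Definition lift (f : nat -> R -> R) (p : pt) : R := f (branch p) (enorm p).

Lemma lift_smul f i x :
  (forall j k, (j < N)%nat -> (k < N)%nat -> f j 0 = f k 0) ->
  (i < N)%nat -> 0 <= x -> lift f (smul x (e i)) = f i x.
Proof.
  intros Hf Hi Hx. unfold lift.
  destruct (branch_spec _ (inJ_smul i x Hi Hx)) as [Hb Eb].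
  rewrite enorm_smul in Eb |- * by assumption.
  destruct (smul_inj _ _ _ _ Hi Hb Hx Hx Eb) as [_ [->| <-]]; auto.
Qed.

Lemma C1_star_lift T (f ft fx : nat -> R -> R -> R) :
  (forall j k t, (j < N)%nat -> (k < N)%nat -> f j t 0 = f k t 0) ->
  (forall i, (i < N)%nat -> C1_half T (f i) (ft i) (fx i)) ->
  C1_star T N e (fun t => lift (fun i => f i t)) ft fx.
Proof.
  intros Hm Hf. split.
  - intros t p [Ht Hp] eps Heps. destruct (inJ_coord p Hp) as [i [x [Hi [Hx ->]]]].
    destruct (finite_lower_bound (fun j d => forall s y, 0 < s < T -> 0 <= y ->
      Rabs (t - s) < d -> bdist i x j y < d -> Rabs (f j s y - f i t x) < eps) N) as [d [Hd H]].
    + intros j Hj. destruct (Nat.eq_dec i j) as [<-|Hij].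
      * destruct (Hf i Hi) as [Hc _]. destruct (Hc t x (conj Ht Hx) eps Heps) as [d [Hd H]].
        exists d. split; [exact Hd|]. intros d' Hd' s y Hs Hy H1 H2.
        unfold bdist in H2. destruct (Nat.eq_dec i i); [|congruence].
        apply H; [split; assumption|rewrite Rabs_minus_sym; lra|rewrite Rabs_minus_sym; lra].
      (* From the vertex, continuity at 0 on the other branch applies; from [x > 0], the radius [x]
         leaves the other branches out of reach. *)
      * destruct (Req_dec x 0) as [->|Hx0].
        -- destruct (Hf j Hj) as [Hc _]. destruct (Hc t 0 (conj Ht Hx) eps Heps) as [d [Hd H]].
           exists d. split; [exact Hd|]. intros d' Hd' s y Hs Hy H1 H2.
           unfold bdist in H2. destruct (Nat.eq_dec i j); [congruence|].
           rewrite (Hm i j) by assumption.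
           apply H; [split; assumption|rewrite Rabs_minus_sym; lra|].
           rewrite Rminus_0_r, Rabs_pos_eq by exact Hy. lra.
        -- exists x. split; [lra|]. intros d' Hd' s y Hs Hy H1 H2.
           unfold bdist in H2. destruct (Nat.eq_dec i j); [congruence|]. lra.
    + exists d. split; [exact Hd|]. intros s p [Hs Hp'] Hpd.
      destruct (inJ_coord p Hp') as [j [y [Hj [Hy ->]]]].
      rewrite !lift_smul; auto. unfold pdist in Hpd. rewrite dJ_smul in Hpd by assumption.
      pose proof (Rmax_l (Rabs (t - s)) (bdist i x j y)). pose proof (Rmax_r (Rabs (t - s)) (bdist i x j y)).
      apply (H j Hj); auto; lra.
  - intros i Hi. apply (C1_half_ext T (f i) _ (ft i) _ (fx i)); [auto| |apply Hf; exact Hi].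
    intros t s Hs. rewrite lift_smul; auto.
Qed.

Lemma pdist_smul t i x s j y r :
  (i < N)%nat -> (j < N)%nat -> 0 <= x -> 0 <= y ->
  pdist N e t (smul x (e i)) s (smul y (e j)) < r <-> Rabs (s - t) < r /\ bdist i x j y < r.
Proof.
  intros Hi Hj Hx Hy. unfold pdist. rewrite dJ_smul, Rabs_minus_sym by assumption. split.
  - intro H. split; eapply Rle_lt_trans; [apply Rmax_l|exact H|apply Rmax_r|exact H].
  - intros [H1 H2]. apply Rmax_lub_lt; assumption.
Qed.

Section Tests.
Context (T : R) (L : nat -> R -> R) (f ft fx : nat -> R -> R -> R).
Hypothesis Hmatch : forall j k t, (j < N)%nat -> (k < N)%nat -> f j t 0 = f k t 0.
Hypothesis HC1 : forall i, (i < N)%nat -> C1_half T (f i) (ft i) (fx i).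

Lemma C1_star_lift_shift c : C1_star T N e (fun t => lift (fun i s => f i t s + c)) ft fx.
Proof.
  apply (C1_star_lift T (fun i t s => f i t s + c)).
  - intros. rewrite (Hmatch j k); auto.
  - intros. apply C1_half_shift. auto.
Qed.

(** Contact is obtained by adding the constant [c] to the test function, so only a local maximum of
    [U - f], in coordinates, has to be exhibited. *)
Lemma subsol_test U t i x r :
  subsol T N e L U -> 0 < t < T -> (i < N)%nat -> 0 <= x -> r > 0 ->
  (forall j s y, (j < N)%nat -> 0 < s < T -> 0 <= y -> Rabs (s - t) < r -> bdist i x j y < r ->
     U s (smul y (e j)) - f j s y <= U t (smul x (e i)) - f i t x) ->
  (0 < x -> ft i t x + Hi L i (fx i t x) <= 0) /\
  (x = 0 -> ft 0%nat t 0 + H0 N L (fun j => fx j t 0) <= 0).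
Proof.
  intros [_ HU] Ht Hi Hx Hr Hmax.
  set (c := U t (smul x (e i)) - f i t x).
  destruct (HU _ ft fx (C1_star_lift_shift c) t (smul x (e i)) r) as [H1 H2].
  - split; [exact Ht|apply inJ_smul; assumption].
  - exact Hr.
  - intros s p [Hs Hp] Hd. destruct (inJ_coord p Hp) as [j [y [Hj [Hy ->]]]].
    apply pdist_smul in Hd as [Hd1 Hd2]; try assumption.
    rewrite lift_smul; [|intros; rewrite (Hmatch j0 k); auto|exact Hj|exact Hy].
    specialize (Hmax j s y Hj Hs Hy Hd1 Hd2). unfold c. lra.
  - rewrite lift_smul; [|intros; rewrite (Hmatch j k); auto|exact Hi|exact Hx]. unfold c; ring.
  - split; [intros Hx0; apply H1; auto|]. intros ->. apply H2, smul0.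
Qed.

Lemma supersol_test V t i x r :
  supersol T N e L V -> 0 < t < T -> (i < N)%nat -> 0 <= x -> r > 0 ->
  (forall j s y, (j < N)%nat -> 0 < s < T -> 0 <= y -> Rabs (s - t) < r -> bdist i x j y < r ->
     V t (smul x (e i)) - f i t x <= V s (smul y (e j)) - f j s y) ->
  (0 < x -> ft i t x + Hi L i (fx i t x) >= 0) /\
  (x = 0 -> ft 0%nat t 0 + H0 N L (fun j => fx j t 0) >= 0).
Proof.
  intros [_ HU] Ht Hi Hx Hr Hmax.
  set (c := V t (smul x (e i)) - f i t x).
  destruct (HU _ ft fx (C1_star_lift_shift c) t (smul x (e i)) r) as [H1 H2].
  - split; [exact Ht|apply inJ_smul; assumption].
  - exact Hr.
  - intros s p [Hs Hp] Hd. destruct (inJ_coord p Hp) as [j [y [Hj [Hy ->]]]].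
    apply pdist_smul in Hd as [Hd1 Hd2]; try assumption.
    rewrite lift_smul; [|intros; rewrite (Hmatch j0 k); auto|exact Hj|exact Hy].
    specialize (Hmax j s y Hj Hs Hy Hd1 Hd2). unfold c. lra.
  - rewrite lift_smul; [|intros; rewrite (Hmatch j k); auto|exact Hi|exact Hx]. unfold c; ring.
  - split; [intros Hx0; apply H1; auto|]. intros ->. apply H2, smul0.
Qed.

End Tests.

Lemma usc_coord T U i a b Y :
  usc_on T N e U -> (i < N)%nat -> 0 <= a -> b < T ->
  lsc_box a b 0 Y (fun s y => - U s (smul y (e i))).
Proof.
  intros HU Hi Ha Hb s y Hs Hy eps He.
  destruct (HU s (smul y (e i))) with (eps := eps) as [r [Hr H]];
    [split; [lra|apply inJ_smul; [exact Hi|lra]]|exact He|].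
  exists r. split; [exact Hr|]. intros s' y' Hs' Hy' H1 H2.
  specialize (H s' (smul y' (e i))). apply Rplus_lt_reg_l with (U s (smul y (e i)) + eps + U s' (smul y' (e i))).
  assert (U s' (smul y' (e i)) < U s (smul y (e i)) + eps); [|lra].
  apply H; [split; [lra|apply inJ_smul; [exact Hi|lra]]|].
  apply pdist_smul; try lra; try assumption. split; [exact H1|].
  unfold bdist. destruct (Nat.eq_dec i i); [|congruence]. rewrite Rabs_minus_sym; exact H2.
Qed.

Lemma lsc_coord T V i a b Y :
  lsc_on T N e V -> (i < N)%nat -> 0 <= a -> b < T ->
  lsc_box a b 0 Y (fun s y => V s (smul y (e i))).
Proof.
  intros HV Hi Ha Hb s y Hs Hy eps He.
  destruct (HV s (smul y (e i))) with (eps := eps) as [r [Hr H]];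
    [split; [lra|apply inJ_smul; [exact Hi|lra]]|exact He|].
  exists r. split; [exact Hr|]. intros s' y' Hs' Hy' H1 H2.
  apply H; [split; [lra|apply inJ_smul; [exact Hi|lra]]|].
  apply pdist_smul; try lra; try assumption. split; [exact H1|].
  unfold bdist. destruct (Nat.eq_dec i i); [|congruence]. rewrite Rabs_minus_sym; exact H2.
Qed.

End Junction.

(** * Subsolutions along segments *)

Lemma bdist_le i x j y r : 0 <= x -> bdist i x j y < r -> y <= x + r.
Proof.
  unfold bdist. intros Hx H. destruct (Nat.eq_dec i j); [apply Rabs_def2 in H|]; lra.
Qed.

Lemma bdist_same i x y : bdist i x i y = Rabs (x - y).
Proof. unfold bdist. destruct (Nat.eq_dec i i); [reflexivity|congruence]. Qed.

Lemma bdist_diff i j x y : i <> j -> bdist i x j y = x + y.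
Proof. unfold bdist. destruct (Nat.eq_dec i j); [congruence|reflexivity]. Qed.

Section Sub.
Context (N : nat) (e : nat -> pt) (T : R) (L : nat -> R -> R).
Hypothesis HN : (1 <= N)%nat.
Hypothesis Hunit : forall i, (i < N)%nat -> fst (e i) ^ 2 + snd (e i) ^ 2 = 1.
Hypothesis Hdist : forall i j, (i < N)%nat -> (j < N)%nat -> i <> j -> e i <> e j.
Hypothesis HL : forall i, (i < N)%nat -> regular_lagrangian (L i).

Section Penalty.
Context (i : nat) (l al q Lam K : R).

(* Distance to the line [z = al + q t] of branch [i]; the other branches are
   penalised linearly, with a slope [K] that no subsolution can have. *)
Definition penalty (j : nat) (t z : R) : R :=
  if Nat.eq_dec j i then l * t + Lam * (z - (al + q * t)) ^ 2
  else l * t + Lam * (al + q * t) ^ 2 + K * z.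

Definition penalty_t (eps b kap : R) (j : nat) (t z : R) : R :=
  l + eps + kap * (2 * Rmax 0 (t - b)) +
  if Nat.eq_dec j i then - 2 * Lam * q * (z - (al + q * t)) else 2 * Lam * q * (al + q * t).

Definition penalty_x (j : nat) (t z : R) : R :=
  if Nat.eq_dec j i then 2 * Lam * (z - (al + q * t)) else K.

Lemma penalty_cont D j : cont2_on D (penalty j).
Proof.
  unfold penalty. destruct (Nat.eq_dec j i).
  - apply (cont2_ext D (fun t z => l * t + Lam * ((z - (al + q * t)) * (z - (al + q * t))))); [intros; ring|].
    repeat first [apply cont2_minus | apply cont2_plus | apply cont2_mult | apply cont2_const
      | apply cont2_fst | apply cont2_snd].
  - apply (cont2_ext D (fun t z => l * t + Lam * ((al + q * t) * (al + q * t)) + K * z)); [intros; ring|].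
    repeat first [apply cont2_minus | apply cont2_plus | apply cont2_mult | apply cont2_const
      | apply cont2_fst | apply cont2_snd].
Qed.

Lemma penalty_C1 eps b kap j :
  C1_half T (fun t z => penalty j t z + barrier eps b kap t) (penalty_t eps b kap j) (penalty_x j).
Proof.
  unfold penalty, penalty_t, penalty_x, barrier. destruct (Nat.eq_dec j i).
  - eapply C1_half_ext; [| |apply C1_half_shift with (c := Lam * al ^ 2 - eps * b);
      apply (C1_half_quadratic T (l + 2 * Lam * al * q + eps) (Lam * q ^ 2) (- 2 * Lam * q) Lam
               (- 2 * Lam * al) kap b)].
    + intros. split; ring.
    + intros. cbn beta. ring.
  - eapply C1_half_ext; [| |apply C1_half_shift with (c := Lam * al ^ 2 - eps * b);
      apply (C1_half_quadratic T (l + 2 * Lam * al * q + eps) (Lam * q ^ 2) 0 0 K kap b)].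
    + intros. split; ring.
    + intros. cbn beta. ring.
Qed.

End Penalty.

(** If the inequality fails by [eta], maximise [U] minus the penalised distance to the line. At an
    interior maximum on branch [i], the subsolution inequality tested at velocity [q] contradicts
    the slope [eps0]. The disjunction on [q] and [y0] serves the vertex, where only velocities
    [q <= 0] can be tested: a line with [q > 0] starting inside the branch never comes near it. *)
Lemma subsol_segment_aux U i a b y0 q :
  subsol T N e L U -> (i < N)%nat -> 0 <= a -> a < b -> b < T -> 0 <= y0 ->
  0 <= y0 + q * (b - a) -> q <= 0 \/ 0 < y0 ->
  U b (smul (y0 + q * (b - a)) (e i)) <= U a (smul y0 (e i)) + (b - a) * L i q.
Proof.
  intros HU Hi Ha Hab HbT Hy0 Hx Hq. apply Rnot_lt_le. intro Hlt.
  set (x := y0 + q * (b - a)) in *.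
  set (eta := U b (smul x (e i)) - (U a (smul y0 (e i)) + (b - a) * L i q)).
  assert (Heta : 0 < eta) by (unfold eta; lra).
  (* The reference time [b] must not be the last one, so the minimisation extends to some
     [b' < T]. *)
  set (b' := (b + T) / 2). assert (Hb' : b < b' < T) by (unfold b'; lra).
  set (Y := y0 + Rabs q * (b' - a) + 1).
  assert (Hq0 := Rabs_pos q).
  assert (HX : forall t, a <= t <= b' -> - Y <= y0 + q * (t - a) <= Y - 1).
  { intros t Ht. unfold Y. pose proof (Rle_abs q). pose proof (Rle_abs (- q)). rewrite Rabs_Ropp in H0.
    split; nra. }
  assert (HxY : 0 <= x <= Y) by (split; [exact Hx|]; unfold x; specialize (HX b ltac:(lra)); lra).
  set (al := y0 - q * a).
  assert (HXe : forall t, al + q * t = y0 + q * (t - a)) by (intros; unfold al; ring).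
  pose proof (proj1 HU) as Husc.
  destruct (lsc_family_min N a b' 0 Y (fun j s y => - U s (smul y (e j))))
    as [j1 [s1 [y1 [_ [_ [_ Hm]]]]]]; [lia|lra|lra| |].
  { intros j Hj. apply (usc_coord N e Hunit Hdist T); auto; lra. }
  set (m := - U s1 (smul y1 (e j1))) in *.
  (* The barrier then favours time [a] over time [b] by [eta / 4] only, not enough to make up for
     [eta]. *)
  set (eps0 := eta / (4 * (b - a))).
  assert (Heps0 : eps0 * (b - a) = eta / 4) by (unfold eps0; field; lra).
  assert (Heps0p : 0 < eps0) by (unfold eps0; apply Rdiv_lt_0_compat; lra).
  set (l := L i q).
  (* Bound on the penalty at the minimiser, by comparison with [(b, x)], where it vanishes. *)
  set (M0 := - U b (smul x (e i)) - m + Rabs l * (b' - a) + eta / 4).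
  assert (HM0 : 0 < M0).
  { unfold M0. specialize (Hm i b x Hi ltac:(lra) ltac:(lra)).
    pose proof (Rabs_pos l). assert (0 <= Rabs l * (b' - a)) by nra. lra. }
  destruct (Husc a (smul y0 (e i))) with (eps := eta / 4) as [r [Hr Hrusc]];
    [split; [lra|apply inJ_smul; assumption]|lra|].
  (* [rho] is the scale at which [U] is controlled at time [a]; if [y0 > 0] it is also at most [y0],
     so that an increasing line stays at distance [rho] from the vertex. *)
  assert (Hrho : exists rho, 0 < rho /\ rho <= r /\ rho <= 1 /\ (0 < y0 -> rho <= y0)).
  { destruct (Rlt_dec 0 y0) as [H|H].
    - exists (Rmin (Rmin r 1) y0). pose proof (Rmin_l (Rmin r 1) y0). pose proof (Rmin_r (Rmin r 1) y0).
      pose proof (Rmin_l r 1). pose proof (Rmin_r r 1).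
      split; [repeat apply Rmin_glb_lt; lra|]. repeat split; lra.
    - exists (Rmin r 1). pose proof (Rmin_l r 1). pose proof (Rmin_r r 1).
      split; [apply Rmin_glb_lt; lra|]. repeat split; lra. }
  destruct Hrho as [rho [Hrho [Hrhor [Hrho1 Hrhoy]]]].
  (* With this [Lam], a distance [rho / 2] from the line already costs more than [M0]. *)
  set (Lam := 4 * (M0 + 1) / rho ^ 2).
  assert (HLam : Lam * rho ^ 2 = 4 * (M0 + 1)) by (unfold Lam; field; lra).
  assert (HLamp : 0 < Lam) by (unfold Lam; apply Rdiv_lt_0_compat; nra).
  assert (HLd : forall d, rho / 2 <= Rabs d -> M0 < Lam * d ^ 2).
  { intros d Hd. rewrite <- (pow2_abs d). assert ((rho / 2) ^ 2 <= Rabs d ^ 2) by (apply pow_incr; lra). nra. }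
  destruct (finite_bound (fun j => L j 1) N) as [B HB].
  (* The first three terms dominate [L j 1] and the time derivative of the penalty, so
     [Hi L j K >= K - L j 1] contradicts a maximum on another branch; the last one forces a maximum
     there to lie close to the vertex. *)
  set (K := Rabs B + Rabs l + 2 * Lam * Y * Rabs q + 2 * (M0 + 1) / rho).
  assert (HYp : 0 < Y) by (specialize (HX a ltac:(lra)); lra).
  assert (HKr : 2 * (M0 + 1) <= K * rho).
  { unfold K. pose proof (Rabs_pos B). pose proof (Rabs_pos l).
    assert (0 <= 2 * Lam * Y * Rabs q) by (apply Rmult_le_pos; nra).
    assert (2 * (M0 + 1) / rho * rho = 2 * (M0 + 1)) by (field; lra). nra. }
  assert (HKp : 0 <= K) by nra.
  destruct (barrier_min N a b' Y b eps0
     (fun j s y => - U s (smul y (e j)) + penalty i l al q Lam K j s y) i x)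
    as [kap [j [s [z [Hkap [Hj [Hs [Hz Hmin]]]]]]]]; [exact Hi|lra|lra|lra| |].
  { intros j Hj. apply lsc_box_plus; [apply (usc_coord N e Hunit Hdist T); auto; lra|].
    apply cont2_lsc, penalty_cont. }
  assert (Hval := Hmin i b x Hi ltac:(lra) ltac:(lra)).
  rewrite barrier_at in Hval.
  assert (HP0 : penalty i l al q Lam K i b x = l * b).
  { unfold penalty. destruct (Nat.eq_dec i i); [|congruence]. rewrite HXe. fold x. rewrite Rminus_diag. ring. }
  rewrite HP0 in Hval. clear HP0.
  set (pen := penalty i l al q Lam K j s z - l * s).
  assert (Hpen : pen <= M0).
  { unfold M0, pen. assert (H1 := Hm j s z Hj ltac:(lra) Hz).
    pose proof (barrier_ge eps0 b kap s Hkap).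
    assert (l * (b - s) <= Rabs l * (b' - a)).
    { pose proof (Rle_abs l). pose proof (Rle_abs (- l)). rewrite Rabs_Ropp in H2.
      destruct (Rle_dec s b); [apply Rle_trans with (Rabs l * (b - s))|apply Rle_trans with (Rabs l * (s - b))]; nra. }
    nra. }
  assert (HpenE : (j = i -> pen = Lam * (z - (y0 + q * (s - a))) ^ 2) /\
     (j <> i -> pen = Lam * (y0 + q * (s - a)) ^ 2 + K * z)).
  { unfold pen, penalty. destruct (Nat.eq_dec j i); split; intros; try congruence; rewrite <- HXe; ring. }
  destruct HpenE as [HpenE1 HpenE2].
  assert (Hpenpos : 0 <= pen).
  { destruct (Nat.eq_dec j i) as [Hji|Hji]; [rewrite (HpenE1 Hji)|rewrite (HpenE2 Hji)].
    - pose proof (pow2_ge_0 (z - (y0 + q * (s - a)))). nra.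
    - pose proof (pow2_ge_0 (y0 + q * (s - a))). nra. }
  assert (Hsa : a < s).
  (* At time [a] the penalty bound puts the minimiser within [rho] of [y0], where upper
     semicontinuity costs [eta / 4]; with the [eta / 4] of the barrier this is less than [eta]. *)
  { destruct (Req_dec s a) as [Hsa|]; [exfalso|lra].
    rewrite barrier_before in Hval by lra. rewrite Hsa in Hval, HpenE1, HpenE2.
    replace (y0 + q * (a - a)) with y0 in HpenE1, HpenE2 by ring.
    assert (Hnear : bdist i y0 j z < rho).
    { apply Rnot_le_lt. intro Hfar. destruct (Nat.eq_dec j i) as [Hji|Hji].
      - specialize (HpenE1 Hji). rewrite Hji, bdist_same, Rabs_minus_sym in Hfar.
        specialize (HLd (z - y0) ltac:(lra)). lra.
      - specialize (HpenE2 Hji). rewrite bdist_diff in Hfar by congruence.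
        destruct (Rle_dec (rho / 2) y0) as [Hc|Hc].
        + specialize (HLd y0). rewrite Rabs_pos_eq in HLd by lra. specialize (HLd Hc). nra.
        + pose proof (pow2_ge_0 y0). nra. }
    assert (HUz : U a (smul z (e j)) < U a (smul y0 (e i)) + eta / 4).
    { apply Hrusc; [split; [lra|apply inJ_smul; [exact Hj|lra]]|].
      apply pdist_smul; auto; [lra|]. rewrite Rminus_diag, Rabs_R0. lra. }
    unfold pen in Hpenpos. rewrite Hsa in Hpenpos. unfold eta, l in *. nra. }
  assert (HzY : z < Y).
  { destruct (Req_dec z Y) as [HzY|]; [exfalso|lra].
    destruct (Nat.eq_dec j i) as [Hji|Hji].
    - specialize (HpenE1 Hji). specialize (HX s ltac:(lra)).
      specialize (HLd (z - (y0 + q * (s - a)))). rewrite Rabs_pos_eq in HLd by lra.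
      specialize (HLd ltac:(lra)). lra.
    - specialize (HpenE2 Hji). pose proof (pow2_ge_0 (y0 + q * (s - a))).
      assert (HY1 : 1 <= Y) by (specialize (HX a ltac:(lra)); lra).
      assert (K * rho <= K * z) by (apply Rmult_le_compat_l; lra).
      assert (0 <= Lam * (y0 + q * (s - a)) ^ 2) by (apply Rmult_le_pos; lra). lra. }
  set (rr := Rmin (Rmin (s - a) (b' - s)) (Y - z)).
  assert (Hrr : 0 < rr) by (unfold rr; repeat apply Rmin_glb_lt; lra).
  assert (Hrrb : rr <= s - a /\ rr <= b' - s /\ rr <= Y - z).
  { unfold rr. pose proof (Rmin_l (Rmin (s - a) (b' - s)) (Y - z)).
    pose proof (Rmin_r (Rmin (s - a) (b' - s)) (Y - z)).
    pose proof (Rmin_l (s - a) (b' - s)). pose proof (Rmin_r (s - a) (b' - s)). lra. }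
  destruct (subsol_test N e Hunit Hdist T L
    (fun j t z => penalty i l al q Lam K j t z + barrier eps0 b kap t)
    (penalty_t i l al q Lam eps0 b kap) (penalty_x i al q Lam K)) with (U := U) (t := s) (i := j) (x := z) (r := rr)
    as [Ht1 Ht2]; auto; try lra.
  { intros j' k' t' _ _. f_equal. unfold penalty.
    destruct (Nat.eq_dec j' i), (Nat.eq_dec k' i); ring. }
  { intros k _. apply penalty_C1. }
  { intros k s' y' Hk Hs' Hy' H1 H2. apply bdist_le in H2; [|lra]. apply Rabs_def2 in H1.
    specialize (Hmin k s' y' Hk ltac:(lra) ltac:(lra)). lra. }
  assert (Hmaxp : 0 <= kap * (2 * Rmax 0 (s - b))).
  { pose proof (Rmax_l 0 (s - b)). nra. }
  destruct (Req_dec z 0) as [Hz0|Hz0].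
  - specialize (Ht2 Hz0).
    (* For [q > 0] the line is at distance at least [rho] from the vertex, which the penalty at
       [z = 0] excludes. *)
    assert (Hq' : q <= 0).
    { destruct Hq as [Hq|Hy0p]; [exact Hq|]. apply Rnot_lt_le. intro Hqp.
      assert (HXs : rho <= y0 + q * (s - a)).
      { specialize (Hrhoy Hy0p). assert (0 <= q * (s - a)) by (apply Rmult_le_pos; lra). lra. }
      specialize (HLd (y0 + q * (s - a))). rewrite Rabs_pos_eq in HLd by lra. specialize (HLd ltac:(lra)).
      destruct (Nat.eq_dec j i) as [Hji|Hji]; [specialize (HpenE1 Hji)|specialize (HpenE2 Hji)];
        rewrite Hz0 in *; nra. }
    assert (HH := H0_ge N L HN (fun j => penalty_x i al q Lam K j s 0) i Hi). cbv beta in HH.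
    assert (HH2 := Hminus_ge N L HL i (penalty_x i al q Lam K i s 0) q Hi Hq').
    unfold penalty_x in HH2 at 1. destruct (Nat.eq_dec i i) as [_|]; [|congruence].
    fold l in HH2.
    assert (Ht0 : penalty_t i l al q Lam eps0 b kap 0 s 0 =
      l + eps0 + kap * (2 * Rmax 0 (s - b)) + 2 * Lam * q * (al + q * s)).
    { unfold penalty_t. destruct (Nat.eq_dec 0 i); ring. }
    rewrite Ht0 in Ht2. lra.
  - specialize (Ht1 ltac:(lra)). unfold penalty_t, penalty_x in Ht1.
    destruct (Nat.eq_dec j i) as [->|Hji].
    + assert (HH := Hi_ge N L HL i (2 * Lam * (z - (al + q * s))) q Hi). fold l in HH. lra.
    + assert (HH := Hi_ge N L HL j K 1 Hj). specialize (HB j Hj). cbv beta in HB.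
      assert (HB2 := Rle_abs B). rewrite HXe in Ht1.
      specialize (HX s ltac:(lra)).
      assert (Habs : - (2 * Lam * q * (y0 + q * (s - a))) <= 2 * Lam * Y * Rabs q).
      { assert (- (q * (y0 + q * (s - a))) <= Rabs q * Y).
        { eapply Rle_trans; [apply Rle_abs|]. rewrite Rabs_Ropp, Rabs_mult.
          apply Rmult_le_compat_l; [exact Hq0|]. apply Rabs_le. lra. }
        assert (2 * Lam * - (q * (y0 + q * (s - a))) <= 2 * Lam * (Rabs q * Y))
          by (apply Rmult_le_compat_l; lra). lra. }
      assert (Hll : - l <= Rabs l) by (rewrite <- Rabs_Ropp; apply Rle_abs).
      assert (0 < 2 * (M0 + 1) / rho) by (apply Rdiv_lt_0_compat; lra).
      unfold K in *. lra.
Qed.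

Lemma subsol_segment U i s t x y :
  subsol T N e L U -> (i < N)%nat -> 0 <= s -> s < t -> t < T -> 0 <= x -> 0 <= y ->
  U t (smul x (e i)) <= U s (smul y (e i)) + (t - s) * L i ((x - y) / (t - s)).
Proof.
  intros HU Hi Hs Hst HtT Hx Hy.
  assert (E : forall y, y + (x - y) / (t - s) * (t - s) = x) by (intros; field; lra).
  destruct (Rle_dec ((x - y) / (t - s)) 0) as [Hq|Hq]; [|destruct (Rlt_dec 0 y) as [Hyp|Hyp]].
  - rewrite <- (E y) at 1. apply subsol_segment_aux; auto. rewrite E; exact Hx.
  - rewrite <- (E y) at 1. apply subsol_segment_aux; auto. rewrite E; exact Hx.
  (* A segment leaving the vertex: start from the height [dl > 0] instead. Upper semicontinuity of
     [U] at time [s] and continuity of [L i] each absorb [eta / 2]. *)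
  - replace y with 0 in * by lra. apply Rnot_lt_le. intro Hlt.
    set (eta := U t (smul x (e i)) - (U s (smul 0 (e i)) + (t - s) * L i ((x - 0) / (t - s)))).
    assert (Heta : 0 < eta) by (unfold eta; lra).
    destruct (proj1 HU s (smul 0 (e i))) with (eps := eta / 2) as [r [Hr Hrusc]];
      [split; [lra|apply inJ_smul; [assumption|lra]]|lra|].
    destruct (HL i Hi) as [Hcont _].
    destruct (Hcont ((x - 0) / (t - s)) (eta / (2 * (t - s)))) as [d [Hd Hdc]];
      [apply Rdiv_lt_0_compat; lra|].
    set (dl := Rmin (r / 2) (d * (t - s) / 2)).
    assert (Hdt : 0 < d * (t - s)) by (apply Rmult_lt_0_compat; lra).
    assert (Hdl : 0 < dl) by (unfold dl; apply Rmin_glb_lt; lra).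
    assert (Hdl1 : dl <= r / 2) by apply Rmin_l. assert (Hdl2 : dl <= d * (t - s) / 2) by apply Rmin_r.
    assert (HS := subsol_segment_aux U i s t dl ((x - dl) / (t - s)) HU Hi Hs Hst HtT ltac:(lra)).
    rewrite E in HS. specialize (HS Hx (or_intror Hdl)).
    assert (HUd : U s (smul dl (e i)) < U s (smul 0 (e i)) + eta / 2).
    { apply Hrusc; [split; [lra|apply inJ_smul; [assumption|lra]]|].
      apply pdist_smul; auto; try lra. rewrite Rminus_diag, Rabs_R0, bdist_same, Rminus_0_l, Rabs_Ropp, Rabs_pos_eq; lra. }
    assert (HLd : L i ((x - dl) / (t - s)) < L i ((x - 0) / (t - s)) + eta / (2 * (t - s))).
    { assert (Hr' : Rabs (L i ((x - dl) / (t - s)) - L i ((x - 0) / (t - s))) < eta / (2 * (t - s))).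
      { apply (Hdc ((x - dl) / (t - s))). split.
        - split; [exact I|]. intro E'. apply (f_equal (fun v => v * (t - s))) in E'. field_simplify in E'; lra.
        - cbn. unfold Rdist.
          replace ((x - dl) / (t - s) - (x - 0) / (t - s)) with (- (dl / (t - s))) by (field; lra).
          rewrite Rabs_Ropp, Rabs_pos_eq by (apply Rle_mult_inv_pos; lra).
          apply Rmult_lt_reg_r with (t - s); [lra|].
          replace (dl / (t - s) * (t - s)) with dl by (field; lra). lra. }
      apply Rabs_def2 in Hr'. lra. }
    apply Rmult_lt_compat_l with (r := t - s) in HLd; [|lra].
    replace ((t - s) * (L i ((x - 0) / (t - s)) + eta / (2 * (t - s))))
      with ((t - s) * L i ((x - 0) / (t - s)) + eta / 2) in HLd by (field; lra).
    unfold eta in *. lra.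
Qed.

End Sub.

(** * The value function *)

(* Cost of a trajectory that reaches the vertex from branch [j] at time [tau] and
   then waits there, [l0] being the cheapest waiting cost. *)
Definition vertex_cost (N : nat) (L w0 : nat -> R -> R) (l0 t m : R) : Prop :=
  exists j y tau, (j < N)%nat /\ 0 <= y /\ 0 < tau <= t /\
    m = w0 j y + tau * L j (- y / tau) + (t - tau) * l0.

Definition vertex_value (N : nat) (L w0 : nat -> R -> R) (l0 t : R) : R :=
  if Rle_dec t 0 then w0 0%nat 0 else Rinf (vertex_cost N L w0 l0 t).

(** By convexity one straight piece after the last visit to the vertex is enough; all that precedes
    this visit is summarised by [vertex_value] at its time [s]. *)
Definition branch_cost (N : nat) (L w0 : nat -> R -> R) (l0 t : R) (i : nat) (x m : R) : Prop :=
  (exists y, 0 <= y /\ m = w0 i y + t * L i ((x - y) / t)) \/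
  (exists s, 0 <= s < t /\ m = vertex_value N L w0 l0 s + (t - s) * L i (x / (t - s))).

Definition value (N : nat) (L w0 : nat -> R -> R) (l0 t : R) (i : nat) (x : R) : R :=
  if Rle_dec t 0 then w0 i x
  else if Req_dec_T x 0 then vertex_value N L w0 l0 t
  else Rinf (branch_cost N L w0 l0 t i x).

(** [adm_growth] says that the running cost plus [C] pays for the variation of the initial datum
    along any motion, and [adm_slow] that moving at speed at most one costs at most [C]. The single
    constant [C] then governs all Lipschitz bounds of the value. *)
Record admissible (N : nat) (L w0 : nat -> R -> R) (j0 : nat) (K0 C : R) : Prop := {
  adm_L : forall i, (i < N)%nat -> regular_lagrangian (L i);
  adm_j0 : (j0 < N)%nat;
  adm_l0 : forall j, (j < N)%nat -> L j0 0 <= L j 0;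
  adm_w0 : forall i x y, (i < N)%nat -> 0 <= x -> 0 <= y ->
    Rabs (w0 i x - w0 i y) <= K0 * Rabs (x - y);
  adm_w00 : forall i j, (i < N)%nat -> (j < N)%nat -> w0 i 0 = w0 j 0;
  adm_C : 0 < C;
  adm_K0 : K0 <= C;
  adm_growth : forall i q, (i < N)%nat -> K0 * Rabs q - C <= L i q;
  adm_slow : forall i q, (i < N)%nat -> Rabs q <= 1 -> L i q <= C }.

Ltac unpack Hd := pose proof Hd as [HL Hj0 Hl0 Hw0 Hw00 HC0 HK0C HCL HCu].

Section Value.
Context {N : nat} {L w0 : nat -> R -> R} {j0 : nat} {K0 C : R}.
Hypothesis Hd : admissible N L w0 j0 K0 C.

Notation l0 := (L j0 0).
Notation A := (vertex_value N L w0 l0).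
Notation val := (value N L w0 l0).

Lemma initial_move i y q h :
  (i < N)%nat -> 0 <= y -> 0 <= h -> 0 <= y + q * h -> w0 i (y + q * h) <= w0 i y + h * (L i q + C).
Proof.
  unpack Hd.
  intros Hi Hy Hh Hyq. assert (H := Hw0 i (y + q * h) y Hi Hyq Hy).
  replace (y + q * h - y) with (q * h) in H by ring. rewrite Rabs_mult, (Rabs_pos_eq h) in H by exact Hh.
  assert (H1 := Rle_abs (w0 i (y + q * h) - w0 i y)). specialize (HCL i q Hi). nra.
Qed.

Lemma wait_cost_bound : - C <= l0 <= C.
Proof.
  unpack Hd.
  assert (H := HCL j0 0 Hj0). rewrite Rabs_R0 in H. split; [lra|].
  apply HCu; [exact Hj0|rewrite Rabs_R0; lra].
Qed.

Lemma vertex_value_0 : A 0 = w0 0%nat 0.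
Proof. unfold vertex_value. destruct (Rle_dec 0 0); [reflexivity|lra]. Qed.

(* Cut off the initial part of the trajectory, of duration [t - s]. *)
Lemma vertex_cost_cut s t m :
  0 <= s -> s <= t -> vertex_cost N L w0 l0 t m ->
  (0 < s -> exists m', vertex_cost N L w0 l0 s m' /\ m' <= m + C * (t - s)) /\
  (s = 0 -> w0 0%nat 0 <= m + C * t).
Proof.
  unpack Hd.
  intros Hs Hst [j [y [tau [Hj [Hy [Ht ->]]]]]]. pose proof wait_cost_bound as Hl.
  set (q := - y / tau). assert (Eq : q * tau = - y) by (unfold q; field; lra).
  (* If the vertex is reached by time [s], the waiting is shortened. Otherwise all the waiting
     disappears and the trajectory starts at [- (q * s)], from which the vertex is reached in time
     exactly [s]. *)
  destruct (Rle_dec tau s) as [Hts|Hts].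
  - split; [|lra]. intros _. exists (w0 j y + tau * L j q + (s - tau) * l0).
    split; [exists j, y, tau; repeat split; auto; lra|]. fold q. nra.
  - assert (Hmove := initial_move j y q (tau - s) Hj Hy ltac:(lra)).
    assert (Eys : y + q * (tau - s) = - (q * s)) by nra.
    assert (Hqs : 0 <= - (q * s)).
    { replace (- (q * s)) with (y / tau * s) by (unfold q; field; lra).
      apply Rmult_le_pos; [apply Rle_mult_inv_pos; lra|lra]. }
    rewrite Eys in Hmove. specialize (Hmove Hqs).
    split.
    + intros Hs0. exists (w0 j (- (q * s)) + s * L j (- (- (q * s)) / s) + (s - s) * l0).
      split; [exists j, (- (q * s)), s; repeat split; auto; lra|].
      replace (- - (q * s) / s) with q by (field; lra). fold q.
      assert ((t - tau) * (- C) <= (t - tau) * l0) by (apply Rmult_le_compat_l; lra). nra.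
    + intros ->. replace (- (q * 0)) with 0 in Hmove by ring. fold q.
      rewrite (Hw00 0%nat j) by (auto; lia).
      assert ((t - tau) * (- C) <= (t - tau) * l0) by (apply Rmult_le_compat_l; lra). nra.
Qed.

Lemma vertex_cost_wait t : 0 < t -> vertex_cost N L w0 l0 t (w0 0%nat 0 + t * l0).
Proof.
  unpack Hd.
  intros Ht. exists j0, 0, t. repeat split; auto; try lra.
  rewrite (Hw00 0%nat j0) by (auto; lia). replace (- 0 / t) with 0 by (field; lra). ring.
Qed.

(** The lower bound that makes the infimum meaningful is the cut down to time 0. *)
Lemma vertex_value_glb t : 0 < t ->
  (forall m, vertex_cost N L w0 l0 t m -> A t <= m) /\
  (forall c, (forall m, vertex_cost N L w0 l0 t m -> c <= m) -> c <= A t).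
Proof.
  unpack Hd.
  intros Ht. unfold vertex_value. destruct (Rle_dec t 0); [lra|].
  apply Rinf_glb with (w0 0%nat 0 - C * t); [exists (w0 0%nat 0 + t * l0); apply vertex_cost_wait; exact Ht|].
  intros m Hm. destruct (vertex_cost_cut 0 t m) as [_ H]; [lra|lra|exact Hm|]. specialize (H eq_refl). lra.
Qed.

Lemma vertex_value_cut s t : 0 <= s -> s <= t -> A s <= A t + C * (t - s).
Proof.
  unpack Hd.
  intros Hs Hst. destruct (Req_dec s t) as [->|]; [lra|].
  assert (A s - C * (t - s) <= A t); [|lra].
  apply vertex_value_glb; [lra|]. intros m Hm.
  destruct (vertex_cost_cut s t m Hs Hst Hm) as [H1 H2].
  destruct (Req_dec s 0) as [->|].
  - rewrite vertex_value_0. specialize (H2 eq_refl). lra.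
  - destruct H1 as [m' [Hm' Hle]]; [lra|].
    assert (A s <= m') by (apply vertex_value_glb; [lra|exact Hm']). lra.
Qed.

Lemma vertex_value_wait s t : 0 <= s -> s <= t -> A t <= A s + (t - s) * l0.
Proof.
  unpack Hd.
  intros Hs Hst. destruct (Req_dec s t) as [->|]; [lra|].
  destruct (Req_dec s 0) as [->|].
  - rewrite vertex_value_0, Rminus_0_r. apply vertex_value_glb; [lra|apply vertex_cost_wait; lra].
  - assert (A t - (t - s) * l0 <= A s); [|lra].
    apply vertex_value_glb; [lra|]. intros m [j [y [tau [Hj [Hy [Ht ->]]]]]].
    assert (A t <= w0 j y + tau * L j (- y / tau) + (t - tau) * l0); [|lra].
    apply vertex_value_glb; [lra|]. exists j, y, tau. repeat split; auto; lra.
Qed.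

Lemma vertex_value_arrive j y t :
  (j < N)%nat -> 0 <= y -> 0 < t -> A t <= w0 j y + t * L j (- y / t).
Proof.
  unpack Hd.
  intros Hj Hy Ht. apply vertex_value_glb; [exact Ht|].
  exists j, y, t. repeat split; auto; try lra.
Qed.

Lemma value_0 i x : val 0 i x = w0 i x.
Proof. unfold value. destruct (Rle_dec 0 0); [reflexivity|lra]. Qed.

Lemma value_vertex t i : (i < N)%nat -> 0 <= t -> val t i 0 = A t.
Proof.
  unpack Hd.
  intros Hi Ht. unfold value, vertex_value. destruct (Rle_dec t 0); [apply Hw00; [exact Hi|lia]|].
  destruct (Req_dec_T 0 0); [reflexivity|congruence].
Qed.

Lemma branch_cost_cut s t i x m :
  (i < N)%nat -> 0 <= x -> 0 <= s -> s < t -> branch_cost N L w0 l0 t i x m ->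
  (0 < s -> exists m', branch_cost N L w0 l0 s i x m' /\ m' <= m + C * (t - s)) /\
  (s = 0 -> w0 i x <= m + C * t).
Proof.
  unpack Hd.
  intros Hi Hx Hs Hst Hm.
  (* Common case of a final straight piece of duration [s + h]: what precedes it is dropped, its
     first [h] units are cut, and it starts from a later point of the same line. *)
  assert (Hline : forall y q h m, 0 <= y -> 0 <= h <= t - s -> x = y + q * (s + h) ->
     w0 i y + (s + h) * L i q - C * (t - s - h) <= m ->
     (0 < s -> exists m', branch_cost N L w0 l0 s i x m' /\ m' <= m + C * (t - s)) /\
     (s = 0 -> w0 i x <= m + C * t)).
  { intros y q h m' Hy Hh Ex Hle.
    assert (Hyq : 0 <= y + q * h).
    { destruct (Rle_dec 0 q); [assert (0 <= q * h) by (apply Rmult_le_pos; lra); lra|].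
      assert (q * s <= 0) by nra. lra. }
    assert (Hmove := initial_move i y q h Hi Hy ltac:(lra) Hyq). split.
    - intros Hs0. exists (w0 i (y + q * h) + s * L i q). split; [|lra].
      left. exists (y + q * h). split; [exact Hyq|]. do 3 f_equal. rewrite Ex. field. lra.
    - intros ->. rewrite Ex, Rplus_0_l. lra. }
  destruct Hm as [[y [Hy ->]]|[r [Hr ->]]].
  - apply (Hline y ((x - y) / t) (t - s)); replace (s + (t - s)) with t by ring;
      [exact Hy|lra|field; lra|lra].
  - set (q := x / (t - r)). assert (Eq : q * (t - r) = x) by (unfold q; field; lra).
    (* If the cut ends before the vertex is left, the departure time moves to [r - (t - s)];
       otherwise the whole part up to the vertex is dropped and the cut falls inside the straight
       piece. *)
    destruct (Rle_dec (t - s) r) as [Hrs|Hrs].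
    + split; [|lra]. intros Hs0. exists (A (r - (t - s)) + (s - (r - (t - s))) * L i (x / (s - (r - (t - s))))).
      split; [right; exists (r - (t - s)); split; [lra|reflexivity]|].
      replace (s - (r - (t - s))) with (t - r) by ring. fold q.
      assert (H := vertex_value_cut (r - (t - s)) r ltac:(lra) ltac:(lra)).
      replace (r - (r - (t - s))) with (t - s) in H by ring. lra.
    + apply (Hline 0 q (t - s - r)); try lra.
      assert (H := vertex_value_cut 0 r ltac:(lra) ltac:(lra)).
      rewrite vertex_value_0, (Hw00 0%nat i) in H by (auto; lia).
      replace (s + (t - s - r)) with (t - r) by ring. lra.
Qed.

Lemma value_glb t i x : (i < N)%nat -> 0 < t -> 0 < x ->
  (forall m, branch_cost N L w0 l0 t i x m -> val t i x <= m) /\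
  (forall c, (forall m, branch_cost N L w0 l0 t i x m -> c <= m) -> c <= val t i x).
Proof.
  unpack Hd.
  intros Hi Ht Hx. unfold value. destruct (Rle_dec t 0); [lra|].
  destruct (Req_dec_T x 0); [lra|].
  apply Rinf_glb with (w0 i x - C * t).
  - exists (w0 i x + t * L i ((x - x) / t)). left. exists x. split; [lra|reflexivity].
  - intros m Hm. destruct (branch_cost_cut 0 t i x m Hi) as [_ H]; [lra|lra|lra|exact Hm|].
    specialize (H eq_refl). lra.
Qed.

Lemma value_le t i x m :
  (i < N)%nat -> 0 < t -> 0 <= x -> branch_cost N L w0 l0 t i x m -> val t i x <= m.
Proof.
  unpack Hd.
  intros Hi Ht Hx Hm. destruct (Req_dec x 0) as [->|]; [|apply value_glb; auto; lra].
  rewrite value_vertex by (auto; lra).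
  destruct Hm as [[y [Hy ->]]|[s [Hs ->]]].
  - rewrite Rminus_0_l. apply vertex_value_arrive; auto.
  (* A straight piece from the vertex to itself stands still at cost [L i 0], which is at least
     [l0]. *)
  - eapply Rle_trans; [apply (vertex_value_wait s t); lra|].
    replace (0 / (t - s)) with 0 by (field; lra). specialize (Hl0 i Hi). nra.
Qed.

Lemma value_cut s t i x :
  (i < N)%nat -> 0 <= x -> 0 <= s -> s <= t -> val s i x <= val t i x + C * (t - s).
Proof.
  unpack Hd.
  intros Hi Hx Hs Hst. destruct (Req_dec s t) as [->|]; [lra|].
  destruct (Req_dec x 0) as [->|].
  - rewrite !value_vertex by (auto; lra). apply vertex_value_cut; lra.
  - assert (val s i x - C * (t - s) <= val t i x); [|lra].
    apply value_glb; [exact Hi|lra|lra|]. intros m Hm.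
    destruct (branch_cost_cut s t i x m Hi Hx Hs ltac:(lra) Hm) as [H1 H2].
    destruct (Req_dec s 0) as [->|].
    + rewrite value_0. specialize (H2 eq_refl). lra.
    + destruct H1 as [m' [Hm' Hle]]; [lra|].
      assert (val s i x <= m') by (apply value_le; auto; lra). lra.
Qed.

Lemma value_segment s t i x y :
  (i < N)%nat -> 0 <= s -> s < t -> 0 <= x -> 0 <= y ->
  val t i x <= val s i y + (t - s) * L i ((x - y) / (t - s)).
Proof.
  unpack Hd.
  intros Hi Hs Hst Hx Hy. destruct (Req_dec s 0) as [->|Hs0].
  - rewrite value_0, Rminus_0_r. apply value_le; auto. left. exists y. auto.
  - destruct (Req_dec y 0) as [->|Hy0].
    + rewrite value_vertex, Rminus_0_r by (auto; lra). apply value_le; auto; [lra|].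
      right. exists s. split; [lra|reflexivity].
    + assert (val t i x - (t - s) * L i ((x - y) / (t - s)) <= val s i y); [|lra].
      apply value_glb; [exact Hi|lra|lra|]. intros m [[z [Hz ->]]|[r [Hr ->]]].
      * assert (HJ := perspective_subadditive (L i) s (t - s) (y - z) (x - y) (HL i Hi) ltac:(lra) ltac:(lra)).
        replace (s + (t - s)) with t in HJ by ring. replace (y - z + (x - y)) with (x - z) in HJ by ring.
        assert (val t i x <= w0 i z + t * L i ((x - z) / t)); [|lra].
        apply value_le; auto; [lra|]. left. exists z. auto.
      * assert (HJ := perspective_subadditive (L i) (s - r) (t - s) y (x - y) (HL i Hi) ltac:(lra) ltac:(lra)).
        replace (s - r + (t - s)) with (t - r) in HJ by ring. replace (y + (x - y)) with x in HJ by ring.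
        assert (val t i x <= A r + (t - r) * L i (x / (t - r))); [|lra].
        apply value_le; auto; [lra|]. right. exists r. split; [lra|reflexivity].
Qed.

Lemma value_rest s t i x :
  (i < N)%nat -> 0 <= x -> 0 <= s -> s <= t -> val t i x <= val s i x + C * (t - s).
Proof.
  unpack Hd.
  intros Hi Hx Hs Hst. destruct (Req_dec s t) as [->|]; [lra|].
  eapply Rle_trans; [apply (value_segment s t i x x); auto; lra|].
  replace ((x - x) / (t - s)) with 0 by (field; lra).
  assert (H' := HCu i 0 Hi). rewrite Rabs_R0 in H'. specialize (H' ltac:(lra)). nra.
Qed.

Lemma value_initial t i x : (i < N)%nat -> 0 <= x -> 0 <= t -> Rabs (val t i x - w0 i x) <= C * t.
Proof.
  unpack Hd.
  intros Hi Hx Ht. assert (H1 := value_rest 0 t i x Hi Hx ltac:(lra) Ht).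
  assert (H2 := value_cut 0 t i x Hi Hx ltac:(lra) Ht). rewrite value_0 in *. apply Rabs_le. lra.
Qed.

(** If [d < t], go back by time [d] and travel from [y] to [x] at unit speed: [C * d] for the travel
    and [C * d] for the cut. If [t <= d], compare both values with the initial datum, which costs
    twice [C * t] plus [K0 * d]; this explains the factor 3. *)
Lemma value_lipschitz_x t i x y :
  (i < N)%nat -> 0 <= x -> 0 <= y -> 0 <= t -> val t i x <= val t i y + 3 * C * Rabs (x - y).
Proof.
  unpack Hd.
  intros Hi Hx Hy Ht. set (d := Rabs (x - y)). assert (Hdp : 0 <= d) by apply Rabs_pos.
  destruct (Rlt_dec d t) as [Hdt|Hdt].
  - destruct (Req_dec d 0) as [Hd0|Hd0].
    { replace x with y; [nra|]. unfold d in Hd0. destruct (Req_dec x y); [auto|].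
      exfalso. apply (Rabs_no_R0 (x - y)); [lra|exact Hd0]. }
    assert (HS := value_segment (t - d) t i x y Hi ltac:(lra) ltac:(lra) Hx Hy).
    replace (t - (t - d)) with d in HS by ring.
    assert (Hone : L i ((x - y) / d) <= C).
    { apply HCu; [exact Hi|]. unfold Rdiv. rewrite Rabs_mult, Rabs_inv. fold d.
      rewrite (Rabs_pos_eq d) by exact Hdp. right. field. exact Hd0. }
    assert (HD := value_cut (t - d) t i y Hi Hy ltac:(lra) ltac:(lra)). nra.
  - assert (H1 := value_initial t i x Hi Hx Ht). assert (H2 := value_initial t i y Hi Hy Ht).
    assert (H3 := Hw0 i x y Hi Hx Hy). fold d in H3.
    pose proof (Rle_abs (val t i x - w0 i x)). pose proof (Rle_abs (w0 i x - w0 i y)).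
    pose proof (Rle_abs (- (val t i y - w0 i y))). rewrite Rabs_Ropp in H4.
    assert (K0 * d <= C * d) by (apply Rmult_le_compat_r; lra).
    assert (C * t <= C * d) by (apply Rmult_le_compat_l; lra). lra.
Qed.

Lemma value_lipschitz t i x s j y :
  (i < N)%nat -> (j < N)%nat -> 0 <= x -> 0 <= y -> 0 <= t -> 0 <= s ->
  Rabs (val t i x - val s j y) <= 3 * C * (Rabs (t - s) + bdist i x j y).
Proof.
  unpack Hd.
  intros Hi Hj Hx Hy Ht Hs.
  assert (Htime : forall t s, 0 <= t -> 0 <= s -> val t i x <= val s i x + C * Rabs (t - s)).
  { clear t s Ht Hs. intros t s Ht Hs. destruct (Rle_dec s t).
    - rewrite Rabs_pos_eq by lra. apply value_rest; auto.
    - rewrite Rabs_minus_sym, Rabs_pos_eq by lra. apply value_cut; auto; lra. }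
  assert (Hspace : forall i x j y, (i < N)%nat -> (j < N)%nat -> 0 <= x -> 0 <= y ->
    val s i x <= val s j y + 3 * C * bdist i x j y).
  { clear i x j y Hi Hj Hx Hy Htime. intros i x j y Hi Hj Hx Hy. unfold bdist.
    destruct (Nat.eq_dec i j) as [->|]; [apply value_lipschitz_x; auto|].
    assert (H1 := value_lipschitz_x s i x 0 Hi Hx ltac:(lra) Hs).
    assert (H2 := value_lipschitz_x s j 0 y Hj ltac:(lra) Hy Hs).
    rewrite value_vertex in H1, H2 by auto.
    rewrite Rminus_0_r, Rabs_pos_eq in H1 by exact Hx.
    rewrite Rminus_0_l, Rabs_Ropp, Rabs_pos_eq in H2 by exact Hy. lra. }
  assert (Hsym : bdist j y i x = bdist i x j y).
  { unfold bdist. destruct (Nat.eq_dec j i), (Nat.eq_dec i j); try congruence; [apply Rabs_minus_sym|ring]. }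
  assert (H1 := Htime t s Ht Hs). assert (H2 := Htime s t Hs Ht). rewrite (Rabs_minus_sym s t) in H2.
  assert (H3 := Hspace i x j y Hi Hj Hx Hy). assert (H4 := Hspace j y i x Hj Hi Hy Hx). rewrite Hsym in H4.
  pose proof (Rabs_pos (t - s)). apply Rabs_le. nra.
Qed.

Lemma value_le_of_vertex s t i x :
  (i < N)%nat -> 0 <= s < t -> 0 <= x -> val t i x <= A s + (t - s) * L i (x / (t - s)).
Proof.
  unpack Hd.
  intros Hi Hs Hx. apply value_le; [exact Hi|lra|exact Hx|]. right. exists s. auto.
Qed.

End Value.

(** * Supersolutions lie above the value function *)

Section Super.
Context (N : nat) (e : nat -> pt) (T : R) (L w0 : nat -> R -> R) (j0 : nat) (K0 C : R).
Hypothesis HN : (1 <= N)%nat.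
Hypothesis Hunit : forall i, (i < N)%nat -> fst (e i) ^ 2 + snd (e i) ^ 2 = 1.
Hypothesis Hdist : forall i j, (i < N)%nat -> (j < N)%nat -> i <> j -> e i <> e j.
Hypothesis Hd : admissible N L w0 j0 K0 C.

(** The cost to the target is touched from above by a polynomial, so the opposite of this
    polynomial, minus the barrier, touches [V] from below up to a constant. Its slope at the contact
    is [p], conjugate to the velocity [q]; the left side of the equation is then at most [- eps]. *)
Lemma supersol_straight V i t0 t1 x0 eps kap s y r :
  supersol T N e L V -> (i < N)%nat -> 0 < s < T -> s < t1 -> 0 < y -> 0 < eps -> 0 <= kap -> 0 < r ->
  (forall s' y', 0 < s' < T -> 0 <= y' -> Rabs (s' - s) < r -> Rabs (y' - y) < r ->
     V s (smul y (e i)) + (t1 - s) * L i ((x0 - y) / (t1 - s)) + barrier eps t0 kap s <=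
     V s' (smul y' (e i)) + (t1 - s') * L i ((x0 - y') / (t1 - s')) + barrier eps t0 kap s') ->
  False.
Proof.
  unpack Hd.
  intros HV Hi Hs Hst Hy Heps Hkap Hr Hmin.
  destruct (perspective_upper_bound (L i) (t1 - s) (x0 - y) (HL i Hi) ltac:(lra))
    as [p [M [r1 [Htan [Hr1 Hub]]]]].
  set (q := (x0 - y) / (t1 - s)) in *. set (Lq := L i q) in *.
  (* [be + q * s'] is the line through the contact point [(s, y)] and the target [(t1, x0)]. *)
  set (be := x0 - q * t1).
  assert (Ebe : be + q * s - y = 0) by (unfold be, q; field; lra).
  (* On the other branches [f] is frozen at its vertex value, so as to match there; the radius of
     the test is at most [y] and does not reach them. *)
  set (f := fun (j : nat) s' y' =>
    let z := if Nat.eq_dec j i then y' else 0 in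
    - ((t1 - s') * Lq + p * (be + q * s' - z) + M * (be + q * s' - z) ^ 2) - barrier eps t0 kap s').
  set (ft := fun (j : nat) s' y' =>
    let z := if Nat.eq_dec j i then y' else 0 in
    Lq - p * q - 2 * M * q * (be + q * s' - z) - eps - kap * (2 * Rmax 0 (s' - t0))).
  set (fx := fun (j : nat) s' y' => if Nat.eq_dec j i then p + 2 * M * (be + q * s' - y') else 0).
  destruct (supersol_test N e Hunit Hdist T L f ft fx) with (V := V) (t := s) (i := i) (x := y)
    (r := Rmin (Rmin r r1) y) as [H1 _]; auto; try lra.
  - intros j k t _ _. unfold f. destruct (Nat.eq_dec j i), (Nat.eq_dec k i); reflexivity.
  - intros j Hj. unfold f, ft, fx, barrier. destruct (Nat.eq_dec j i).
    + eapply C1_half_ext; [| |apply C1_half_shift with (c := - t1 * Lq - p * be - M * be ^ 2 + eps * t0);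
        apply (C1_half_quadratic T (Lq - p * q - 2 * M * be * q - eps) (- M * q ^ 2) (2 * M * q) (- M)
               (p + 2 * M * be) (- kap) t0)].
      * intros. split; ring.
      * intros. cbn zeta beta. ring.
    + eapply C1_half_ext; [| |apply C1_half_shift with (c := - t1 * Lq - p * be - M * be ^ 2 + eps * t0);
        apply (C1_half_quadratic T (Lq - p * q - 2 * M * be * q - eps) (- M * q ^ 2) 0 0 0 (- kap) t0)].
      * intros. split; ring.
      * intros. cbn zeta beta. ring.
  - repeat apply Rmin_glb_lt; lra.
  - intros j s' y' Hj Hs' Hy' Hd1 Hd2.
    pose proof (Rmin_l (Rmin r r1) y). pose proof (Rmin_r (Rmin r r1) y).
    pose proof (Rmin_l r r1). pose proof (Rmin_r r r1).
    destruct (Nat.eq_dec j i) as [->|Hji]; [|rewrite bdist_diff in Hd2 by congruence; lra].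
    rewrite bdist_same, Rabs_minus_sym in Hd2.
    specialize (Hmin s' y' Hs' Hy' ltac:(lra) ltac:(lra)).
    assert (Hub' := Hub (t1 - s') (x0 - y')).
    replace (t1 - s' - (t1 - s)) with (- (s' - s)) in Hub' by ring.
    replace (x0 - y' - (x0 - y)) with (- (y' - y)) in Hub' by ring.
    rewrite !Rabs_Ropp in Hub'. specialize (Hub' ltac:(lra) ltac:(lra)).
    fold q Lq in Hub'. replace (x0 - y' - q * (t1 - s')) with (be + q * s' - y') in Hub' by (unfold be; ring).
    unfold f. destruct (Nat.eq_dec i i); [|congruence]. cbn zeta. rewrite Ebe.
    fold q Lq in Hmin. lra.
  - specialize (H1 Hy). unfold ft, fx in H1. destruct (Nat.eq_dec i i); [|congruence].
    cbn zeta in H1. rewrite Ebe in H1.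
    replace (p + 2 * M * 0) with p in H1 by ring.
    assert (H2 := Hi_tangent N L HL i q p Hi Htan). fold Lq in H2.
    assert (0 <= kap * (2 * Rmax 0 (s - t0))).
    { pose proof (Rmax_l 0 (s - t0)). apply Rmult_le_pos; lra. }
    lra.
Qed.


Notation l0 := (L j0 0).
Notation A := (vertex_value N L w0 l0).
Notation val := (value N L w0 l0).

Context (V : R -> pt -> R) (CV : R).
Hypothesis HV : supersol T N e L V.
Hypothesis HV0 : forall i x, (i < N)%nat -> 0 <= x -> w0 i x <= V 0 (smul x (e i)).
Hypothesis HVb : forall i s x, (i < N)%nat -> 0 <= s < T -> 0 <= x -> w0 i x - CV <= V s (smul x (e i)).

(** * Convexified cost-to-go to the vertex *)

Section Hull.
Context (l : R) (q p : nat -> R).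
Hypothesis Hq : forall j, (j < N)%nat -> q j < 0 /\ tangent (L j) (q j) (p j) /\ l = L j (q j) - q j * p j.

(* Perspective of the convex hull of [L j] on the negative half-line and of the
   waiting cost [l] at speed zero. *)
Definition hull (j : nat) (th y : R) : R :=
  th * (L j (- Rmax (- q j) (y / th)) + p j * (Rmax (- q j) (y / th) - y / th)).

Lemma hull_linear j th y :
  (j < N)%nat -> 0 < th -> y <= - q j * th -> hull j th y = th * l - p j * y.
Proof.
  intros Hj Hth Hy. destruct (Hq j Hj) as [Hqj [_ El]]. unfold hull.
  rewrite Rmax_left.
  - rewrite Ropp_involutive. rewrite El. field. lra.
  - apply Rmult_le_reg_r with th; [exact Hth|]. replace (y / th * th) with y by (field; lra). exact Hy.
Qed.

Lemma hull_straight j th y :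
  (j < N)%nat -> 0 < th -> - q j * th <= y -> hull j th y = th * L j ((0 - y) / th).
Proof.
  intros Hj Hth Hy. unfold hull. rewrite Rmax_right.
  - replace (- (y / th)) with ((0 - y) / th) by (field; lra). ring.
  - apply Rmult_le_reg_r with th; [exact Hth|]. replace (y / th * th) with y by (field; lra). exact Hy.
Qed.

Lemma hull_le_straight j th y :
  (j < N)%nat -> 0 < th -> hull j th y <= th * L j ((0 - y) / th).
Proof.
  intros Hj Hth. destruct (Rle_dec (- q j * th) y); [right; apply hull_straight; auto|].
  rewrite hull_linear by (auto; lra). destruct (Hq j Hj) as [Hqj [Ht El]].
  specialize (Ht ((0 - y) / th)). apply Rmult_le_compat_l with (r := th) in Ht; [|lra].
  eapply Rle_trans; [|exact Ht]. right. rewrite El. field. lra.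
Qed.

(** A single formula with [Rmax] covers both regimes, so nothing has to be glued along
    [y = - q j * th]. *)
Lemma hull_cont j a b c d t1 : (j < N)%nat -> b < t1 ->
  cont2_on (fun s y => a <= s <= b /\ c <= y <= d) (fun s y => hull j (t1 - s) y).
Proof.
  unpack Hd.
  intros Hj Hb. set (D := fun s y => a <= s <= b /\ c <= y <= d).
  assert (Hth : cont2_on D (fun s _ => t1 - s)) by (apply cont2_minus; [apply cont2_const|apply cont2_fst]).
  assert (Hr : cont2_on D (fun s y => y / (t1 - s))).
  { apply cont2_div; [apply cont2_snd|exact Hth|]. intros s y [Hs _]. lra. }
  assert (Hm : cont2_on D (fun s y => Rmax (- q j) (y / (t1 - s)))).
  { apply (cont2_comp D (fun x => Rmax (- q j) x)); [exact Hr|]. intros; apply continuity_Rmax. }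
  unfold hull. apply cont2_mult; [exact Hth|]. apply cont2_plus.
  - apply (cont2_comp D (fun x => L j (- x))); [exact Hm|]. intros s y _.
    apply (continuity_pt_comp Ropp (L j)).
    + apply (continuity_pt_opp id). apply derivable_continuous_pt, derivable_pt_id.
    + destruct (HL j Hj) as [Hc _]. apply Hc.
  - apply cont2_mult; [apply cont2_const|]. apply cont2_minus; assumption.
Qed.

(** In the linear regime the hull is the cost of travelling at velocity [q j] for the time
    [tau = y / - q j] and then waiting at cost [l]. This is a genuine trajectory, up to the discount
    [eps] on the waiting. *)
Lemma hull_vertex_value j t y eps :
  (j < N)%nat -> 0 < t -> 0 <= y -> 0 <= eps -> l = l0 - eps -> A t - eps * t <= w0 j y + hull j t y.
Proof.
  unpack Hd. intros Hj Ht Hy Heps El. destruct (Hq j Hj) as [Hqj [_ El']].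
  destruct (Rle_dec (- q j * t) y) as [Hc|Hc].
  - rewrite hull_straight by auto. rewrite Rminus_0_l.
    assert (H := vertex_value_arrive Hd j y t Hj Hy Ht). nra.
  - rewrite hull_linear by (auto; lra). set (tau := y / - q j).
    assert (Etau : tau * (- q j) = y) by (unfold tau; field; lra).
    assert (Htau : 0 <= tau) by (unfold tau; apply Rle_mult_inv_pos; lra).
    assert (Htaut : tau < t) by nra.
    destruct (Req_dec tau 0) as [Ht0|Ht0].
    + assert (Ey : y = 0) by (rewrite Ht0 in Etau; lra). rewrite Ey.
      assert (H := vertex_value_wait Hd 0 t ltac:(lra) ltac:(lra)).
      rewrite vertex_value_0, (Hw00 0%nat j) in H by (auto; lia). rewrite El. lra.
    + assert (H : A t <= w0 j y + tau * L j (- y / tau) + (t - tau) * l0).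
      { apply (vertex_value_glb Hd t Ht).
        exists j, y, tau. repeat split; auto; lra. }
      replace (- y / tau) with (q j) in H by (rewrite <- Etau; field; lra).
      assert (E : tau * L j (q j) = tau * l - p j * y) by (rewrite El', <- Etau; ring).
      assert (0 <= eps * tau) by (apply Rmult_le_pos; lra).
      rewrite E in H. rewrite El in *. lra.
Qed.

(** In the linear regime the opposite of the hull, minus the barrier, is itself a test function near
    the contact point, even when this point is the vertex. The other regime reduces to the straight
    cost. *)
Lemma supersol_hull t0 t1 eps kap s j y r :
  (j < N)%nat -> 0 < s < T -> s < t1 -> 0 <= y -> 0 < eps -> 0 <= kap -> 0 < r ->
  (forall k s' y', (k < N)%nat -> 0 < s' < T -> 0 <= y' -> Rabs (s' - s) < r -> bdist j y k y' < r ->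
     V s (smul y (e j)) + hull j (t1 - s) y + barrier eps t0 kap s <=
     V s' (smul y' (e k)) + hull k (t1 - s') y' + barrier eps t0 kap s') ->
  False.
Proof.
  unpack Hd.
  intros Hj Hs Hst Hy Heps Hkap Hr Hmin.
  assert (Hkp : 0 <= kap * (2 * Rmax 0 (s - t0))).
  { pose proof (Rmax_l 0 (s - t0)). apply Rmult_le_pos; lra. }
  destruct (Rlt_dec y (- q j * (t1 - s))) as [Hc|Hc].
  (* The linear regime is open: around [y > 0] on the same branch, and around the vertex on all
     branches at once because every [q k] is strictly negative. *)
  - assert (Hlin : exists d, 0 < d /\ d <= t1 - s /\
      forall k s' y', (k < N)%nat -> 0 <= y' -> Rabs (s' - s) < d -> bdist j y k y' < d ->
        y' <= - q k * (t1 - s')).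
    { destruct (Rlt_dec 0 y) as [Hy0|Hy0].
      - destruct (Hq j Hj) as [Hqj _].
        (* Changing time and position by less than [d1] uses up at most [d1 * (1 - q j)], which is
           exactly the margin. *)
        set (d1 := (- q j * (t1 - s) - y) / (1 - q j)).
        assert (Hd1 : 0 < d1) by (unfold d1; apply Rdiv_lt_0_compat; lra).
        exists (Rmin (Rmin d1 (t1 - s)) y).
        pose proof (Rmin_l (Rmin d1 (t1 - s)) y). pose proof (Rmin_r (Rmin d1 (t1 - s)) y).
        pose proof (Rmin_l d1 (t1 - s)). pose proof (Rmin_r d1 (t1 - s)).
        split; [repeat apply Rmin_glb_lt; lra|]. split; [lra|].
        intros k s' y' Hk Hy' Hs' Hb. destruct (Nat.eq_dec k j) as [->|Hkj];
          [|rewrite bdist_diff in Hb by congruence; lra].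
        rewrite bdist_same in Hb. apply Rabs_def2 in Hb. apply Rabs_def2 in Hs'.
        assert (E : d1 * (1 - q j) = - q j * (t1 - s) - y) by (unfold d1; field; lra).
        assert (q j * d1 < q j * (s' - s)).
        { apply Ropp_lt_cancel. rewrite !Ropp_mult_distr_l. apply Rmult_lt_compat_l; lra. }
        lra.
      - assert (Ey : y = 0) by lra.
        destruct (finite_lower_bound (fun k d => d <= - q k * ((t1 - s) / 2)) N) as [d [Hdp Hdq]].
        + intros k Hk. destruct (Hq k Hk) as [Hqk _]. exists (- q k * ((t1 - s) / 2)).
          split; [apply Rmult_lt_0_compat; lra|]. intros; lra.
        + exists (Rmin d ((t1 - s) / 2)).
          pose proof (Rmin_l d ((t1 - s) / 2)). pose proof (Rmin_r d ((t1 - s) / 2)).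
          split; [apply Rmin_glb_lt; lra|]. split; [lra|].
          intros k s' y' Hk Hy' Hs' Hb. apply bdist_le in Hb; [|lra]. apply Rabs_def2 in Hs'.
          destruct (Hq k Hk) as [Hqk _]. specialize (Hdq k Hk).
          assert (- q k * ((t1 - s) / 2) <= - q k * (t1 - s')) by (apply Rmult_le_compat_l; lra). lra. }
    destruct Hlin as [d [Hdp [Hdt Hlin]]].
    set (f := fun k s' y' => - ((t1 - s') * l - p k * y') - barrier eps t0 kap s').
    destruct (supersol_test N e Hunit Hdist T L f
      (fun _ s' _ => l - eps - kap * (2 * Rmax 0 (s' - t0))) (fun k _ _ => p k))
      with (V := V) (t := s) (i := j) (x := y) (r := Rmin r d) as [H1 H2]; auto.
    + intros. unfold f. ring.
    + intros k Hk. unfold f, barrier.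
      eapply C1_half_ext; [| |apply C1_half_shift with (c := - t1 * l + eps * t0);
        apply (C1_half_quadratic T (l - eps) 0 0 0 (p k) (- kap) t0)].
      * intros. split; ring.
      * intros. cbn beta. ring.
    + apply Rmin_glb_lt; lra.
    + intros k s' y' Hk Hs' Hy' Hb1 Hb2. pose proof (Rmin_l r d). pose proof (Rmin_r r d).
      specialize (Hmin k s' y' Hk Hs' Hy' ltac:(lra) ltac:(lra)).
      specialize (Hlin k s' y' Hk Hy' ltac:(lra) ltac:(lra)).
      apply Rabs_def2 in Hb1.
      rewrite hull_linear in Hmin by (auto; lra). rewrite hull_linear in Hmin by (auto; lra).
      unfold f. lra.
    + destruct (Req_dec y 0) as [Hy0|Hy0].
      * specialize (H2 Hy0).
        (* All tangents have the same intercept [l], so each [Hminus] is at most [- l]; the time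
           derivative is at most [l - eps]. *)
        assert (HH : H0 N L (fun k => p k) <= - l).
        { apply H0_le; [exact HN|]. intros k Hk. destruct (Hq k Hk) as [_ [Ht El]].
          assert (H := Hminus_tangent N L HL k (q k) (p k) Hk Ht). lra. }
        lra.
      * specialize (H1 ltac:(lra)). destruct (Hq j Hj) as [_ [Ht El]].
        assert (H := Hi_tangent N L HL j (q j) (p j) Hj Ht). lra.
  (* The hull lies below the straight cost and equals it at the contact point, so the minimum is
     inherited by the straight cost. *)
  - destruct (Hq j Hj) as [Hqj _].
    assert (Hyp : 0 < y).
    { assert (0 < - q j * (t1 - s)) by (apply Rmult_lt_0_compat; lra). lra. }
    apply (supersol_straight V j t0 t1 0 eps kap s y (Rmin r (t1 - s))); auto.
    + apply Rmin_glb_lt; lra.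
    + intros s' y' Hs' Hy' Hb1 Hb2. pose proof (Rmin_l r (t1 - s)). pose proof (Rmin_r r (t1 - s)).
      rewrite Rabs_minus_sym, <- (bdist_same j) in Hb2.
      specialize (Hmin j s' y' Hj Hs' Hy' ltac:(lra) ltac:(lra)).
      apply Rabs_def2 in Hb1.
      rewrite hull_straight in Hmin by (auto; lra).
      assert (H' := hull_le_straight j (t1 - s') y' Hj ltac:(lra)). lra.
Qed.

End Hull.

Lemma vertex_value_le_supersol_approx t0 dl eps :
  0 < t0 -> 0 < dl -> t0 + dl < T -> 0 < eps ->
  A (t0 + dl) - eps * (t0 + dl) - eps * t0 <= V t0 (0, 0) + dl * (l0 - eps).
Proof.
  unpack Hd. intros Ht0 Hdl HtT Heps. set (t1 := t0 + dl). set (l := l0 - eps).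
  destruct (functional_choice (fun (j : nat) (qp : R * R) => (j < N)%nat ->
    fst qp < 0 /\ tangent (L j) (fst qp) (snd qp) /\ l = L j (fst qp) - fst qp * snd qp)) as [qp Hqp].
  { intros j. destruct (Nat.lt_ge_cases j N) as [Hj|Hj]; [|exists (0, 0); lia].
    destruct (HL j Hj) as [_ [_ [_ Hl]]]. destruct (Hl l) as [q [p H]].
    - specialize (Hl0 j Hj). unfold l; lra.
    - exists (q, p). auto. }
  set (q := fun j => fst (qp j)). set (p := fun j => snd (qp j)).
  assert (Hq : forall j, (j < N)%nat -> q j < 0 /\ tangent (L j) (q j) (p j) /\ l = L j (q j) - q j * p j)
    by (intros j Hj; apply Hqp; exact Hj).
  destruct (uniform_growth N L HL (K0 + 1)) as [c [Hc Hgr]].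
  destruct (finite_bound (fun j => - q j * t1) N) as [B HB].
  (* At [Y >= B] the hull is the straight cost, which grows with slope [K0 + 1] while [V] may
     decrease with slope [K0] only; the last term makes the net gain exceed the value at the
     comparison point [(t0, 0)]. *)
  set (Y := Rmax 1 (Rmax B (V t0 (0, 0) + dl * l - w0 0%nat 0 + CV + c * t1 + eps * t0 + 1))).
  assert (HY1 : 1 <= Y) by apply Rmax_l.
  assert (HYB : B <= Y) by (eapply Rle_trans; [apply Rmax_l|apply Rmax_r]).
  assert (HY2 : V t0 (0, 0) + dl * l - w0 0%nat 0 + CV + c * t1 + eps * t0 + 1 <= Y)
    by (eapply Rle_trans; [apply Rmax_r|apply Rmax_r]).
  (* Stopping halfway to the target keeps the remaining duration [t1 - s] at least [dl / 2]. *)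
  set (b := t0 + dl / 2).
  destruct (barrier_min N 0 b Y t0 eps
    (fun j s y => V s (smul y (e j)) + hull q p j (t1 - s) y) 0%nat 0)
    as [kap [j [s [y [Hkap [Hj [Hs [Hy Hmin]]]]]]]]; try lra; try lia; [unfold b; lra| |].
  { intros j Hj. apply lsc_box_plus; [apply (lsc_coord N e Hunit Hdist T); auto; [exact (proj1 HV)|lra|unfold b; lra]|].
    apply cont2_lsc, hull_cont; [exact Hj|unfold b, t1; lra]. }
  assert (Hval := Hmin 0%nat t0 0 ltac:(lia) ltac:(unfold b; lra) ltac:(lra)).
  rewrite barrier_at, smul0 in Hval.
  assert (E0 : hull q p 0 (t1 - t0) 0 = dl * l).
  { rewrite (hull_linear l q p Hq); [unfold t1; ring|lia|unfold t1; lra|].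
    destruct (Hq 0%nat) as [Hq0 _]; [lia|]. assert (0 < - q 0%nat * (t1 - t0)); [|lra].
    apply Rmult_lt_0_compat; unfold t1; lra. }
  rewrite E0 in Hval.
  assert (Hbar := barrier_ge eps t0 kap s Hkap).
  assert (Hbar' : - (eps * t0) <= barrier eps t0 kap s).
  { assert (0 <= eps * s) by (apply Rmult_le_pos; lra). lra. }
  destruct (Req_dec s 0) as [Hs0|Hs0].
  (* The minimum can only be at time 0, where the initial datum plus the hull bounds the value at
     the target. *)
  - rewrite Hs0 in Hval, Hbar'. rewrite Rminus_0_r in Hval.
    assert (H1 := HV0 j y Hj ltac:(lra)).
    assert (H2 := hull_vertex_value l q p Hq j t1 y eps Hj ltac:(unfold t1; lra) ltac:(lra) ltac:(lra) eq_refl).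
    fold t1 l. lra.
  - exfalso. destruct (Req_dec y Y) as [HyY|HyY].
    + assert (H1 := HVb j s y Hj ltac:(unfold b in Hs; lra) ltac:(lra)).
      assert (H2 := Hw0 j y 0 Hj ltac:(lra) ltac:(lra)).
      rewrite Rminus_0_r, (Rabs_pos_eq y) in H2 by lra. rewrite (Hw00 j 0%nat) in H2 by (auto; lia).
      assert (H3 := Rle_abs (- (w0 j y - w0 0%nat 0))). rewrite Rabs_Ropp in H3.
      rewrite (hull_straight q p) in Hval; [|exact Hj|unfold b in Hs; unfold t1; lra|].
      2: { specialize (HB j Hj). cbv beta in HB. destruct (Hq j Hj) as [Hqj _].
           assert (- q j * (t1 - s) <= - q j * t1) by (apply Rmult_le_compat_l; lra). lra. }
      assert (H4 := perspective_growth (L j) (K0 + 1) c (t1 - s) (0 - y)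
        (fun q => Hgr j q Hj) ltac:(unfold b in Hs; unfold t1; lra)).
      rewrite Rminus_0_l, Rabs_Ropp, (Rabs_pos_eq y) in H4 by lra. rewrite Rminus_0_l in Hval.
      assert (c * (t1 - s) <= c * t1) by (apply Rmult_le_compat_l; lra).
      lra.
    + set (rr := Rmin (Rmin s (b - s)) (Y - y)).
      assert (Hrr : 0 < rr) by (unfold rr; repeat apply Rmin_glb_lt; lra).
      assert (Hrrb : rr <= s /\ rr <= b - s /\ rr <= Y - y).
      { unfold rr. pose proof (Rmin_l (Rmin s (b - s)) (Y - y)).
        pose proof (Rmin_r (Rmin s (b - s)) (Y - y)).
        pose proof (Rmin_l s (b - s)). pose proof (Rmin_r s (b - s)). lra. }
      apply (supersol_hull l q p Hq t0 t1 eps kap s j y rr); auto; try lra.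
      * unfold b in Hs; lra.
      * unfold b in Hs; unfold t1; lra.
      * intros k s' y' Hk Hs' Hy' Hb1 Hb2. apply bdist_le in Hb2; [|lra]. apply Rabs_def2 in Hb1.
        apply Hmin; [exact Hk|lra|lra].
Qed.

Lemma vertex_value_le_supersol t0 : 0 <= t0 < T -> A t0 <= V t0 (0, 0).
Proof.
  unpack Hd. intros Ht0. destruct (Req_dec t0 0) as [->|Ht00].
  { rewrite vertex_value_0, <- (smul0 (e 0%nat)). apply HV0; [lia|lra]. }
  apply Rnot_lt_le. intro Hlt. set (gap := A t0 - V t0 (0, 0)).
  assert (Hgap : 0 < gap) by (unfold gap; lra).
  (* Four errors of at most [gap / 8]: the cut over the delay [dl], the waiting until the target,
     and the two terms in [eps]. Their sum is less than [gap]. *)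
  set (dl := Rmin ((T - t0) / 2) (gap / (8 * C))).
  assert (Hg8 : 0 < gap / (8 * C)) by (apply Rdiv_lt_0_compat; lra).
  assert (Hdl : 0 < dl) by (unfold dl; apply Rmin_glb_lt; lra).
  assert (Hdl1 : dl <= (T - t0) / 2) by apply Rmin_l.
  assert (Hdl2 : dl <= gap / (8 * C)) by apply Rmin_r.
  assert (HCd : C * dl <= gap / 8).
  { apply Rmult_le_compat_l with (r := C) in Hdl2; [|lra].
    replace (C * (gap / (8 * C))) with (gap / 8) in Hdl2 by (field; lra). exact Hdl2. }
  set (eps := gap / (8 * T)).
  assert (Heps : 0 < eps) by (unfold eps; apply Rdiv_lt_0_compat; lra).
  assert (HeT : eps * T = gap / 8) by (unfold eps; field; lra).
  assert (H := vertex_value_le_supersol_approx t0 dl eps ltac:(lra) Hdl ltac:(lra) Heps).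
  assert (H1 := vertex_value_cut Hd t0 (t0 + dl) ltac:(lra) ltac:(lra)).
  replace (t0 + dl - t0) with dl in H1 by ring.
  assert (H2 := wait_cost_bound Hd).
  assert (dl * (l0 - eps) <= dl * C) by (apply Rmult_le_compat_l; lra).
  assert (eps * (t0 + dl) <= eps * T) by (apply Rmult_le_compat_l; lra).
  assert (eps * t0 <= eps * T) by (apply Rmult_le_compat_l; lra).
  unfold gap in *. lra.
Qed.

Lemma value_le_supersol_approx i x0 t0 dl eps :
  (i < N)%nat -> 0 < x0 -> 0 < t0 -> 0 < dl -> t0 + dl < T -> 0 < eps ->
  val (t0 + dl) i x0 - eps * t0 <= V t0 (smul x0 (e i)) + dl * L i 0.
Proof.
  unpack Hd. intros Hi Hx0 Ht0 Hdl HtT Heps. set (t1 := t0 + dl).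
  destruct (uniform_growth N L HL (K0 + 1)) as [c [Hc Hgr]].
  set (v0 := V t0 (smul x0 (e i)) + dl * L i 0).
  set (Y := Rmax (x0 + 1) (x0 + v0 - w0 i x0 + CV + c * t1 + eps * t0 + 1)).
  assert (HY1 : x0 + 1 <= Y) by apply Rmax_l.
  assert (HY2 : x0 + v0 - w0 i x0 + CV + c * t1 + eps * t0 + 1 <= Y) by apply Rmax_r.
  set (b := t0 + dl / 2).
  assert (Hb1 : b < t1) by (unfold b, t1; lra).
  (* Only branch [i] is minimised over, hence a family of size one. *)
  destruct (barrier_min 1 0 b Y t0 eps
    (fun _ s y => V s (smul y (e i)) + (t1 - s) * L i ((x0 - y) / (t1 - s))) 0%nat x0)
    as [kap [k [s [y [Hkap [_ [Hs [Hy Hmin]]]]]]]]; try lra; try lia; [unfold b; lra| |].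
  { intros _ _. apply lsc_box_plus; [apply (lsc_coord N e Hunit Hdist T); auto; [exact (proj1 HV)|lra|unfold b; lra]|].
    apply cont2_lsc. set (D := fun s y => 0 <= s <= b /\ 0 <= y <= Y).
    assert (Hth : cont2_on D (fun s _ => t1 - s)) by (apply cont2_minus; [apply cont2_const|apply cont2_fst]).
    apply cont2_mult; [exact Hth|]. apply (cont2_comp D (L i)).
    - apply cont2_div; [apply cont2_minus; [apply cont2_const|apply cont2_snd]|exact Hth|].
      intros s y [Hs _]. lra.
    - intros. destruct (HL i Hi) as [Hcont _]. apply Hcont. }
  assert (Hval := Hmin 0%nat t0 x0 ltac:(lia) ltac:(unfold b; lra) ltac:(lra)).
  rewrite barrier_at in Hval.
  replace ((x0 - x0) / (t1 - t0)) with 0 in Hval by (unfold t1; field; lra).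
  replace (t1 - t0) with dl in Hval by (unfold t1; ring).
  fold v0 in Hval |- *.
  assert (Hbar := barrier_ge eps t0 kap s Hkap).
  assert (Hbar' : - (eps * t0) <= barrier eps t0 kap s).
  { assert (0 <= eps * s) by (apply Rmult_le_pos; lra). lra. }
  destruct (Req_dec s 0) as [Hs0|Hs0]; [|destruct (Req_dec y 0) as [Hy0|Hy0]].
  - rewrite Hs0 in Hval, Hbar'. rewrite Rminus_0_r in Hval.
    assert (H1 := HV0 i y Hi ltac:(lra)).
    assert (H2 : val t1 i x0 <= w0 i y + t1 * L i ((x0 - y) / t1)).
    { apply (value_le Hd); auto; [unfold t1; lra|lra|]. left. exists y. split; [lra|reflexivity]. }
    lra.
  (* A minimum at the vertex is harmless: [V] already dominates the value there, and the remaining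
     piece to the target completes a trajectory. *)
  - rewrite Hy0, smul0, Rminus_0_r in Hval.
    assert (H1 := vertex_value_le_supersol s ltac:(unfold b in Hs; lra)).
    assert (H2 := value_le_of_vertex Hd s t1 i x0 Hi ltac:(lra) ltac:(lra)). lra.
  - exfalso. destruct (Req_dec y Y) as [HyY|HyY].
    + assert (H1 := HVb i s y Hi ltac:(unfold b in Hs; lra) ltac:(lra)).
      assert (H2 := Hw0 i y x0 Hi ltac:(lra) ltac:(lra)).
      rewrite (Rabs_pos_eq (y - x0)) in H2 by lra.
      assert (H3 := Rle_abs (- (w0 i y - w0 i x0))). rewrite Rabs_Ropp in H3.
      assert (H4 := perspective_growth (L i) (K0 + 1) c (t1 - s) (x0 - y)
        (fun q => Hgr i q Hi) ltac:(lra)).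
      rewrite Rabs_minus_sym, (Rabs_pos_eq (y - x0)) in H4 by lra.
      assert (c * (t1 - s) <= c * t1) by (apply Rmult_le_compat_l; lra).
      lra.
    + set (rr := Rmin (Rmin s (b - s)) (Y - y)).
      assert (Hrr : 0 < rr) by (unfold rr; repeat apply Rmin_glb_lt; lra).
      assert (Hrrb : rr <= s /\ rr <= b - s /\ rr <= Y - y).
      { unfold rr. pose proof (Rmin_l (Rmin s (b - s)) (Y - y)).
        pose proof (Rmin_r (Rmin s (b - s)) (Y - y)).
        pose proof (Rmin_l s (b - s)). pose proof (Rmin_r s (b - s)). lra. }
      apply (supersol_straight V i t0 t1 x0 eps kap s y rr); auto; try lra.
      * unfold b in Hs; lra.
      * intros s' y' Hs' Hy' Hb2 Hb3. apply Rabs_def2 in Hb2. apply Rabs_def2 in Hb3.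
        apply (Hmin 0%nat); [lia|lra|lra].
Qed.

Lemma value_le_supersol i x t : (i < N)%nat -> 0 <= x -> 0 <= t < T -> val t i x <= V t (smul x (e i)).
Proof.
  unpack Hd. intros Hi Hx Ht.
  destruct (Req_dec t 0) as [->|Ht0]; [rewrite value_0; apply HV0; assumption|].
  destruct (Req_dec x 0) as [->|Hx0].
  { rewrite smul0, (value_vertex Hd) by (auto; lra). apply vertex_value_le_supersol; exact Ht. }
  apply Rnot_lt_le. intro Hlt. set (gap := val t i x - V t (smul x (e i))).
  assert (Hgap : 0 < gap) by (unfold gap; lra).
  set (dl := Rmin ((T - t) / 2) (gap / (8 * C))).
  assert (Hg8 : 0 < gap / (8 * C)) by (apply Rdiv_lt_0_compat; lra).
  assert (Hdl : 0 < dl) by (unfold dl; apply Rmin_glb_lt; lra).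
  assert (Hdl1 : dl <= (T - t) / 2) by apply Rmin_l.
  assert (Hdl2 : dl <= gap / (8 * C)) by apply Rmin_r.
  assert (HCd : C * dl <= gap / 8).
  { apply Rmult_le_compat_l with (r := C) in Hdl2; [|lra].
    replace (C * (gap / (8 * C))) with (gap / 8) in Hdl2 by (field; lra). exact Hdl2. }
  set (eps := gap / (8 * t)).
  assert (Heps : 0 < eps) by (unfold eps; apply Rdiv_lt_0_compat; lra).
  assert (HeT : eps * t = gap / 8) by (unfold eps; field; lra).
  assert (H := value_le_supersol_approx i x t dl eps Hi ltac:(lra) ltac:(lra) Hdl ltac:(lra) Heps).
  assert (H1 := value_cut Hd t (t + dl) i x Hi Hx ltac:(lra) ltac:(lra)).
  replace (t + dl - t) with dl in H1 by ring.
  assert (H2 := HCu i 0 Hi). rewrite Rabs_R0 in H2. specialize (H2 ltac:(lra)).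
  assert (dl * L i 0 <= dl * C) by (apply Rmult_le_compat_l; lra).
  unfold gap in *. lra.
Qed.

End Super.

(** * The value function is a viscosity solution *)

Lemma mean_value_open (f f' : R -> R) (a b : R) :
  a < b -> (forall x, a < x < b -> derivable_pt_lim f x (f' x)) ->
  (forall x, a <= x <= b -> continuity_pt f x) ->
  exists c, a < c < b /\ f b - f a = f' c * (b - a).
Proof.
  intros Hab Hd Hc.
  set (pr1 := fun c (Hcc : a < c < b) => exist _ (f' c) (Hd c Hcc) : derivable_pt f c).
  destruct (MVT f id a b pr1 (fun c _ => derivable_pt_id c) Hab Hc) as [c [P E]].
  - intros c _. apply derivable_continuous_pt, derivable_pt_id.
  - exists c. split; [exact P|]. rewrite derive_pt_id in E. unfold id in E. cbn in E. lra.
Qed.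

(** The time increment is taken at fixed [x], the space increment at the new time [t'] by the mean
    value theorem; joint continuity of [gx] brings its slope back to [(t, x)]. *)
Lemma C1_half_differentiable T g gt gx t x :
  C1_half T g gt gx -> HalfStrip T t x -> forall eps, 0 < eps -> exists d, d > 0 /\
    forall t' x', 0 < t' < T -> 0 <= x' -> Rabs (t' - t) < d -> Rabs (x' - x) < d ->
      Rabs (g t' x' - g t x - gt t x * (t' - t) - gx t x * (x' - x)) <= eps * (Rabs (t' - t) + Rabs (x' - x)).
Proof.
  intros [Hg [_ [Hgx Hder]]] Htx eps Heps.
  destruct (Hder t x Htx) as [Hdt _]. destruct (Hdt eps Heps) as [d1 Hd1].
  destruct (Hgx t x Htx eps Heps) as [d2 [Hd2 Hcx]]. pose proof (cond_pos d1) as Hd1p.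
  exists (Rmin d1 d2). split; [apply Rmin_glb_lt; lra|].
  intros t' x' Ht' Hx' H1 H2. pose proof (Rmin_l d1 d2). pose proof (Rmin_r d1 d2).
  destruct Htx as [Ht Hx].
  assert (Ha : Rabs (g t' x - g t x - gt t x * (t' - t)) <= eps * Rabs (t' - t)).
  { destruct (Req_dec t' t) as [->|Hne].
    - rewrite !Rminus_diag, Rmult_0_r, Rminus_0_r, Rabs_R0. lra.
    - specialize (Hd1 (t' - t) ltac:(lra) ltac:(lra)). replace (t + (t' - t)) with t' in Hd1 by ring.
      replace (g t' x - g t x - gt t x * (t' - t))
        with (((g t' x - g t x) / (t' - t) - gt t x) * (t' - t)) by (field; lra).
      rewrite Rabs_mult. apply Rmult_le_compat_r; [apply Rabs_pos|lra]. }
  assert (Hmv : forall a b, 0 <= a -> a < b -> exists c, a < c < b /\ g t' b - g t' a = gx t' c * (b - a)).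
  { intros a b Ha0 Hab.
    (* The mean value theorem asks for two-sided continuity at the end points, and [a] may be 0;
       [Rmax 0 s] extends the function by a constant. *)
    destruct (mean_value_open (fun s => g t' (Rmax 0 s)) (gx t') a b Hab) as [c [Hc E]].
    - intros s Hs. assert (Hs0 : 0 <= s) by lra. destruct (Hder t' s (conj Ht' Hs0)) as [_ Hdx].
      intros ep Hep. destruct (Hdx ep Hep) as [d [Hdp Hd']].
      assert (Hmp : 0 < Rmin d s) by (apply Rmin_glb_lt; lra).
      exists (mkposreal _ Hmp). cbn. intros h Hh Hhd.
      pose proof (Rmin_l d s). pose proof (Rmin_r d s).
      assert (- s < h) by (apply Rabs_def2 in Hhd; lra).
      rewrite !Rmax_right by lra. apply Hd'; [exact Hh|lra|lra].
    - intros s Hs ep Hep. assert (Hs0 : 0 <= s) by lra. destruct (Hg t' s (conj Ht' Hs0) ep Hep) as [d [Hdp Hd']].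
      exists d. split; [exact Hdp|]. intros z [_ Hz]. cbn in *. unfold Rdist in *.
      rewrite (Rmax_right 0 s) by lra.
      apply Hd'; [split; [exact Ht'|apply Rmax_l]|rewrite Rminus_diag, Rabs_R0; lra|].
      eapply Rle_lt_trans; [|exact Hz]. unfold Rmax. destruct (Rle_dec 0 z); [lra|].
      rewrite Rabs_minus_sym, (Rabs_minus_sym z), !Rabs_pos_eq; lra.
    - exists c. split; [exact Hc|]. rewrite !Rmax_right in E by lra. exact E. }
  assert (Hb : Rabs (g t' x' - g t' x - gx t x * (x' - x)) <= eps * Rabs (x' - x)).
  { assert (Hc : exists c, 0 <= c /\ Rabs (c - x) <= Rabs (x' - x) /\ g t' x' - g t' x = gx t' c * (x' - x)).
    { destruct (Rtotal_order x x') as [Hl|[->|Hl]].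
      - destruct (Hmv x x' Hx Hl) as [c [Hc E]]. exists c. split; [lra|]. split; [|exact E].
        rewrite !Rabs_pos_eq; lra.
      - exists x'. split; [exact Hx'|]. rewrite !Rminus_diag. split; [lra|ring].
      - destruct (Hmv x' x Hx' Hl) as [c [Hc E]]. exists c. split; [lra|]. split; [|lra].
        rewrite Rabs_minus_sym, (Rabs_minus_sym x'), !Rabs_pos_eq; lra. }
    destruct Hc as [c [Hc0 [Hcx' ->]]].
    replace (gx t' c * (x' - x) - gx t x * (x' - x)) with ((gx t' c - gx t x) * (x' - x)) by ring.
    rewrite Rabs_mult. apply Rmult_le_compat_r; [apply Rabs_pos|].
    specialize (Hcx t' c (conj Ht' Hc0) ltac:(lra) ltac:(lra)). lra. }
  replace (g t' x' - g t x - gt t x * (t' - t) - gx t x * (x' - x))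
    with ((g t' x - g t x - gt t x * (t' - t)) + (g t' x' - g t' x - gx t x * (x' - x))) by ring.
  eapply Rle_trans; [apply Rabs_triang|]. lra.
Qed.

(** Infinitesimal form of dynamic programming: expand to first order, divide by [h] and let [h] tend
    to 0. *)
Lemma C1_half_transport_le T g gt gx t x q l h0 :
  C1_half T g gt gx -> HalfStrip T t x -> 0 < h0 ->
  (forall h, 0 < h < h0 -> h < t /\ 0 <= x - q * h /\ g t x <= g (t - h) (x - q * h) + h * l) ->
  gt t x + q * gx t x <= l.
Proof.
  intros HC Htx Hh0 Hineq. apply Rnot_lt_le. intro Hlt.
  set (c := gt t x + q * gx t x - l). assert (Hc : 0 < c) by (unfold c; lra).
  assert (Hq := Rabs_pos q). set (eps := c / (2 * (1 + Rabs q))).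
  assert (Heps : 0 < eps) by (unfold eps; apply Rdiv_lt_0_compat; lra).
  assert (Hepsq : eps * (1 + Rabs q) = c / 2) by (unfold eps; field; lra).
  destruct (C1_half_differentiable T g gt gx t x HC Htx eps Heps) as [d [Hd Hdiff]].
  set (h := Rmin (h0 / 2) (d / (2 * (1 + Rabs q)))).
  assert (Hd2 : 0 < d / (2 * (1 + Rabs q))) by (apply Rdiv_lt_0_compat; lra).
  assert (Hh : 0 < h) by (unfold h; apply Rmin_glb_lt; lra).
  assert (Hh1 : h <= h0 / 2) by apply Rmin_l.
  assert (Hh2 : h * (1 + Rabs q) <= d / 2).
  { assert (Hh3 : h <= d / (2 * (1 + Rabs q))) by apply Rmin_r.
    apply Rmult_le_compat_r with (r := 1 + Rabs q) in Hh3; [|lra].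
    replace (d / (2 * (1 + Rabs q)) * (1 + Rabs q)) with (d / 2) in Hh3 by (field; lra). exact Hh3. }
  destruct (Hineq h ltac:(lra)) as [Hht [Hxq Hg]]. destruct Htx as [Ht Hx].
  assert (Eh : Rabs (t - h - t) = h).
  { replace (t - h - t) with (- h) by ring. rewrite Rabs_Ropp. apply Rabs_pos_eq; lra. }
  assert (Ek : Rabs (x - q * h - x) = Rabs q * h).
  { replace (x - q * h - x) with (- (q * h)) by ring. rewrite Rabs_Ropp, Rabs_mult, (Rabs_pos_eq h); lra. }
  assert (0 <= Rabs q * h) by (apply Rmult_le_pos; lra).
  assert (HD := Hdiff (t - h) (x - q * h) ltac:(lra) Hxq ltac:(lra) ltac:(lra)).
  rewrite Eh, Ek in HD.
  replace (eps * (h + Rabs q * h)) with (h * (eps * (1 + Rabs q))) in HD by ring. rewrite Hepsq in HD.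
  pose proof (Rle_abs (g (t - h) (x - q * h) - g t x - gt t x * (t - h - t) - gx t x * (x - q * h - x))).
  assert (h * c = h * (gt t x + q * gx t x - l)) by reflexivity.
  assert (0 < h * c) by (apply Rmult_lt_0_compat; lra). lra.
Qed.

(* The point reached by going back a time [h] may lie on a branch [j] that depends on [h]. *)
Lemma C1_half_transport_ge T n (g gt gx : nat -> R -> R -> R) t x v a Q Hval :
  (forall j, (j < n)%nat -> C1_half T (g j) (gt j) (gx j) /\ g j t x = v /\ gt j t x = a) ->
  HalfStrip T t x -> 0 <= Q ->
  (forall h0, 0 < h0 -> exists h, 0 < h < h0 /\ h < t /\ exists j k l, (j < n)%nat /\
     Rabs k <= Q * h /\ 0 <= x - k /\
     g j (t - h) (x - k) + h * l <= v + h ^ 2 /\ gx j t x * k - h * l <= h * Hval) ->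
  0 <= a + Hval.
Proof.
  intros HC Htx HQ Hineq. apply Rnot_lt_le. intro Hlt.
  set (c := - (a + Hval)). assert (Hc : 0 < c) by (unfold c; lra).
  set (eps := c / (4 * (1 + Q))).
  assert (Heps : 0 < eps) by (unfold eps; apply Rdiv_lt_0_compat; lra).
  assert (Hepsq : eps * (1 + Q) = c / 4) by (unfold eps; field; lra).
  destruct (finite_lower_bound (fun j d => forall t' x', 0 < t' < T -> 0 <= x' ->
      Rabs (t' - t) < d -> Rabs (x' - x) < d ->
      Rabs (g j t' x' - g j t x - gt j t x * (t' - t) - gx j t x * (x' - x))
        <= eps * (Rabs (t' - t) + Rabs (x' - x))) n) as [d [Hd Hdiff]].
  { intros j Hj. destruct (HC j Hj) as [HCj _].
    destruct (C1_half_differentiable T _ _ _ t x HCj Htx eps Heps) as [d [Hd Hdiff]].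
    exists d. split; [exact Hd|]. intros d' Hd' t' x' Ht' Hx' H1 H2. apply Hdiff; auto; lra. }
  assert (Hd2 : 0 < d / (2 * (1 + Q))) by (apply Rdiv_lt_0_compat; lra).
  destruct (Hineq (Rmin (c / 4) (d / (2 * (1 + Q))))) as [h [Hh [Hht [j [k [l [Hj [Hk [Hxk [Hg HH]]]]]]]]]];
    [apply Rmin_glb_lt; lra|].
  assert (Hh1 : h < c / 4) by (eapply Rlt_le_trans; [apply Hh|apply Rmin_l]).
  assert (Hh2 : h * (1 + Q) <= d / 2).
  { assert (Hh3 : h <= d / (2 * (1 + Q))) by (left; eapply Rlt_le_trans; [apply Hh|apply Rmin_r]).
    apply Rmult_le_compat_r with (r := 1 + Q) in Hh3; [|lra].
    replace (d / (2 * (1 + Q)) * (1 + Q)) with (d / 2) in Hh3 by (field; lra). exact Hh3. }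
  destruct (HC j Hj) as [_ [Ev Ea]]. destruct Htx as [Ht Hx].
  assert (Eh : Rabs (t - h - t) = h).
  { replace (t - h - t) with (- h) by ring. rewrite Rabs_Ropp. apply Rabs_pos_eq; lra. }
  assert (Ek : Rabs (x - k - x) = Rabs k).
  { replace (x - k - x) with (- k) by ring. apply Rabs_Ropp. }
  assert (0 <= Q * h) by (apply Rmult_le_pos; lra).
  assert (HD := Hdiff j Hj (t - h) (x - k) ltac:(lra) Hxk ltac:(lra) ltac:(lra)).
  rewrite Eh, Ek, Ev, Ea in HD.
  assert (HD2 : eps * (h + Rabs k) <= h * (eps * (1 + Q))).
  { replace (h * (eps * (1 + Q))) with (eps * (h + Q * h)) by ring. apply Rmult_le_compat_l; lra. }
  rewrite Hepsq in HD2.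
  pose proof (Rle_abs (- (g j (t - h) (x - k) - v - a * (t - h - t) - gx j t x * (x - k - x)))) as HA.
  rewrite Rabs_Ropp in HA.
  assert (Hhc : h * c = - (h * a) - h * Hval) by (unfold c; ring).
  assert (h * h < h * (c / 4)) by (apply Rmult_lt_compat_l; lra).
  assert (0 < h * c) by (apply Rmult_lt_0_compat; lra). nra.
Qed.

Section Solution.
Context (N : nat) (e : nat -> pt) (T : R) {L w0 : nat -> R -> R} {j0 : nat} {K0 C : R}.
Hypothesis HN : (1 <= N)%nat.
Hypothesis Hunit : forall i, (i < N)%nat -> fst (e i) ^ 2 + snd (e i) ^ 2 = 1.
Hypothesis Hdist : forall i j, (i < N)%nat -> (j < N)%nat -> i <> j -> e i <> e j.
Hypothesis Hd : admissible N L w0 j0 K0 C.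

Notation l0 := (L j0 0).
Notation A := (vertex_value N L w0 l0).
Notation val := (value N L w0 l0).

Definition solution (t : R) (p : pt) : R := lift N e (val t) p.

Lemma solution_smul t i x : (i < N)%nat -> 0 <= x -> solution t (smul x (e i)) = val t i x.
Proof.
  intros Hi Hx. apply lift_smul; auto. intros j k Hj Hk.
  destruct (Rle_dec 0 t) as [Ht|Ht]; [rewrite !(value_vertex Hd) by auto; reflexivity|].
  unfold value. destruct (Rle_dec t 0); [|lra]. apply Hd; auto.
Qed.

Lemma solution_continuous t p : inDom T N e t p -> forall eps, eps > 0 -> exists r, r > 0 /\
  forall s p', inDom T N e s p' -> pdist N e t p s p' < r -> Rabs (solution s p' - solution t p) < eps.
Proof.
  intros [Ht Hp] eps Heps. pose proof (adm_C _ _ _ _ _ _ Hd) as HC.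
  exists (eps / (6 * C)). split; [apply Rdiv_lt_0_compat; lra|].
  intros s p' [Hs Hp'] Hpd.
  destruct (inJ_coord N e p Hp) as [i [x [Hi [Hx ->]]]].
  destruct (inJ_coord N e p' Hp') as [j [y [Hj [Hy ->]]]].
  apply pdist_smul in Hpd as [H1 H2]; auto. rewrite !solution_smul by auto.
  rewrite Rabs_minus_sym. eapply Rle_lt_trans; [apply (value_lipschitz Hd); auto; lra|].
  rewrite (Rabs_minus_sym t s).
  assert (3 * C * (Rabs (s - t) + bdist i x j y) < 3 * C * (eps / (6 * C) + eps / (6 * C)))
    by (apply Rmult_lt_compat_l; lra).
  replace (3 * C * (eps / (6 * C) + eps / (6 * C))) with eps in H by (field; lra). exact H.
Qed.

(** All branches restrict to the same function of time at the vertex. This justifies the use of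
    branch 0 in the junction condition. *)
Lemma test_time_derivative phi phit phix j t :
  C1_star T N e phi phit phix -> (j < N)%nat -> 0 < t < T -> phit j t 0 = phit 0%nat t 0.
Proof.
  intros [_ Hphi] Hj Ht.
  destruct (Hphi j Hj) as [_ [_ [_ H1]]]. destruct (H1 t 0) as [D1 _]; [split; [exact Ht|lra]|].
  destruct (Hphi 0%nat HN) as [_ [_ [_ H2]]]. destruct (H2 t 0) as [D2 _]; [split; [exact Ht|lra]|].
  rewrite smul0 in D1, D2. exact (uniqueness_limite _ _ _ _ D1 D2).
Qed.

Lemma solution_subsol : subsol T N e L solution.
Proof.
  unpack Hd. split.
  { intros t p Hp eps Heps. destruct (solution_continuous t p Hp eps Heps) as [r [Hr H]].
    exists r. split; [exact Hr|]. intros s y Hs Hpd. specialize (H s y Hs Hpd). apply Rabs_def2 in H. lra. }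
  intros phi phit phix Hphi t p r [Ht Hp] Hr Hle Heq.
  (* The point [x - q * h] must stay in the branch: from [x > 0] every [q] is allowed for a short
     time, from the vertex only [q <= 0]. This is how [Hminus] enters the junction condition. *)
  assert (Hcore : forall i x q, (i < N)%nat -> 0 <= x -> p = smul x (e i) -> 0 < x \/ q <= 0 ->
    phit i t x + q * phix i t x <= L i q).
  { intros i x q Hi Hx Ep Hxq. destruct (proj2 Hphi i Hi) as [H1 [H2 [H3 H4]]].
    assert (Hq := Rabs_pos q).
    assert (Hh0 : exists h0, 0 < h0 /\ h0 <= t /\ h0 * (1 + Rabs q) <= r /\
      (0 < x -> h0 * (1 + Rabs q) <= x)).
    { set (m := if Rlt_dec 0 x then Rmin r x else r).
      assert (Hm : 0 < m /\ m <= r /\ (0 < x -> m <= x)).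
      { unfold m. destruct (Rlt_dec 0 x); [|repeat split; lra].
        pose proof (Rmin_l r x). pose proof (Rmin_r r x). split; [apply Rmin_glb_lt; lra|split; [lra|auto]]. }
      exists (Rmin t (m / (1 + Rabs q))).
      assert (0 < m / (1 + Rabs q)) by (apply Rdiv_lt_0_compat; lra).
      assert (Hb : Rmin t (m / (1 + Rabs q)) * (1 + Rabs q) <= m).
      { apply Rle_trans with (m / (1 + Rabs q) * (1 + Rabs q)); [|right; field; lra].
        apply Rmult_le_compat_r; [lra|apply Rmin_r]. }
      split; [apply Rmin_glb_lt; lra|]. split; [apply Rmin_l|]. split; [lra|].
      intros Hx0. destruct Hm as [_ [_ Hm]]. specialize (Hm Hx0). lra. }
    destruct Hh0 as [h0 [Hh0 [Hh0t [Hh0r Hh0x]]]].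
    apply (C1_half_transport_le T (fun t s => phi t (smul s (e i))) (phit i) (phix i) t x q (L i q) h0);
      [repeat split; auto; apply H4; auto|split; auto|exact Hh0|].
    intros h Hh. split; [lra|].
    assert (Hqh : Rabs (q * h) < h0 * (1 + Rabs q)).
    { rewrite Rabs_mult, (Rabs_pos_eq h) by lra.
      apply Rle_lt_trans with (Rabs q * h0); [apply Rmult_le_compat_l; lra|lra]. }
    assert (Hxq0 : 0 <= x - q * h).
    { destruct Hxq as [Hx0|Hq0]; [specialize (Hh0x Hx0); apply Rabs_def2 in Hqh; lra|].
      assert (q * h <= 0) by (rewrite <- (Rmult_0_l h); apply Rmult_le_compat_r; lra). lra. }
    split; [exact Hxq0|].
    rewrite <- Ep, <- Heq, Ep, solution_smul by auto.
    apply Rle_trans with (val (t - h) i (x - q * h) + h * L i q).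
    - assert (HS := value_segment Hd (t - h) t i x (x - q * h) Hi ltac:(lra) ltac:(lra) Hx Hxq0).
      replace (t - (t - h)) with h in HS by ring.
      replace ((x - (x - q * h)) / h) with q in HS by (field; lra). exact HS.
    - apply Rplus_le_compat_r. rewrite <- solution_smul by auto. apply Hle.
      + split; [lra|apply inJ_smul; auto].
      + rewrite Ep. apply pdist_smul; auto. rewrite bdist_same.
        replace (t - h - t) with (- h) by ring. replace (x - (x - q * h)) with (q * h) by ring.
        rewrite Rabs_Ropp, (Rabs_pos_eq h) by lra. split; [|lra].
        assert (0 <= h0 * Rabs q) by (apply Rmult_le_pos; lra). lra. }
  split.
  - intros i x Hib Hx Ep. assert (Hi L i (phix i t x) <= - phit i t x); [|lra].
    apply (Hi_le N L HL); [exact Hib|]. intros q.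
    assert (H := Hcore i x q Hib ltac:(lra) Ep (or_introl Hx)). lra.
  - intros Ep. assert (H0 N L (fun j => phix j t 0) <= - phit 0%nat t 0); [|lra].
    apply H0_le; [exact HN|]. intros j Hj. apply (Hminus_le N L HL); [exact Hj|]. intros q Hq.
    assert (H := Hcore j 0 q Hj ltac:(lra) ltac:(rewrite smul0; exact Ep) (or_intror Hq)).
    rewrite (test_time_derivative phi phit phix j t Hphi Hj Ht) in H. lra.
Qed.

Lemma vertex_near_minimiser t eta :
  0 < t -> 0 < eta -> exists m, vertex_cost N L w0 l0 t m /\ m < A t + eta.
Proof.
  intros Ht Heta. apply NNPP. intro Hn.
  assert (A t + eta <= A t); [|lra]. apply (vertex_value_glb Hd t Ht).
  intros m Hm. apply Rnot_lt_le. intro Hlt. apply Hn. exists m. auto.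
Qed.

Lemma branch_near_minimiser t i x eta :
  (i < N)%nat -> 0 < t -> 0 < x -> 0 < eta -> exists m, branch_cost N L w0 l0 t i x m /\ m < val t i x + eta.
Proof.
  intros Hi Ht Hx Heta. apply NNPP. intro Hn.
  assert (val t i x + eta <= val t i x); [|lra]. apply (value_glb Hd t i x Hi Ht Hx).
  intros m Hm. apply Rnot_lt_le. intro Hlt. apply Hn. exists m. auto.
Qed.

(* Near-optimal trajectories ending at an interior point have bounded speed near
   their end, which therefore stays in the branch. *)
Lemma value_backward_step t i x :
  (i < N)%nat -> 0 < t -> 0 < x -> exists Q hm, 0 <= Q /\ 0 < hm /\
    forall h, 0 < h < hm -> h < t /\ exists q, Rabs q <= Q /\ 0 <= x - q * h /\
      val (t - h) i (x - q * h) + h * L i q <= val t i x + h ^ 2.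
Proof.
  unpack Hd. intros Hi Ht Hx.
  destruct (uniform_growth N L HL (K0 + 1)) as [c [Hc Hgr]].
  set (B := val t i x + 1 - w0 0%nat 0 + C * t).
  (* Covering the distance [x] in time [th] costs at least [B + 1 - c' * th], while near-optimality
     leaves at most [B]; so a trajectory coming from the vertex left it early enough to have
     [1 <= c' * th]. *)
  destruct (uniform_growth N L HL ((B + 1) / x)) as [c' [Hc' Hgr']].
  (* The first bound is for lines from time 0, where the growth [K0 + 1] of the cost beats the slope
     [K0] of the datum; the second is for lines from the vertex, of duration bounded below. *)
  set (Q := Rmax (c + C + 1 / t) (x * (c' + 1))).
  assert (HQ : 0 <= Q).
  { apply Rle_trans with (2 := Rmax_r _ _). apply Rmult_le_pos; lra. }
  (* [/ (c' + 1)] keeps the step after the departure from the vertex, and [x / (Q + 1)] keeps it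
     inside the branch. *)
  set (hm := Rmin (Rmin 1 t) (Rmin (/ (c' + 1)) (x / (Q + 1)))).
  assert (Hic : 0 < / (c' + 1)) by (apply Rinv_0_lt_compat; lra).
  assert (Hxq : 0 < x / (Q + 1)) by (apply Rdiv_lt_0_compat; lra).
  exists Q, hm. split; [exact HQ|]. split; [unfold hm; repeat apply Rmin_glb_lt; lra|].
  intros h Hh.
  assert (Hhb : h < 1 /\ h < t /\ h < / (c' + 1) /\ h < x / (Q + 1)).
  { unfold hm in Hh.
    pose proof (Rmin_l (Rmin 1 t) (Rmin (/ (c' + 1)) (x / (Q + 1)))).
    pose proof (Rmin_r (Rmin 1 t) (Rmin (/ (c' + 1)) (x / (Q + 1)))).
    pose proof (Rmin_l 1 t). pose proof (Rmin_r 1 t).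
    pose proof (Rmin_l (/ (c' + 1)) (x / (Q + 1))). pose proof (Rmin_r (/ (c' + 1)) (x / (Q + 1))). lra. }
  destruct Hhb as [Hh1 [Hh2 [Hh3 Hh4]]]. split; [exact Hh2|].
  assert (Hstay : forall q, Rabs q <= Q -> 0 <= x - q * h).
  { intros q Hq. assert (Q * h <= x).
    { apply Rle_trans with ((Q + 1) * h); [lra|].
      apply Rle_trans with ((Q + 1) * (x / (Q + 1))); [apply Rmult_le_compat_l; lra|right; field; lra]. }
    assert (q * h <= Q * h) by (apply Rmult_le_compat_r; [lra|]; pose proof (Rle_abs q); lra). lra. }
  destruct (branch_near_minimiser t i x (h ^ 2) Hi Ht Hx) as [m [Hm Hmv]]; [apply pow_lt; lra|].
  assert (Hh2' : h ^ 2 <= 1) by nra.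
  destruct Hm as [[y [Hy ->]]|[s [Hs ->]]].
  - set (q := (x - y) / t) in *. assert (Eq : x = y + q * t) by (unfold q; field; lra).
    assert (Hq : Rabs q <= Q).
    { apply Rle_trans with (2 := Rmax_l _ _).
      assert (H1 := value_initial Hd t i x Hi ltac:(lra) ltac:(lra)).
      assert (H2 := Hw0 i x y Hi ltac:(lra) Hy).
      replace (x - y) with (q * t) in H2 by (rewrite Eq; ring).
      rewrite Rabs_mult, (Rabs_pos_eq t) in H2 by lra.
      pose proof (Rle_abs (val t i x - w0 i x)). pose proof (Rle_abs (w0 i x - w0 i y)).
      specialize (Hgr i q Hi).
      assert (H3 : t * ((K0 + 1) * Rabs q - c) <= t * L i q) by (apply Rmult_le_compat_l; lra).
      apply Rmult_le_reg_l with t; [exact Ht|].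
      replace (t * (c + C + 1 / t)) with (t * c + C * t + 1) by (field; lra). lra. }
    exists q. split; [exact Hq|]. split; [auto|].
    assert (val (t - h) i (x - q * h) <= w0 i y + (t - h) * L i q); [|lra].
    apply (value_le Hd); auto; [lra|]. left. exists y. split; [exact Hy|].
    do 2 f_equal. f_equal. rewrite Eq. field. lra.
  - set (q := x / (t - s)) in *. assert (Eq : x = q * (t - s)) by (unfold q; field; lra).
    assert (Hts : 1 <= c' * (t - s)).
    { assert (H1 := vertex_value_cut Hd 0 s ltac:(lra) ltac:(lra)). rewrite vertex_value_0 in H1.
      assert (C * s <= C * t) by (apply Rmult_le_compat_l; lra).
      assert (H2 := perspective_growth (L i) ((B + 1) / x) c' (t - s) x (fun q => Hgr' i q Hi) ltac:(lra)).
      rewrite (Rabs_pos_eq x) in H2 by lra. replace ((B + 1) / x * x) with (B + 1) in H2 by (field; lra).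
      fold q in H2. unfold B in H2. lra. }
    assert (Hinv : / (c' + 1) < t - s).
    { apply Rmult_lt_reg_l with (c' + 1); [lra|]. rewrite Rinv_r by lra. lra. }
    assert (Hq0 : 0 < q) by (unfold q; apply Rdiv_lt_0_compat; lra).
    assert (Hq : Rabs q <= Q).
    { apply Rle_trans with (2 := Rmax_r _ _). rewrite Rabs_pos_eq by lra.
      unfold q. apply Rmult_le_reg_r with (t - s); [lra|].
      replace (x / (t - s) * (t - s)) with x by (field; lra). nra. }
    exists q. split; [exact Hq|]. split; [auto|].
    assert (H1 := value_le_of_vertex Hd s (t - h) i (x - q * h) Hi ltac:(lra) (Hstay q Hq)).
    replace ((x - q * h) / (t - h - s)) with q in H1 by (rewrite Eq; field; lra). lra.
Qed.

(** During the last [h] units a near-optimal trajectory moves for a time [sg] at velocity [q] and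
    waits for the rest; both cases, arrival before or after [t - h], fit this form. *)
Lemma vertex_backward_step t : 0 < t -> exists Q hm, 0 <= Q /\ 0 < hm /\
  forall h, 0 < h < hm -> h < t /\ exists j q sg, (j < N)%nat /\ q <= 0 /\ - q <= Q /\ 0 <= sg <= h /\
    val (t - h) j (- (q * sg)) + (sg * L j q + (h - sg) * l0) <= A t + h ^ 2.
Proof.
  unpack Hd. intros Ht.
  destruct (uniform_growth N L HL (K0 + 1)) as [c [Hc Hgr]].
  assert (H2t : 0 < 2 / t) by (apply Rdiv_lt_0_compat; lra).
  (* A trajectory still moving after [t - h] has [tau > t / 2], and its cost bound gives
     [tau * - q <= tau * (c + C) + 1]. *)
  exists (c + C + 2 / t), (Rmin 1 (t / 2)). split; [lra|]. split; [apply Rmin_glb_lt; lra|].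
  intros h Hh. pose proof (Rmin_l 1 (t / 2)). pose proof (Rmin_r 1 (t / 2)). split; [lra|].
  destruct (vertex_near_minimiser t (h ^ 2) Ht) as [m [[j [y [tau [Hj [Hy [Htau ->]]]]]] Hm]]; [apply pow_lt; lra|].
  set (q := - y / tau) in *. assert (Eq : y = - q * tau) by (unfold q; field; lra).
  destruct (Rle_dec tau (t - h)) as [Hc1|Hc1].
  - exists j0, 0, 0. split; [exact Hj0|]. split; [lra|]. split; [lra|]. split; [lra|].
    replace (- (0 * 0)) with 0 by ring. rewrite (value_vertex Hd) by (auto; lra).
    assert (A (t - h) <= w0 j y + tau * L j q + (t - h - tau) * l0); [|lra].
    apply (vertex_value_glb Hd); [lra|]. exists j, y, tau. repeat split; auto; lra.
  - assert (Hq0 : q <= 0).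
    { unfold q. assert (0 <= y / tau) by (apply Rle_mult_inv_pos; lra).
      replace (- y / tau) with (- (y / tau)) by (field; lra). lra. }
    exists j, q, (tau - (t - h)). split; [exact Hj|]. split; [exact Hq0|].
    assert (Hy' : 0 <= - (q * (tau - (t - h)))).
    { rewrite Ropp_mult_distr_l. apply Rmult_le_pos; lra. }
    split; [|split; [lra|]].
    + assert (H1 := Hw0 j 0 y Hj ltac:(lra) Hy).
      rewrite Rminus_0_l, Rabs_Ropp, (Rabs_pos_eq y) in H1 by lra.
      rewrite (Hw00 j 0%nat) in H1 by (auto; lia).
      assert (Hab := Rle_abs (w0 0%nat 0 - w0 j y)).
      assert (H2 := vertex_value_wait Hd 0 t ltac:(lra) ltac:(lra)). rewrite vertex_value_0 in H2.
      specialize (Hgr j q Hj). rewrite Rabs_left1 in Hgr by exact Hq0.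
      assert (H3 : tau * ((K0 + 1) * - q - c) <= tau * L j q) by (apply Rmult_le_compat_l; lra).
      assert (H4 := wait_cost_bound Hd).
      assert (tau * l0 <= tau * C) by (apply Rmult_le_compat_l; lra).
      assert (h ^ 2 <= 1) by nra.
      assert (Htq : tau * - q <= tau * c + tau * C + 1).
      { replace (K0 * y) with (K0 * (tau * - q)) in H1 by (rewrite Eq; ring). lra. }
      apply Rmult_le_reg_l with tau; [lra|].
      assert (1 <= tau * (2 / t)).
      { apply Rle_trans with (t / 2 * (2 / t)); [right; field; lra|]. apply Rmult_le_compat_r; lra. }
      lra.
    + assert (val (t - h) j (- (q * (tau - (t - h)))) <= w0 j y + (t - h) * L j q).
      { apply (value_le Hd); auto; [lra|]. left. exists y. split; [exact Hy|].
        do 2 f_equal. f_equal. rewrite Eq. field. lra. }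
      lra.
Qed.

Lemma solution_supersol : supersol T N e L solution.
Proof.
  unpack Hd. split.
  { intros t p Hp eps Heps. destruct (solution_continuous t p Hp eps Heps) as [r [Hr H]].
    exists r. split; [exact Hr|]. intros s y Hs Hpd. specialize (H s y Hs Hpd). apply Rabs_def2 in H. lra. }
  intros phi phit phix Hphi t p r [Ht Hp] Hr Hle Heq.
  assert (Hball : forall Q, 0 <= Q -> exists hr, 0 < hr /\ forall h k, 0 < h < hr -> Rabs k <= Q * h ->
    h < r /\ Rabs k < r).
  { intros Q HQ. exists (r / (Q + 1)). split; [apply Rdiv_lt_0_compat; lra|].
    intros h k Hh Hk. assert ((Q + 1) * h < r).
    { apply Rlt_le_trans with ((Q + 1) * (r / (Q + 1))); [apply Rmult_lt_compat_l; lra|right; field; lra]. }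
    assert (0 <= Q * h) by (apply Rmult_le_pos; lra). lra. }
  split.
  - intros i x Hib Hx Ep. apply Rle_ge.
    destruct (value_backward_step t i x Hib ltac:(lra) Hx) as [Q [hm [HQ [Hhm Hstep]]]].
    destruct (Hball Q HQ) as [hr [Hhr Hin]].
    apply (C1_half_transport_ge T 1 (fun _ t s => phi t (smul s (e i))) (fun _ => phit i) (fun _ => phix i)
      t x (phi t (smul x (e i))) (phit i t x) Q).
    + intros _ _. split; [apply (proj2 Hphi i Hib)|auto].
    + split; [exact Ht|lra].
    + exact HQ.
    + intros h0 Hh0. set (h := Rmin h0 (Rmin hm hr) / 2).
      assert (Hh : 0 < h /\ h < h0 /\ h < hm /\ h < hr).
      { assert (0 < Rmin h0 (Rmin hm hr)) by (repeat apply Rmin_glb_lt; lra).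
        pose proof (Rmin_l h0 (Rmin hm hr)). pose proof (Rmin_r h0 (Rmin hm hr)).
        pose proof (Rmin_l hm hr). pose proof (Rmin_r hm hr). unfold h. lra. }
      destruct (Hstep h ltac:(lra)) as [Hht [q [Hq [Hxq Hv]]]].
      assert (Hqh : Rabs (q * h) <= Q * h).
      { rewrite Rabs_mult, (Rabs_pos_eq h) by lra. apply Rmult_le_compat_r; lra. }
      exists h. split; [lra|]. split; [exact Hht|]. exists 0%nat, (q * h), (L i q).
      split; [lia|]. split; [exact Hqh|]. split; [exact Hxq|].
      rewrite <- Ep, <- Heq, Ep, solution_smul by (auto; lra). split.
      * eapply Rle_trans; [|exact Hv]. apply Rplus_le_compat_r. rewrite <- solution_smul by auto.
        apply Hle; [split; [lra|apply inJ_smul; auto]|].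
        destruct (Hin h (q * h) ltac:(lra) Hqh) as [G1 G2].
        rewrite Ep. apply pdist_smul; auto; [lra|]. rewrite bdist_same.
        replace (t - h - t) with (- h) by ring. replace (x - (x - q * h)) with (q * h) by ring.
        rewrite Rabs_Ropp, (Rabs_pos_eq h) by lra. auto.
      * assert (H := Hi_ge N L HL i (phix i t x) q Hib).
        apply Rmult_le_compat_l with (r := h) in H; [|lra]. lra.
  - intros Ep. apply Rle_ge.
    destruct (vertex_backward_step t ltac:(lra)) as [Q [hm [HQ [Hhm Hstep]]]].
    destruct (Hball Q HQ) as [hr [Hhr Hin]].
    apply (C1_half_transport_ge T N (fun j t s => phi t (smul s (e j))) phit phix
      t 0 (phi t (0, 0)) (phit 0%nat t 0) Q).
    + intros j Hj. split; [apply (proj2 Hphi j Hj)|]. rewrite smul0. split; [reflexivity|].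
      apply (test_time_derivative phi phit phix j t Hphi Hj Ht).
    + split; [exact Ht|lra].
    + exact HQ.
    + intros h0 Hh0. set (h := Rmin h0 (Rmin hm hr) / 2).
      assert (Hh : 0 < h /\ h < h0 /\ h < hm /\ h < hr).
      { assert (0 < Rmin h0 (Rmin hm hr)) by (repeat apply Rmin_glb_lt; lra).
        pose proof (Rmin_l h0 (Rmin hm hr)). pose proof (Rmin_r h0 (Rmin hm hr)).
        pose proof (Rmin_l hm hr). pose proof (Rmin_r hm hr). unfold h. lra. }
      destruct (Hstep h ltac:(lra)) as [Hht [j [q [sg [Hj [Hq [HqQ [Hsg Hv]]]]]]]].
      assert (Hqs : 0 <= - (q * sg)) by (rewrite Ropp_mult_distr_l; apply Rmult_le_pos; lra).
      assert (Hqh : Rabs (q * sg) <= Q * h).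
      { rewrite Rabs_left1 by lra. rewrite Ropp_mult_distr_l. apply Rmult_le_compat; lra. }
      exists h. split; [lra|]. split; [exact Hht|].
      (* The cost rate is the average of moving and waiting. Moving is estimated by [Hminus] of
         branch [j], since [q <= 0], and waiting by [Hminus] of branch [j0] at speed 0; both are
         below [H0]. *)
      exists j, (q * sg), ((sg * L j q + (h - sg) * l0) / h).
      split; [exact Hj|]. split; [exact Hqh|]. split; [lra|].
      replace (h * ((sg * L j q + (h - sg) * l0) / h)) with (sg * L j q + (h - sg) * l0) by (field; lra).
      assert (E0 : phi t (0, 0) = A t).
      { rewrite <- Ep, <- Heq, Ep, <- (smul0 (e 0%nat)), solution_smul by (auto; lra).
        apply (value_vertex Hd); [exact HN|lra]. }
      rewrite E0, Rminus_0_l. split.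
      * eapply Rle_trans; [|exact Hv]. apply Rplus_le_compat_r. rewrite <- solution_smul by auto.
        apply Hle; [split; [lra|apply inJ_smul; auto]|].
        destruct (Hin h (q * sg) ltac:(lra) Hqh) as [G1 G2].
        rewrite Ep, <- (smul0 (e j)). apply pdist_smul; auto; [lra|]. rewrite bdist_same.
        replace (t - h - t) with (- h) by ring. replace (0 - - (q * sg)) with (q * sg) by ring.
        rewrite Rabs_Ropp, (Rabs_pos_eq h) by lra. auto.
      * assert (H1 := H0_ge N L HN (fun j => phix j t 0) j Hj). cbv beta in H1.
        assert (H2 := Hminus_ge N L HL j (phix j t 0) q Hj Hq).
        assert (H3 := H0_ge N L HN (fun j => phix j t 0) j0 Hj0). cbv beta in H3.
        assert (H4 := Hminus_ge N L HL j0 (phix j0 t 0) 0 Hj0 ltac:(lra)).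
        set (HH := H0 N L (fun j => phix j t 0)) in *.
        assert (sg * (phix j t 0 * q - L j q) <= sg * HH) by (apply Rmult_le_compat_l; lra).
        assert ((h - sg) * - l0 <= (h - sg) * HH) by (apply Rmult_le_compat_l; lra).
        lra.
Qed.

Lemma subsol_le_value U i x t :
  subsol T N e L U -> (forall i x, (i < N)%nat -> 0 <= x -> U 0 (smul x (e i)) <= w0 i x) ->
  (i < N)%nat -> 0 <= x -> 0 <= t < T -> U t (smul x (e i)) <= val t i x.
Proof.
  unpack Hd. intros HU HU0 Hi Hx Ht.
  assert (Hseg := fun i s t x y => subsol_segment N e T L HN Hunit Hdist HL U i s t x y HU).
  assert (Hvert : forall s, 0 <= s < T -> U s (0, 0) <= A s).
  { intros s Hs. destruct (Req_dec s 0) as [->|Hs0].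
    - rewrite vertex_value_0, <- (smul0 (e 0%nat)). apply HU0; [exact HN|lra].
    - apply (vertex_value_glb Hd); [lra|]. intros m [j [y [tau [Hj [Hy [Htau ->]]]]]].
      assert (H1 : U tau (0, 0) <= w0 j y + tau * L j (- y / tau)).
      { assert (H := Hseg j 0 tau 0 y Hj ltac:(lra) ltac:(lra) ltac:(lra) ltac:(lra) Hy).
        rewrite smul0, Rminus_0_l, Rminus_0_r in H. specialize (HU0 j y Hj Hy). lra. }
      destruct (Req_dec tau s) as [<-|Hts]; [lra|].
      (* Waiting at the vertex is a segment of zero velocity in the cheapest branch. *)
      assert (H := Hseg j0 tau s 0 0 Hj0 ltac:(lra) ltac:(lra) ltac:(lra) ltac:(lra) ltac:(lra)).
      rewrite smul0 in H. replace ((0 - 0) / (s - tau)) with 0 in H by (field; lra). lra. }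
  destruct (Req_dec t 0) as [->|Ht0]; [rewrite value_0; apply HU0; assumption|].
  destruct (Req_dec x 0) as [->|Hx0].
  { rewrite smul0, (value_vertex Hd) by (auto; lra). apply Hvert; exact Ht. }
  apply (value_glb Hd); [exact Hi|lra|lra|]. intros m [[y [Hy ->]]|[s [Hs ->]]].
  - assert (H := Hseg i 0 t x y Hi ltac:(lra) ltac:(lra) ltac:(lra) Hx Hy).
    rewrite Rminus_0_r in H. specialize (HU0 i y Hi Hy). lra.
  - assert (H := Hseg i s t x 0 Hi ltac:(lra) ltac:(lra) ltac:(lra) Hx ltac:(lra)).
    rewrite smul0, Rminus_0_r in H. specialize (Hvert s ltac:(lra)). lra.
Qed.

End Solution.

(** * Choice of the constants and conclusion *)

Lemma admissible_exists N e L gamma (u0 : pt -> R) :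
  (1 <= N)%nat ->
  (forall i, (i < N)%nat -> fst (e i) ^ 2 + snd (e i) ^ 2 = 1) ->
  (forall i j, (i < N)%nat -> (j < N)%nat -> i <> j -> e i <> e j) ->
  (exists K, forall x y, inJ N e x -> inJ N e y -> Rabs (u0 x - u0 y) <= K * dJ N e x y) ->
  gamma > 0 ->
  (forall i, (i < N)%nat -> exists L1 L2 : R -> R,
     (forall q, derivable_pt_lim (L i) q (L1 q)) /\
     (forall q, derivable_pt_lim L1 q (L2 q)) /\
     continuity L2 /\ (forall q, gamma <= L2 q)) ->
  exists j0 K0 C, 0 <= K0 /\ admissible N L (fun i x => u0 (smul x (e i))) j0 K0 C.
Proof.
  intros HN Hunit Hdist [K HK] Hgamma HLag.
  assert (HL : forall i, (i < N)%nat -> regular_lagrangian (L i)).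
  { intros i Hi. destruct (HLag i Hi) as [L1 [L2 [H1 [H2 [_ H3]]]]].
    exact (uniformly_convex_regular (L i) L1 L2 gamma Hgamma H1 H2 H3). }
  destruct (finite_min (fun i m => m = L i 0) N HN) as [j0 [m [Hj0 [-> Hmin]]]];
    [intros i _; exists (L i 0); reflexivity|].
  set (K0 := Rmax K 0). assert (HK0 : 0 <= K0) by apply Rmax_r.
  assert (HKK : K <= K0) by apply Rmax_l.
  destruct (uniform_growth N L HL K0) as [c [Hc Hgr]].
  destruct (finite_bound (fun i => Rmax (L i 1) (L i (-1))) N) as [B HB].
  (* [c] serves the growth bound, [B] the cost at speed at most one, and [K0 + 1] ensures both
     [K0 <= C] and [0 < C]. *)
  exists j0, K0, (Rmax (Rmax c B) (K0 + 1)).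
  assert (HC1 : c <= Rmax (Rmax c B) (K0 + 1)) by (eapply Rle_trans; [apply Rmax_l|apply Rmax_l]).
  assert (HC2 : B <= Rmax (Rmax c B) (K0 + 1)) by (eapply Rle_trans; [apply Rmax_r|apply Rmax_l]).
  assert (HC3 : K0 + 1 <= Rmax (Rmax c B) (K0 + 1)) by apply Rmax_r.
  split; [exact HK0|]. constructor; auto; try lra.
  - intros j Hj. destruct (Hmin j Hj) as [m' [-> H]]. exact H.
  - intros i x y Hi Hx Hy.
    eapply Rle_trans; [apply HK; apply inJ_smul; auto|].
    rewrite (dJ_smul N e Hunit Hdist), bdist_same by auto.
    apply Rmult_le_compat_r; [apply Rabs_pos|exact HKK].
  - intros i j _ _. rewrite !smul0. reflexivity.
  - intros i q Hi. specialize (Hgr i q Hi). lra.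
  (* The tangent at [q] bounds [L i q] by [L i 1] or by [L i (-1)], according to the sign of its
     slope. *)
  - intros i q Hi Hq. destruct (HL i Hi) as [_ [Ht _]]. destruct (Ht q) as [p [Hp _]].
    specialize (HB i Hi). cbv beta in HB.
    pose proof (Rmax_l (L i 1) (L i (-1))). pose proof (Rmax_r (L i 1) (L i (-1))).
    assert (H1 := Hp 1). assert (H2 := Hp (-1)).
    assert (-1 <= q <= 1) by (pose proof (Rle_abs q); pose proof (Rle_abs (- q)); rewrite Rabs_Ropp in *; lra).
    destruct (Rle_dec 0 p).
    + assert (0 <= p * (1 - q)) by (apply Rmult_le_pos; lra). lra.
    + assert (0 <= (- p) * (1 + q)) by (apply Rmult_le_pos; lra). lra.
Qed.

Theorem mainTheorem1 (N : nat) (e : nat -> pt) (L : nat -> R -> R) (gamma : R)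
    (u0 : pt -> R) (T : R) :
  (1 <= N)%nat ->
  (forall i, (i < N)%nat -> fst (e i) ^ 2 + snd (e i) ^ 2 = 1) ->
  (forall i j, (i < N)%nat -> (j < N)%nat -> i <> j -> e i <> e j) ->
  (* (A0) *)
  (exists K, forall x y, inJ N e x -> inJ N e y ->
     Rabs (u0 x - u0 y) <= K * dJ N e x y) ->
  (* (A1) *)
  gamma > 0 ->
  (forall i, (i < N)%nat -> exists L1 L2 : R -> R,
     (forall q, derivable_pt_lim (L i) q (L1 q)) /\
     (forall q, derivable_pt_lim L1 q (L2 q)) /\
     continuity L2 /\ (forall q, gamma <= L2 q)) ->
  T > 0 ->
  exists u : R -> pt -> R,
    is_solution T N e L u0 u /\
    (exists C, C > 0 /\ forall t x, inJT T N e t x -> Rabs (u t x - u0 x) <= C) /\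
    (forall v : R -> pt -> R, is_solution T N e L u0 v ->
       (exists C, C > 0 /\ forall t x, inJT T N e t x -> Rabs (v t x - u0 x) <= C) ->
       forall t x, inDom T N e t x -> v t x = u t x) /\
    (exists K, forall t x s y, inJT T N e t x -> inJT T N e s y ->
       Rabs (u t x - u s y) <= K * (Rabs (t - s) + dJ N e x y)).
Proof.
  intros HN Hunit Hdist HA0 Hgamma HA1 HT.
  destruct (admissible_exists N e L gamma u0 HN Hunit Hdist HA0 Hgamma HA1) as [j0 [K0 [C [HK0 Hd]]]].
  set (w0 := fun i x => u0 (smul x (e i))) in *.
  pose proof (adm_C _ _ _ _ _ _ Hd) as HC.
  set (u := solution N e (L := L) (w0 := w0) (j0 := j0)).
  assert (Hu : forall t i x, (i < N)%nat -> 0 <= x -> u t (smul x (e i)) = value N L w0 (L j0 0) t i x)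
    by (intros; apply (solution_smul N e Hunit Hdist Hd); auto).
  assert (Hcont := solution_continuous N e T Hunit Hdist Hd). fold u in Hcont.
  assert (Hself : forall t x, inDom T N e t x -> forall r, r > 0 -> pdist N e t x t x < r).
  { intros t p [_ Hp] r Hr. destruct (inJ_coord N e p Hp) as [i [x [Hi [Hx ->]]]].
    apply pdist_smul; auto. rewrite bdist_same, !Rminus_diag, Rabs_R0. lra. }
  assert (Hinit : forall x, inJ N e x -> u 0 x = u0 x).
  { intros p Hp. destruct (inJ_coord N e p Hp) as [i [x [Hi [Hx ->]]]].
    rewrite Hu, value_0 by auto. reflexivity. }
  exists u. repeat split.
  - exists u, u. split; [|split; [|split; [|split; [|split]]]].
    + intros t x Hx. split.
      * intros eps Heps. destruct (Hcont t x Hx eps Heps) as [r [Hr H]]. exists r. split; [exact Hr|].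
        intros s y Hs Hpd. specialize (H s y Hs Hpd). apply Rabs_def2 in H. lra.
      * intros eps r Heps Hr. exists t, x. split; [exact Hx|]. split; [apply Hself; auto|lra].
    + intros t x Hx. split.
      * intros eps Heps. destruct (Hcont t x Hx eps Heps) as [r [Hr H]]. exists r. split; [exact Hr|].
        intros s y Hs Hpd. specialize (H s y Hs Hpd). apply Rabs_def2 in H. lra.
      * intros eps r Heps Hr. exists t, x. split; [exact Hx|]. split; [apply Hself; auto|lra].
    + apply (solution_subsol N e T HN Hunit Hdist Hd).
    + intros x Hx. rewrite Hinit by exact Hx. lra.
    + apply (solution_supersol N e T HN Hunit Hdist Hd).
    + intros x Hx. rewrite Hinit by exact Hx. lra.
  - exists (C * T). split; [apply Rmult_lt_0_compat; lra|].
    intros t p [Ht Hp]. destruct (inJ_coord N e p Hp) as [i [x [Hi [Hx ->]]]].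
    rewrite Hu by auto. eapply Rle_trans; [apply (value_initial Hd); auto; lra|].
    apply Rmult_le_compat_l; lra.
  - intros v [U [V [HUenv [HVenv [HU [HU0 [HV HV0]]]]]]] [Cv [HCv Hvb]] t p Hp.
    assert (HvU : v t p <= U t p).
    { apply le_epsilon. intros eps Heps. destruct (proj1 (HUenv t p Hp) eps Heps) as [r [Hr H]].
      left. apply H; [exact Hp|apply Hself; auto]. }
    assert (HVv : V t p <= v t p).
    { apply le_epsilon. intros eps Heps. destruct (proj1 (HVenv t p Hp) eps Heps) as [r [Hr H]].
      specialize (H t p Hp (Hself t p Hp r Hr)). lra. }
    (* The lower bound passes from [v] to its envelope through a nearby point: 1 is lost in the
       approximation, [K0] in moving by less than 1, and [Cv] in the bound on [v]. *)
    assert (HVlow : forall i s x, (i < N)%nat -> 0 <= s < T -> 0 <= x ->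
      w0 i x - (Cv + K0 + 1) <= V s (smul x (e i))).
    { intros i s x Hi Hs Hx. destruct (Req_dec s 0) as [->|Hs0].
      - specialize (HV0 (smul x (e i)) (inJ_smul N e i x Hi Hx)). unfold w0. lra.
      - assert (Hdom : inDom T N e s (smul x (e i))) by (split; [exact Hs|apply inJ_smul; auto]).
        (* A radius at most [s] keeps [s'] positive, where the bound on [v] is available. *)
        destruct (proj2 (HVenv s _ Hdom) 1 (Rmin s 1)) as [s' [p' [[Hs' Hp'] [Hpd Hlt]]]];
          [lra|apply Rmin_glb_lt; lra|].
        pose proof (Rmin_l s 1). pose proof (Rmin_r s 1).
        destruct (inJ_coord N e p' Hp') as [j [y [Hj [Hy ->]]]].
        apply pdist_smul in Hpd as [G1 G2]; auto. apply Rabs_def2 in G1.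
        assert (G3 := Hvb s' (smul y (e j)) ltac:(split; [lra|exact Hp'])).
        assert (G4 : Rabs (w0 i x - w0 j y) <= K0 * bdist i x j y).
        { unpack Hd. unfold bdist. destruct (Nat.eq_dec i j) as [<-|Hij]; [auto|].
          assert (F1 := Hw0 i x 0 Hi Hx ltac:(lra)). assert (F2 := Hw0 j y 0 Hj Hy ltac:(lra)).
          rewrite Rminus_0_r, (Rabs_pos_eq x) in F1 by assumption.
          rewrite Rminus_0_r, (Rabs_pos_eq y) in F2 by assumption.
          rewrite (Hw00 i j) in F1 by auto.
          replace (w0 i x - w0 j y) with ((w0 i x - w0 j 0) + - (w0 j y - w0 j 0)) by ring.
          eapply Rle_trans; [apply Rabs_triang|]. rewrite Rabs_Ropp. lra. }
        assert (G5 := Rle_abs (w0 i x - w0 j y)).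
        assert (G6 := Rle_abs (- (v s' (smul y (e j)) - u0 (smul y (e j))))). rewrite Rabs_Ropp in G6.
        assert (K0 * bdist i x j y <= K0 * 1) by (apply Rmult_le_compat_l; lra).
        change (u0 (smul y (e j))) with (w0 j y) in *. lra. }
    destruct Hp as [Ht Hp]. destruct (inJ_coord N e p Hp) as [i [x [Hi [Hx ->]]]].
    (* Since [V <= v <= U], the comparison [U <= u <= V] makes all four functions coincide. *)
    assert (H1 : U t (smul x (e i)) <= u t (smul x (e i))).
    { rewrite Hu by auto. apply (subsol_le_value N e T HN Hunit Hdist Hd); auto.
      intros j y Hj Hy. apply HU0, inJ_smul; auto. }
    assert (H2 : u t (smul x (e i)) <= V t (smul x (e i))).
    { rewrite Hu by auto.
      apply (value_le_supersol N e T L w0 j0 K0 C HN Hunit Hdist Hd V (Cv + K0 + 1)); auto.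
      intros j y Hj Hy. apply Rge_le, HV0, inJ_smul; auto. }
    lra.
  - exists (3 * C). intros t p s p' [Ht Hp] [Hs Hp'].
    destruct (inJ_coord N e p Hp) as [i [x [Hi [Hx ->]]]].
    destruct (inJ_coord N e p' Hp') as [j [y [Hj [Hy ->]]]].
    rewrite !Hu, (dJ_smul N e Hunit Hdist) by auto. apply (value_lipschitz Hd); auto; lra.
Qed.
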